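(* Let $Y(\Delta,\mathcal{S})$ be a small cover of dimension $n$ (in the generalized sense of the context), with underlying ranked poset $P$, system of subgroups $\mathcal{S}=\{\overline{\sigma}\mid\sigma\in P\}$ of $\{\pm1\}^n$, and cell complex $\Delta=\coprod_{\sigma\in P}F_\sigma$. Let $Y^\circ(\Delta,\mathcal{S})$ be the part of $Y(\Delta,\mathcal{S})$ lying over the big cell and the facets. Then: (1) $Y^\circ(\Delta,\mathcal{S})$ is orientable if and only if there exists a basis of $\{\pm1\}^n$ such that for every $\sigma\in P$ of rank $1$, the generator of $\overline{\sigma}\simeq\{\pm1\}$ is a product of an odd number of basis vectors. (2) The connected components of $Y^\circ(\Delta,\mathcal{S})$ are naturally indexed by the quotient group $\{\pm1\}^n/\langle\overline{\sigma}\mid \operatorname{rank}(\sigma)=1\rangle$ (the coset of $\xi$ corresponds to the component containing the image of $F_0\times\{\xi\}$).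
   Context: The group $\{\pm1\}^n$ is regarded as an $n$-dimensional vector space over $\mathbb{Z}/2\mathbb{Z}$, written multiplicatively; ''basis'' means a basis of this vector space, and ''a product of an odd number of basis vectors'' means a product of an odd number of distinct elements of the basis. Data for a (generalized) small cover of dimension $n$: - $P$ is a finite ranked poset with minimal element $0$ and rank at most $n$, in which any two elements have at most one minimal upper bound. - $\mathcal{S}=\{\overline{\sigma}\mid\sigma\in P\}$ is a collection of subgroups of $\{\pm1\}^n$ with $\overline{\sigma}\simeq\{\pm1\}^{\operatorname{rank}(\sigma)}$, and such that $\sigma\le\tau$ in $P$ implies $\overline{\sigma}\subset\overline{\tau}$. - $\Delta=\coprod_{\sigma\in P}F_\sigma$ is a cell complex with cells (called faces) indexed by $P$, where $F_\sigma$ is a cell of dimension $n-\operatorname{rank}(\sigma)$, identified with the interior of the closed unit ball in $\mathbb{R}^{n-\operatorname{rank}(\sigma)}$. It is assumed that: $\Delta$ is a subset of the closed ball $\overline{F_0}$ in $\mathbb{R}^n$; the closure of each face $F_\sigma$ in $\mathbb{R}^n$ is homeomorphic to the closed ball of dimension $n-\operatorname{rank}(\sigma)$; and for $\sigma,\tau\in P$ the closures of $F_\sigma$ and $F_\tau$ are disjoint if $\sigma,\tau$ have no upper bound in $P$, and otherwise intersect in the closure of $F_\rho$, where $\rho$ is the least upper bound of $\sigma$ and $\tau$ in $P$. The small cover is the quotient space $Y(\Delta,\mathcal{S})=(\Delta\times\{\pm1\}^n)/\sim$, where $(p,\xi)\sim(q,\eta)$ if and only if $p=q$ and $\xi\overline{\sigma}=\eta\overline{\sigma}$,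 where $F_\sigma$ is the face containing $p$. A facet is a face $F_\sigma$ with $\operatorname{rank}(\sigma)=1$. Let $\Delta^\circ$ be the union of the big cell $F_0$ and all facets, and set $Y^\circ(\Delta,\mathcal{S})=(\Delta^\circ\times\{\pm1\}^n)/\sim$, a subset of $Y(\Delta,\mathcal{S})$ which is a topological $n$-manifold. A (possibly disconnected) manifold is orientable if each of its components is. *)

(* Defs.v *)
From HB Require Import structures.
From mathcomp Require Import all_boot all_order all_algebra all_fingroup.
From mathcomp Require Import all_solvable generic_quotient.
From mathcomp Require Import all_classical all_reals all_analysis.

Set Implicit Arguments.
Unset Strict Implicit.
Unset Printing Implicit Defensive.

Import Order.TTheory GRing.Theory Num.Theory.
Import numFieldNormedType.Exports.

Local Open Scope classical_set_scope.
Local Open Scope ring_scope.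
Local Open Scope quotient_scope.

(* The group {1, -1}^n is written additively as F_2^n: the row vector v stands
   for the tuple of signs ((-1)^(v_i))_i. *)
Notation signs n := 'rV['F_2]_n.

(* The library norm on row vectors is the sup norm, so the Euclidean balls are
   defined by hand. *)
Definition sqnorm (R : realType) (n : nat) (x : 'rV[R]_n) : R :=
  \sum_(i < n) x ord0 i ^+ 2.

Definition unit_ball (R : realType) (n : nat) : set 'rV[R]_n :=
  [set x | sqnorm x < 1].

Definition closed_unit_ball (R : realType) (n : nat) : set 'rV[R]_n :=
  [set x | sqnorm x <= 1].

Definition unit_sphere (R : realType) (n : nat) : set 'rV[R]_n :=
  [set x | sqnorm x = 1].

Arguments unit_ball : clear implicits.
Arguments closed_unit_ball : clear implicits.
Arguments unit_sphere : clear implicits.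

Definition homeo_on (T U : topologicalType) (A : set T) (B : set U)
    (f : T -> U) (g : U -> T) : Prop :=
  [/\ {within A, continuous f}, {within B, continuous g},
      set_fun A B f, set_fun B A g &
      {in A, cancel f g} /\ {in B, cancel g f}].

Definition homeomorphic (T U : topologicalType) (A : set T) (B : set U)
    : Prop :=
  exists f g, homeo_on A B f g.

Definition homotopic (R : realType) (T U : topologicalType)
    (A : set T) (B : set U) (f g : T -> U) : Prop :=
  exists H : R * T -> U,
    [/\ {within `[0%R, 1%R] `*` A, continuous H},
        set_fun (`[0%R, 1%R] `*` A) B H,
        forall x, A x -> H (0, x) = f x &
        forall x, A x -> H (1, x) = g x].

(* A homeomorphism h from an open set U of R^n onto an open set of R^n
   preserves the orientation if its local degree at every point x of U is 1.
   That degree is the degree of u |-> h (x + e u) - h x, from the unit sphere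
   to the complement of the origin; by Hopf's theorem it is 1 iff this map is
   homotopic to the inclusion.  The condition does not depend on the radius e of
   a closed ball around x contained in U. *)
Definition orientation_preserving (R : realType) (n : nat)
    (U : set 'rV[R]_n) (h : 'rV[R]_n -> 'rV[R]_n) : Prop :=
  forall x, U x -> exists e : R,
    [/\ 0 < e,
        [set x + e *: u | u in closed_unit_ball R n] `<=` U &
        homotopic R (unit_sphere R n) (~` [set (0 : 'rV[R]_n)])
          (fun u => h (x + e *: u) - h x) id].

Record chart (R : realType) (n : nat) (T : topologicalType) := Chart {
  chart_dom : set T;
  chart_cod : set 'rV[R]_n;
  chart_map : T -> 'rV[R]_n;
  chart_inv : 'rV[R]_n -> T;
  open_chart_dom : open chart_dom;
  open_chart_cod : open chart_cod;
  chart_homeo : homeo_on chart_dom chart_cod chart_map chart_inv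
}.

Definition oriented_atlas (R : realType) (n : nat) (T : topologicalType)
    (C : set T) (A : set (chart R n T)) : Prop :=
  [/\ forall c, A c -> chart_dom c `<=` C,
      C `<=` \bigcup_(c in A) chart_dom c &
      forall c d, A c -> A d ->
        orientation_preserving
          (chart_cod c `&` chart_inv c @^-1` chart_dom d)
          (chart_map d \o chart_inv c)].

Definition components (T : topologicalType) : set (set T) :=
  range (connected_component [set: T]).
Arguments components : clear implicits.

Definition orientable (R : realType) (n : nat) (T : topologicalType) : Prop :=
  forall C, components T C ->
    exists A : set (chart R n T), oriented_atlas C A.

Section FacePoset.
Local Open Scope order_scope.
Variables (d : Order.disp_t) (P : finBPOrderType d).

Definition upper_bound (s t u : P) : Prop := s <= u /\ t <= u.

Definition minimal_upper_bound (s t u : P) : Prop :=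
  upper_bound s t u /\ forall v, upper_bound s t v -> v <= u -> v = u.

Definition least_upper_bound (s t u : P) : Prop :=
  upper_bound s t u /\ forall v, upper_bound s t v -> u <= v.

Definition covered_by (s t : P) : Prop :=
  s < t /\ forall u, ~ (s < u /\ u < t).

Definition rank_function (rk : P -> nat) : Prop :=
  rk \bot = 0%N /\ forall s t, covered_by s t -> rk t = (rk s).+1.

End FacePoset.

Record small_cover (R : realType) (n : nat) (d : Order.disp_t)
    (P : finBPOrderType d) := SmallCover {
  cell_rank : P -> nat;
  sbar : P -> {group signs n};
  face : P -> set 'rV[R]_n;
  cell_rankP : rank_function cell_rank;
  cell_rank_le : forall s, (cell_rank s <= n)%N;
  minimal_upper_bound_uniq : forall s t u v : P,
    minimal_upper_bound s t u -> minimal_upper_bound s t v -> u = v;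
  sbar_isog : forall s, sbar s \isog [set: signs (cell_rank s)]%G;
  sbar_mono : forall s t, (s <= t)%O -> sbar s \subset sbar t;
  big_cell : face \bot%O = unit_ball R n;
  face_sub : forall s, face s `<=` closure (face \bot%O);
  face_disjoint : forall s t, s != t -> face s `&` face t = set0;
  face_cell : forall s, homeomorphic (face s) (unit_ball R (n - cell_rank s));
  closure_face_cell : forall s,
    homeomorphic (closure (face s)) (closed_unit_ball R (n - cell_rank s));
  closure_face_disjoint : forall s t, (~ exists u, upper_bound s t u) ->
    closure (face s) `&` closure (face t) = set0;
  closure_face_meet : forall s t u, least_upper_bound s t u ->
    closure (face s) `&` closure (face t) = closure (face u)
}.

Section CoverSpace.
Variables (R : realType) (n : nat) (d : Order.disp_t) (P : finBPOrderType d).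
Variable X : small_cover R n P.

Definition carrier : set 'rV[R]_n := \bigcup_s face X s.

Definition carrier_circ : set 'rV[R]_n :=
  face X \bot%O `|` \bigcup_(s in [set s | cell_rank X s = 1%N]) face X s.

(* A is meant to be contained in the carrier; then each of its points lies in
   exactly one face, so that the quantifier over s in glue_rel picks that face. *)
Variable A : set 'rV[R]_n.

Definition sheets : topologicalType := (A * discrete_topology (signs n))%type.

Definition glue_rel (x y : sheets) : bool :=
  `[< set_val x.1 = set_val y.1 /\
      forall s, face X s (set_val x.1) ->
        lcoset (sbar X s) x.2 = lcoset (sbar X s) y.2 >].

Lemma glue_rel_refl : reflexive glue_rel.
Proof. by move=> x; apply/asboolP. Qed.

Lemma glue_rel_sym : symmetric glue_rel.
Proof.
by move=> x y; apply/asboolP/asboolP=> -[e h]; split=> // s;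
  rewrite -e => /h.
Qed.

Lemma glue_rel_trans : transitive glue_rel.
Proof.
move=> y x z /asboolP[e h] /asboolP[e' h']; apply/asboolP; split.
  by rewrite e.
by move=> s xs; rewrite h// h'// -e.
Qed.

Canonical glue_equiv :=
  EquivRel glue_rel glue_rel_refl glue_rel_sym glue_rel_trans.

Definition cover_over : topologicalType :=
  quotient_topology {eq_quot glue_equiv}.

Definition cover_pi (x : sheets) : cover_over :=
  (\pi_{eq_quot glue_equiv} x : {eq_quot glue_equiv}).

End CoverSpace.

(* Y(Delta, S) *)
Definition small_cover_space (R : realType) (n : nat) (d : Order.disp_t)
    (P : finBPOrderType d) (X : small_cover R n P) : topologicalType :=
  cover_over X (carrier X).

(* Y°(Delta, S).  Its topology is that of the quotient of the part of the
   product lying over the big cell and the facets; since that part is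
   saturated and the quotient map onto Y(Delta, S) is closed, it is also the
   subspace topology of Y(Delta, S). *)
Definition small_cover_circ (R : realType) (n : nat) (d : Order.disp_t)
    (P : finBPOrderType d) (X : small_cover R n P) : topologicalType :=
  cover_over X (carrier_circ X).

(* image of F_0 x {xi} *)
Definition chamber (R : realType) (n : nat) (d : Order.disp_t)
    (P : finBPOrderType d) (X : small_cover R n P) (xi : signs n) :
    set (small_cover_circ X) :=
  [set cover_pi X (p, xi) | p in [set p : carrier_circ X |
                                   face X \bot%O (set_val p)]].
Arguments chamber {R n d P} X xi.

Definition facet_group (R : realType) (n : nat) (d : Order.disp_t)
    (P : finBPOrderType d) (X : small_cover R n P) : {group signs n} :=
  <<(\bigcup_(s | cell_rank X s == 1%N) sbar X s)%SET>>%G.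

(* Main.v *)
Require Import Defs.
From HB Require Import structures.
From mathcomp Require Import all_boot all_order all_algebra all_fingroup.
From mathcomp Require Import all_solvable generic_quotient.
From mathcomp Require Import all_classical all_reals all_analysis.
From mathcomp Require Import zify ring lra.

(** Both implications rest on the fact that a facet, being an embedded open
    (n-1)-cell, is open in the unit sphere (invariance of domain).  Hence the
    chambers of xi and xi + g adjacent along a facet with generator g are
    unfolded by the inversion x |-> x / |x|^2 into a single chart.

    If phi is a linear form equal to 1 on the generators of the facets, reflect
    the charts of the chambers xi with phi xi = 1.  Every transition map is then
    the identity or the inversion followed by a reflection, and near each point
    the latter is homotopic to the identity, since the derivative of the
    inversion at x is a multiple of the reflection in the hyperplane orthogonal
    to x.

    Conversely, compare an oriented atlas with these coordinates: in the chamber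
    xi it determines a homotopy class of maps from the sphere to the punctured
    space, and crossing a facet composes this class with a reflection.  If no
    linear form is 1 on all generators, an odd number of generators adds up to
    0, so that the class is invariant under a reflection.  Composing with a
    local inverse, the identity of the sphere would be homotopic to a
    reflection.

    The two topological inputs are obtained from cubical cochains.  Given a map
    f of a cube, the integer sum over the small cubes of the cochain
    d(l_n d(l_(n-1) ... d l_1)), with l_k the indicator of f_k > 0, depends only
    on the boundary values of the l_k, and vanishes if f has no zero.  It takes
    opposite nonzero values for the identity and a reflection; modulo 2 it
    equals 1 if f is odd on the boundary.  The latter yields invariance of domain
    by deforming f (x + u) - f x into the odd map f (x + u) - f (x - u). *)

Set Implicit Arguments.
Unset Strict Implicit.
Unset Printing Implicit Defensive.

Import Order.TTheory GRing.Theory Num.Theory.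
Import numFieldNormedType.Exports.

Local Open Scope classical_set_scope.
Local Open Scope ring_scope.

(** * Cubical cochains *)

(** A facet is given only up to homeomorphism, so nothing says directly that the unfolded domains
    around it are open; this is the obstacle that calls for invariance of domain, applied to the
    cone over the facet. The same theorem supplies the local inverse by which a chart is cancelled
    from a homotopy. An orientation is kept as a homotopy class of maps into the punctured space,
    not as a number. Only the class [a] read at the base chamber and [a \o refl] occur, so the
    obstruction is a single statement: these two differ. The linear form comes from a Fredholm
    alternative over F_2: either (0, 1) is a sum of vectors (generator, 1), or a form vanishing on
    all of these separates it from their span. Labels are sampled at the centres of cells of every
    dimension and multiplied into cochains cell by cell. A cube on which the final cochain is
    nonzero has no constant label, whereas a map without zeros has, on every small enough cube, a
    coordinate of constant sign. *)

Definition oddz (z : int) : bool := odd `|z|%N.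

Lemma oddzD1 z : oddz (z + 1) = ~~ oddz z.
Proof. rewrite /oddz; lia. Qed.

Lemma oddzB1 z : oddz (z - 1) = ~~ oddz z.
Proof. rewrite /oddz; lia. Qed.

Lemma oddzN z : oddz (- z) = oddz z.
Proof. by rewrite /oddz abszN. Qed.

Section Points.

(** A function [p] codes a cell of the cubical grid: an odd coordinate stands for the open edge
    between its two even neighbours, an even one for a vertex. Moving one odd coordinate by one
    gives a face of codimension one. *)
Definition upd (p : nat -> int) i c : nat -> int :=
  fun j => if j == i then c else p j.

Definition oppp (p : nat -> int) : nat -> int := fun j => - p j.

Lemma upd_id p i : upd p i (p i) = p.
Proof. by apply/funext => j; rewrite /upd; case: eqP => [->|]. Qed.

Lemma updE p i c : upd p i c i = c.
Proof. by rewrite /upd eqxx. Qed.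

Lemma upd_ne p i j c : j != i -> upd p i c j = p j.
Proof. by rewrite /upd => /negbTE->. Qed.

Lemma updC p i j a b : i != j -> upd (upd p i a) j b = upd (upd p j b) i a.
Proof.
move=> ij; apply/funext => k; rewrite /upd.
by case: (k =P j) => // ->; rewrite eq_sym (negbTE ij).
Qed.

Lemma upd_upd p i a b : upd (upd p i a) i b = upd p i b.
Proof. by apply/funext => k; rewrite /upd; case: eqP. Qed.

Lemma oppp_upd p i c : oppp (upd p i c) = upd (oppp p) i (- c).
Proof. by apply/funext => k; rewrite /upd /oppp; case: eqP. Qed.

End Points.

Section Coboundary.
Variables (R : comNzRingType) (n : nat).
Implicit Types (p : nat -> int) (B : (nat -> int) -> R).

(** Faces in direction [i] exist only where [p i] is odd. With the signs [sg], which count the odd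
    coordinates before [i], the sum over [i < n] is the usual cubical coboundary. *)
Definition diff i B p : R :=
  if oddz (p i) then B (upd p i (p i + 1)) - B (upd p i (p i - 1)) else 0.

Definition sg i p : R := \prod_(j < i) (-1) ^+ oddz (p j).

Definition cobound B p : R := \sum_(i < n) sg i p * diff i B p.

Lemma sg_upd i j p c : (i <= j)%N -> sg i (upd p j c) = sg i p.
Proof.
move=> ij; apply: eq_bigr => k _; rewrite upd_ne// neq_ltn.
by rewrite (leq_trans (ltn_ord k) ij).
Qed.

Lemma sg_flip i j p c : (j < i)%N -> oddz c = ~~ oddz (p j) ->
  sg i (upd p j c) = - sg i p.
Proof.
move=> ji oc; rewrite /sg (bigD1 (Ordinal ji))//= [in RHS](bigD1 (Ordinal ji))//=.
rewrite updE oc (eq_bigr (fun k : 'I_i => (-1) ^+ oddz (p k))); last first.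
  by move=> k kj; rewrite upd_ne//.
by case: (oddz (p j)) => /=; rewrite ?expr0 ?expr1; ring.
Qed.

(** Passing to a face in direction [i] makes that coordinate even, which removes one factor -1 from
    [sg j]; a face in direction [j] does not affect [sg i]. *)
Lemma sgdiff_anticomm i j B p : (i < j)%N ->
  sg i p * diff i (fun q => sg j q * diff j B q) p =
  - (sg j p * diff j (fun q => sg i q * diff i B q) p).
Proof.
move=> ij; rewrite /diff.
have ji : j != i by rewrite gtn_eqF.
have ij' : i != j by rewrite ltn_eqF.
rewrite !upd_ne// !(sg_upd _ _ (ltnW ij)).
case oi: (oddz (p i)); case oj: (oddz (p j)); rewrite ?(subrr, mulr0, oppr0, addr0)//.
rewrite !(sg_flip ij) ?oddzD1 ?oddzB1// !(updC _ _ _ ij'); ring.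
Qed.

Lemma sgdiff_sq i B p :
  sg i p * diff i (fun q => sg i q * diff i B q) p = 0.
Proof.
rewrite /diff; case oi: (oddz (p i)); rewrite ?mulr0//.
by rewrite !updE oddzD1 oddzB1 oi /= !mulr0 subrr mulr0.
Qed.

Lemma sum_antisym (G : nat -> nat -> R) m :
  (forall i, G i i = 0) -> (forall i j, (i < j)%N -> G i j = - G j i) ->
  \sum_(i < m) \sum_(j < m) G i j = 0.
Proof.
move=> G0 GN; elim: m => [|m IH]; first by rewrite big_ord0.
rewrite big_ord_recr /= big_ord_recr /= G0 addr0.
under eq_bigr do rewrite big_ord_recr /=.
rewrite big_split /= IH add0r -big_split /= big1// => i _.
by rewrite GN// addNr.
Qed.

Lemma diff_sum i m (C : 'I_m -> (nat -> int) -> R) p :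
  diff i (fun q => \sum_j C j q) p = \sum_j diff i (C j) p.
Proof.
rewrite /diff; case: oddz; first by rewrite -sumrB.
by rewrite big1.
Qed.

Lemma cobound_cobound B p : cobound (cobound B) p = 0.
Proof.
rewrite /cobound; under eq_bigr do rewrite diff_sum mulr_sumr.
apply: (@sum_antisym (fun i j =>
  sg i p * diff i (fun q => sg j q * diff j B q) p)) => [i|i j ij].
  exact: sgdiff_sq.
exact: sgdiff_anticomm.
Qed.

Lemma diffZ i c B p : diff i (fun q => c * B q) p = c * diff i B p.
Proof. by rewrite /diff; case: oddz; rewrite ?mulr0 ?mulrBr. Qed.

Lemma coboundZ c B p : cobound (fun q => c * B q) p = c * cobound B p.
Proof. by rewrite mulr_sumr; apply: eq_bigr => i _; rewrite diffZ mulrCA. Qed.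

(** The label [lam k'] is a function on cells of every dimension, so the product is taken cell by
    cell. Every stage is closed; the next one measures how the new label varies over the faces. *)
Fixpoint cochain (lam : nat -> (nat -> int) -> R) k : (nat -> int) -> R :=
  if k is k'.+1 then cobound (fun q => lam k' q * cochain lam k' q)
  else fun=> 1.

Lemma cobound_cochain lam k p : cobound (cochain lam k) p = 0.
Proof.
case: k => [|k] /=; last exact: cobound_cobound.
rewrite /cobound big1// => i _; rewrite /diff; case: oddz; rewrite ?mulr0//.
by rewrite subrr mulr0.
Qed.

(* Z is a subcomplex: it contains the facets, hence all faces, of its cells *)
Definition subcomplex (Z : (nat -> int) -> Prop) := forall p i, (i < n)%N ->
  Z p -> oddz (p i) -> Z (upd p i (p i + 1)) /\ Z (upd p i (p i - 1)).

Lemma cobound_local Z B C p : subcomplex Z -> (forall q, Z q -> B q = C q) ->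
  Z p -> cobound B p = cobound C p.
Proof.
move=> cZ BC Zp; apply: eq_bigr => i _; rewrite /diff.
case oi: oddz => //; have [Z1 Z2] := cZ _ _ (ltn_ord i) Zp oi.
by rewrite !BC.
Qed.

Lemma cochain_local Z lam lam' k p : subcomplex Z ->
  (forall j q, (j < k)%N -> Z q -> lam j q = lam' j q) ->
  Z p -> cochain lam k p = cochain lam' k p.
Proof.
move=> cZ; elim: k p => [//|k IH] p h Zp /=.
apply: (cobound_local cZ) => // q Zq; rewrite h// IH// => j q' jk.
by apply: h; rewrite ltnS ltnW.
Qed.

(** A constant multiple of the closed cochain of stage [j] has zero coboundary, so stage [j.+1] is
    zero and with it all later stages. *)
Lemma cochain_vanish Z lam j k c p : subcomplex Z -> (j < k)%N ->
  (forall q, Z q -> lam j q = c) -> Z p -> cochain lam k p = 0.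
Proof.
move=> cZ jk h Zp.
(* Making label [j] constant on all cells lets the induction run without keeping track of [Z]. *)
pose lam' i q := if i == j then c else lam i q.
rewrite (@cochain_local Z lam lam')//; last first.
  by move=> i q _ Zq; rewrite /lam'; case: eqP => [->|//]; exact: h.
move: jk; rewrite -subn_gt0 => jk.
have -> : k = ((k - j).-1 + j.+1)%N by lia.
elim: (k - j).-1 p {jk Zp} => [|m IH] p /=.
  under eq_fun do rewrite /lam' eqxx.
  by rewrite coboundZ cobound_cochain mulr0.
rewrite /cobound big1// => i _; rewrite /diff -/(cochain _ _) !IH !mulr0 subrr.
by case: oddz; rewrite mulr0.
Qed.

End Coboundary.

(** * Sums over boxes and the discrete Stokes formula *)

Section BoxSums.
Variables (R : comNzRingType) (N : nat).
Implicit Types (p : nat -> int) (B C : (nat -> int) -> R) (l : seq nat).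

Local Notation M := (N.*2%:Z).

(** The odd values up to 2N - 1 in absolute value are the edges of [-2N, 2N]. The two halves are
    kept apart because the antipodal argument applies Stokes to half a cube. *)
Definition psum i B p : R := \sum_(j < N) B (upd p i j.*2.+1%:Z).

Definition nsum i B p : R := \sum_(j < N) B (upd p i (- j.*2.+1%:Z)).

Definition ssum i B p : R := psum i B p + nsum i B p.

Definition box l B : (nat -> int) -> R := foldr ssum B l.

Definition others (a : nat) l := [seq i <- l | i != a].

Definition inside (z : int) := oddz z && (`|z| < N.*2)%N.

Lemma inside_pos (j : 'I_N) : inside j.*2.+1%:Z.
Proof. by case: j => j jN; rewrite /inside /oddz /=; lia. Qed.

Lemma inside_neg (j : 'I_N) : inside (- j.*2.+1%:Z).
Proof. by case: j => j jN; rewrite /inside /oddz /=; lia. Qed.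

Lemma box_ext l B C p :
  (forall q, (forall i, i \in l -> inside (q i)) ->
     (forall i, i \notin l -> q i = p i) -> B q = C q) ->
  box l B p = box l C p.
Proof.
elim: l p => [|i l IH] p h /=; first exact: h.
have key c : inside c -> box l B (upd p i c) = box l C (upd p i c).
  move=> ci; apply: IH => q q1 q2; apply: h => j.
    rewrite inE => /predU1P[->|/q1//].
    have [/q1//|/q2->] := boolP (i \in l); by rewrite updE.
  by rewrite inE negb_or => /andP[ji /q2->]; rewrite upd_ne.
by congr (_ + _); apply: eq_bigr => j _; rewrite key// ?inside_pos ?inside_neg.
Qed.

Lemma boxD l B C p : box l (fun q => B q + C q) p = box l B p + box l C p.
Proof.
elim: l p => [//|i l IH] p /=; rewrite /ssum /psum /nsum.
under eq_bigr do rewrite IH.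
under [in X in _ + X = _]eq_bigr do rewrite IH.
by rewrite !big_split /=; ring.
Qed.

Lemma boxZ l c B p : box l (fun q => c * B q) p = c * box l B p.
Proof.
elim: l p => [//|i l IH] p /=; rewrite /ssum /psum /nsum.
under eq_bigr do rewrite IH.
under [in X in _ + X = _]eq_bigr do rewrite IH.
by rewrite -!mulr_sumr mulrDr.
Qed.

Lemma box0 l p : box l (fun _ => 0) p = 0.
Proof.
have -> : (fun _ : nat -> int => 0 : R) = (fun _ => 0 * 0).
  by apply/funext => q; rewrite mul0r.
by rewrite boxZ mul0r.
Qed.

Lemma box_sum l m (C : 'I_m -> (nat -> int) -> R) p :
  box l (fun q => \sum_j C j q) p = \sum_j box l (C j) p.
Proof.
elim: m C => [|m IH] C.
  rewrite big_ord0 -[RHS](box0 l p); congr (box _ _ _).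
  by apply/funext => q; rewrite big_ord0.
rewrite big_ord_recr /= -IH -boxD; congr (box _ _ _).
by apply/funext => q; rewrite big_ord_recr.
Qed.

Lemma boxN l B p : box l (fun q => - B q) p = - box l B p.
Proof.
rewrite -mulN1r -boxZ; congr (box _ _ _).
by apply/funext => q; rewrite mulN1r.
Qed.

Lemma box_opp l B p : box l B (oppp p) = box l (fun q => B (oppp q)) p.
Proof.
elim: l p => [//|i l IH] p /=; rewrite /ssum addrC; congr (_ + _).
  by apply: eq_bigr => j _; rewrite -IH oppp_upd.
by apply: eq_bigr => j _; rewrite -IH oppp_upd opprK.
Qed.

Lemma ssumC i j B : ssum i (ssum j B) = ssum j (ssum i B).
Proof.
have [->//|ij] := eqVneq i j; apply/funext => p.
rewrite /ssum /psum /nsum !big_split /=.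
rewrite [X in X + _ + _ = _]exchange_big /= [X in _ + X + _ = _]exchange_big /=.
rewrite [X in _ + (X + _) = _]exchange_big /=.
rewrite [X in _ + (_ + X) = _]exchange_big /= addrACA.
by congr (_ + _ + (_ + _)); apply: eq_bigr => a _; apply: eq_bigr => b _;
  rewrite updC.
Qed.

Lemma box_rcons l a B : box (rcons l a) B = box l (ssum a B).
Proof. by rewrite /box -cats1 foldr_cat. Qed.

Lemma box_cons l a B : box (a :: l) B = box l (ssum a B).
Proof. by elim: l => [//|i l IH] /=; rewrite ssumC -IH. Qed.

Lemma box_others l a B : uniq l -> a \in l ->
  box l B = box (others a l) (ssum a B).
Proof.
rewrite /others; elim: l => [//|i l IH] /andP[il ul].
rewrite inE => /predU1P[ai|al].
  rewrite ai box_cons /= eqxx /=; congr box; apply/esym/all_filterP/allP => j jl.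
  by apply: contraNneq il => <-.
have ia : i != a by apply: contraNneq il => ->.
by rewrite /= ia /= IH.
Qed.

(** Telescoping: each odd position contributes the difference between its two even neighbours. *)
Lemma psum_diff i B p :
  psum i (diff i B) p = B (upd p i M) - B (upd p i 0).
Proof.
rewrite /psum; elim: N => [|k IH]; first by rewrite big_ord0 subrr.
rewrite big_ord_recr /= IH /diff updE.
have -> : oddz k.*2.+1 by rewrite /oddz /=; lia.
rewrite !upd_upd.
have -> : k.*2.+1%:Z + 1 = k.+1.*2%:Z by lia.
have -> : k.*2.+1%:Z - 1 = k.*2%:Z by lia.
by rewrite addrC addrA subrK.
Qed.

Lemma nsum_diff i B p :
  nsum i (diff i B) p = B (upd p i 0) - B (upd p i (- M)).
Proof.
rewrite /nsum; elim: N => [|k IH]; first by rewrite big_ord0 subrr.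
rewrite big_ord_recr /= IH /diff updE.
have -> : oddz (- k.*2.+1%:Z) by rewrite oddzN /oddz /=; lia.
rewrite !upd_upd.
have -> : - k.*2.+1%:Z + 1 = - k.*2%:Z by lia.
have -> : - k.*2.+1%:Z - 1 = - k.+1.*2%:Z by lia.
by rewrite addrA subrK.
Qed.

Lemma ssum_diff i B p :
  ssum i (diff i B) p = B (upd p i M) - B (upd p i (- M)).
Proof. by rewrite /ssum psum_diff nsum_diff addrA subrK. Qed.

Lemma box_diff l a B p : uniq l -> a \in l ->
  box l (diff a B) p =
  box (others a l) (fun q => B (upd q a M) - B (upd q a (- M))) p.
Proof.
move=> ul al; rewrite (box_others _ ul al).
by congr (box _ _ _); apply/funext => q; rewrite ssum_diff.
Qed.

Lemma box_diff_out l a B p : a \notin l -> ~~ oddz (p a) ->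
  box l (diff a B) p = 0.
Proof.
move=> al pa; rewrite -[RHS](box0 l p); apply: box_ext => q _ h.
by rewrite /diff h// (negbTE pa).
Qed.

End BoxSums.

Section CubeBoundary.
Variables (n N : nat).
Implicit Types p : nat -> int.

Definition cube_boundary (p : nat -> int) :=
  (exists2 a, (a < n)%N & `|p a|%N = N.*2) /\
  forall i, (i < n)%N -> (`|p i| <= N.*2)%N.

(** A coordinate of absolute value 2N is even and survives the passage to a face; an odd one is
    below 2N in absolute value, so a step of one does not leave the cube. *)
Lemma subcomplex_cube_boundary : subcomplex n cube_boundary.
Proof.
move=> p i iN [[a aN pa] ple] oi.
have ai : a != i by apply: contraTneq oi => <-; rewrite /oddz pa odd_double.
have pi := ple _ iN.
by split; (split; [exists a => //; rewrite upd_ne//|]) => j jn;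
  rewrite /upd; case: eqP => // _; [|apply: ple| |apply: ple] => //;
  move: oi pi; rewrite /oddz; lia.
Qed.

Lemma cube_boundary_opp p : cube_boundary p -> cube_boundary (oppp p).
Proof.
move=> [[a aN pa] ple]; split; first by exists a => //; rewrite /oppp abszN.
by move=> i iN; rewrite /oppp abszN; exact: ple.
Qed.

End CubeBoundary.

(** * Antipodal labels modulo 2 *)

Section OddLabels.
Variables (R : comNzRingType) (n N : nat).
Hypothesis char2 : 2%N \in [pchar R].
Implicit Types (p q : nat -> int) (B C : (nat -> int) -> R).

Local Notation M := (N.*2%:Z).
Local Notation cube_boundary := (cube_boundary n N).

Lemma diff_opp i B p : diff i B (oppp p) = - diff i (fun q => B (oppp q)) p.
Proof.
rewrite /diff {1}/oppp oddzN; case: oddz; rewrite ?oppr0// opprB !oppp_upd.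
by congr (B (upd _ _ _) - B (upd _ _ _)); rewrite /oppp; ring.
Qed.

Lemma diffD i B C p : diff i (fun q => B q + C q) p = diff i B p + diff i C p.
Proof. by rewrite /diff; case: oddz; rewrite ?addr0//; ring. Qed.

Lemma cobound_char2 B p : cobound n B p = \sum_(i < n) diff i B p.
Proof.
apply: eq_bigr => i _; rewrite /sg big1 ?mul1r// => j _.
by rewrite (oppr_pchar2 char2) expr1n.
Qed.

(** Under the antipode the product of label and cochain gains the cochain itself as a summand. That
    summand is closed, so the coboundary does not change; signs are invisible in characteristic
    2. *)
Lemma cochain_opp Z lam k p : subcomplex n Z -> (forall q, Z q -> Z (oppp q)) ->
  (forall j q, (j < k)%N -> Z q -> lam j (oppp q) = lam j q + 1) ->
  Z p -> cochain n lam k (oppp p) = cochain n lam k p :> R.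
Proof.
move=> cZ oZ; elim: k p => [//|k IH] p h Zp /=.
have {}IH q : Z q -> cochain n lam k (oppp q) = cochain n lam k q.
  by apply: IH => j q' jk; apply: h; rewrite ltnS ltnW.
transitivity (cobound n
    (fun q => lam k (oppp q) * cochain n lam k (oppp q)) p).
  rewrite !cobound_char2; apply: eq_bigr => i _.
  by rewrite diff_opp (oppr_pchar2 char2).
transitivity (cobound n (fun q => lam k q * cochain n lam k q
                                + cochain n lam k q) p).
  apply: (cobound_local cZ) => // q Zq.
  by rewrite IH// h// mulrDl mul1r.
rewrite -[RHS]addr0 -(cobound_cochain n lam k p) !cobound_char2 -big_split /=.
by apply: eq_bigr => i _; rewrite diffD.
Qed.

Variable lam : nat -> (nat -> int) -> R.
Hypothesis lam_opp : forall j q, (j < n)%N -> cube_boundary q ->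
  lam j (oppp q) = lam j q + 1.

Local Notation origin := (fun _ : nat => 0 : int).

Lemma inside_le z : inside N z -> (`|z| <= N.*2)%N.
Proof. by case/andP => _ /ltnW. Qed.

Lemma upd_boundary a q s : (a < n)%N -> `|s|%N = N.*2 ->
  (forall i, i != a -> (`|q i| <= N.*2)%N) -> cube_boundary (upd q a s).
Proof.
move=> an sM qle; split; first by exists a; rewrite ?updE.
by move=> i _; rewrite /upd; case: eqP => [_|/eqP/qle//]; rewrite sM.
Qed.

Lemma box_opp0 l B : box N l B origin = box N l (fun q => B (oppp q)) origin.
Proof.
by rewrite -box_opp; congr box; apply/funext => i; rewrite /oppp oppr0.
Qed.

Lemma box_ext0 l B C :
  (forall q, (forall i, (`|q i| <= N.*2)%N) -> (forall i, i \notin l -> q i = 0) ->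
     B q = C q) -> box N l B origin = box N l C origin.
Proof.
move=> h; apply: box_ext => q q1 q2; apply: h => // i.
by have [/q1/inside_le//|/q2->//] := boolP (i \in l).
Qed.

Lemma psum_diffC i k B p : i != k -> psum N k (diff i B) p = diff i (psum N k B) p.
Proof.
move=> ik; rewrite /psum /diff; case oi: oddz; last first.
  by rewrite big1// => j _; rewrite upd_ne// oi.
rewrite -sumrB; apply: eq_bigr => j _; rewrite upd_ne// oi.
by rewrite !(updC _ _ _ ik).
Qed.

(** The dimension step of a combinatorial Borsuk-Ulam theorem. Stokes moves the sum to the boundary,
    pairing antipodal faces replaces [lam k * A] by the closed cochain [A], and [A] is left on the
    half x_k > 0 of the lateral boundary together with the top face. Stokes on that half cube trades
    this for the section x_k = 0. *)
Lemma box_cochain_rec k : (k < n)%N ->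
  box N (iota 0 k.+1) (cochain n lam k.+1) origin =
  box N (iota 0 k) (cochain n lam k) origin.
Proof.
move=> kn; rewrite [cochain _ _ k.+1]/=; set A := cochain n lam k; set B := fun q => _.
have N2 (x : R) : - x = x by rewrite (oppr_pchar2 char2).
have D2 (x : R) : x + x = 0 by rewrite (addrr_pchar2 char2).
have uk m : uniq (iota 0 m) by exact: iota_uniq.
have M2 : `|M|%N = N.*2 by [].
have MN2 : `|- M|%N = N.*2 by rewrite abszN.
have AN q : cube_boundary q -> A (oppp q) = A q.
  apply: (cochain_opp (@subcomplex_cube_boundary n N) (@cube_boundary_opp n N)) => j q' jk.
  by apply: lam_opp; exact: ltn_trans kn.
have BN q : cube_boundary q -> B (oppp q) = B q + A q.
  by move=> bq; rewrite /B /= -/A AN// lam_opp// mulrDl mul1r.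
have othk : others k (iota 0 k.+1) = iota 0 k.
  rewrite /others -[k.+1]addn1 iotaD add0n filter_cat /= eqxx cats0.
  by apply/all_filterP/allP => i; rewrite mem_iota => /andP[_ /ltn_eqF->].
have otha a : (a < k)%N ->
    others a (iota 0 k.+1) = rcons (others a (iota 0 k)) k.
  move=> ak; rewrite /others -[k.+1]addn1 iotaD add0n filter_cat /=.
  by rewrite gtn_eqF//= cats1.
(* The antipode turns [B] on the face at -M into [B + A] on the face at M; the two copies of [B]
   cancel. *)
have faceE a : (a <= k)%N ->
    box N (iota 0 k.+1) (diff a B) origin =
    box N (others a (iota 0 k.+1)) (fun q => A (upd q a M)) origin.
  move=> ak; rewrite box_diff ?mem_iota ?add0n ?ltnS// boxD boxN N2.
  rewrite [X in _ + X]box_opp0 -boxD; apply: box_ext0 => q q1 _.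
  rewrite -oppp_upd BN ?addrA ?D2 ?add0r//.
  by apply: upd_boundary => //; exact: leq_ltn_trans kn.
have sumE C m : (m <= n)%N -> box N (iota 0 m) (cobound n C) origin =
    \sum_(a < m) box N (iota 0 m) (diff a C) origin.
  move=> mn; have -> : cobound n C = fun q => \sum_(i < n) diff i C q.
    by apply/funext => q; rewrite cobound_char2.
  rewrite box_sum (big_ord_widen _ (fun a => box N (iota 0 m) (diff a C) origin) mn).
  rewrite [RHS]big_mkcond; apply: eq_bigr => i _; case: ltnP => // mi.
  by rewrite box_diff_out// mem_iota /= add0n -leqNgt.
(* Stokes for the closed cochain [A] on the half cube x_k > 0: the lateral faces equal the top face
   plus the section x_k = 0. *)
have halfE : \sum_(a < k) box N (iota 0 k) (diff a (psum N k A)) origin =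
    box N (iota 0 k) (fun q => A (upd q k M)) origin +
    box N (iota 0 k) A origin.
  apply/eqP; rewrite -subr_eq0 N2; apply/eqP.
  transitivity (box N (iota 0 k) (psum N k (cobound n A)) origin); last first.
    rewrite -[RHS](box0 R N (iota 0 k) origin); apply: box_ext0 => q _ _.
    by rewrite /psum big1// => i _; rewrite cobound_cochain.
  have -> : psum N k (cobound n A) =
      fun q => \sum_(i < n) psum N k (diff i A) q.
    apply/funext => q; rewrite /psum [RHS]exchange_big /=; apply: eq_bigr => j _.
    by rewrite cobound_char2.
  rewrite box_sum.
  transitivity (\sum_(i < k.+1) box N (iota 0 k) (psum N k (diff i A)) origin).
    rewrite big_ord_recr /=; congr (_ + _).
      apply: eq_bigr => -[a /= ak] _; congr box; apply/funext => q.
      by rewrite psum_diffC// ltn_eqF.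
    rewrite -boxD; apply: box_ext0 => q _ q0.
    rewrite psum_diff N2; congr (_ + A _).
    by rewrite -[LHS](upd_id q k) q0// mem_iota /= add0n ltnn.
  rewrite (big_ord_widen _ (fun i => box N (iota 0 k) (psum N k (diff i A)) origin) kn).
  rewrite big_mkcond; apply: eq_bigr => i _; case: ltnP => // ki.
  rewrite -[LHS](box_diff_out (l := iota 0 k) (a := i) N (psum N k A) (p := origin))//.
    by congr box; apply/funext => q; rewrite psum_diffC// gtn_eqF.
  by rewrite mem_iota /= add0n -leqNgt ltnW.
rewrite sumE//; transitivity (
  \sum_(a < k) box N (iota 0 k.+1) (diff a B) origin +
  box N (iota 0 k.+1) (diff k B) origin); first exact: big_ord_recr.
rewrite faceE// othk.
(* The antipode carries the lower half of the face at M in direction [a] to the upper half of the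
   face at -M, and [A] is invariant. Both upper halves together are a difference of [psum N k A]. *)
have -> : \sum_(a < k) box N (iota 0 k.+1) (diff a B) origin =
          \sum_(a < k) box N (iota 0 k) (diff a (psum N k A)) origin.
  apply: eq_bigr => -[a ak] _; change (nat_of_ord (Ordinal ak)) with a.
  rewrite faceE ?(ltnW ak)// otha// box_rcons.
  rewrite box_diff ?mem_iota// !boxD boxN N2; congr (_ + _).
    apply: box_ext0 => q _ _; apply: eq_bigr => j _.
    by rewrite updC// gtn_eqF.
  rewrite box_opp0; apply: box_ext0 => q q1 _; apply: eq_bigr => j _.
  have ka : k != a by rewrite gtn_eqF.
  rewrite -oppp_upd -{1}[M]opprK -oppp_upd AN ?(updC _ _ _ ka)//.
  rewrite -(updC _ _ _ ka); apply: upd_boundary => // [|i _].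
    exact: ltn_trans kn.
  by rewrite /upd; case: eqP => // _; apply: inside_le; exact: inside_pos.
(* The top face now occurs twice and cancels. *)
by rewrite halfE addrC addrA D2 add0r.
Qed.

End OddLabels.

(** * The degree of a labelling of the cube *)

Section Degree.
Variable n : nat.
Local Notation origin := (fun _ : nat => 0 : int).

Definition degree (R : comNzRingType) N (lam : nat -> (nat -> int) -> R) : R :=
  box N (iota 0 n) (cochain n lam n) origin.

(** Stokes writes the degree as a signed sum over the faces of the cube, and the boundary is a
    subcomplex, so the cochains there see only the labels there. *)
Lemma degree_boundary (R : comNzRingType) N (lam lam' : nat -> (nat -> int) -> R) :
  (0 < n)%N ->
  (forall j q, (j < n)%N -> cube_boundary n N q -> lam j q = lam' j q) ->
  degree N lam = degree N lam'.
Proof.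
rewrite /degree => n0 h.
have facesE (mu : nat -> (nat -> int) -> R) :
    box N (iota 0 n) (cochain n mu n) origin =
    \sum_(a < n) (-1) ^+ a * box N (others a (iota 0 n))
      (fun q => mu n.-1 (upd q a N.*2) * cochain n mu n.-1 (upd q a N.*2)
         - mu n.-1 (upd q a (- N.*2%:Z)) *
           cochain n mu n.-1 (upd q a (- N.*2%:Z))) origin.
  have -> : cochain n mu n =
      cobound n (fun q => mu n.-1 q * cochain n mu n.-1 q).
    by rewrite -{2}(prednK n0).
  rewrite /cobound box_sum; apply: eq_bigr => a _.
  rewrite -(box_diff N (fun q => mu n.-1 q * cochain n mu n.-1 q)) ?iota_uniq//;
    last by rewrite mem_iota /=.
  rewrite -boxZ; apply: box_ext => q q1 _; congr (_ * _).
  (* All coordinates of a top-dimensional cell are odd, so its sign in direction [a] is (-1)^a. *)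
  rewrite /sg (eq_bigr (fun _ => -1)) ?prodr_const ?card_ord// => j _.
  have /q1/andP[-> _ //] : (j : nat) \in iota 0 n.
  by rewrite mem_iota /=; exact: ltn_trans (ltn_ord a).
rewrite !facesE.
apply: eq_bigr => a _; congr (_ * _); apply: box_ext0 => q q1 _.
have cE q' : cube_boundary n N q' ->
    cochain n lam n.-1 q' = cochain n lam' n.-1 q'.
  apply: cochain_local; first exact: subcomplex_cube_boundary.
    move=> j r jn br.
  by apply: h => //; exact: leq_trans (leq_pred n).
by congr (_ * _ - _ * _); rewrite ?cE ?h ?prednK//; apply: upd_boundary => //;
  rewrite ?abszN.
Qed.

(** At stage [k] only direction [k] survives in the coboundary: a face in an earlier direction has
    an even coordinate, which kills a factor of the product, and later coordinates do not occur in
    it. *)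
Lemma cochain_prod (R : comNzRingType) (ell : nat -> int -> R) k p : (k <= n)%N ->
  cochain n (fun j q => ell j (q j)) k p = \prod_(j < k) ((-1) ^+ j *
    if oddz (p j) then ell j (p j + 1) - ell j (p j - 1) else 0).
Proof.
elim: k p => [|k IH] p kn; first by rewrite big_ord0.
rewrite [cochain _ _ _ _]/= /cobound (bigD1 (Ordinal kn)) //= big1 ?addr0.
  rewrite big_ord_recr /= /diff; case: ifP => ok; last by rewrite !mulr0.
  rewrite !IH ?(ltnW kn)// !updE.
  have updk c : \prod_(j < k) ((-1) ^+ j * (if oddz (upd p k c j) then
      ell j (upd p k c j + 1) - ell j (upd p k c j - 1) else 0)) =
      \prod_(j < k) ((-1) ^+ j * (if oddz (p j) then
      ell j (p j + 1) - ell j (p j - 1) else 0)).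
    by apply: eq_bigr => j _; rewrite !upd_ne// ltn_eqF.
  rewrite !updk; set P := \prod_(_ < _) _.
  have -> : sg R k p * (ell k (p k + 1) * P - ell k (p k - 1) * P) =
    (sg R k p * P) * (ell k (p k + 1) - ell k (p k - 1)) by ring.
  have -> : sg R k p * P = (-1) ^+ k * P; last by ring.
  (* The sign is (-1)^k only if all earlier coordinates are odd; otherwise [P] is zero. *)
  case/boolP: [forall j : 'I_k, oddz (p j)] => [/forallP od|].
    rewrite /sg (eq_bigr (fun _ => -1)) ?prodr_const ?card_ord// => j _.
    by rewrite od.
  rewrite negb_forall => /existsP[j /negbTE oj].
  have -> : P = 0 by rewrite /P (bigD1 j)//= oj mulr0 mul0r.
  by rewrite !mulr0.
move=> i ik; rewrite /diff; case: ifP => oi; last by rewrite mulr0.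
have {}ik : (i : nat) != k by apply: contraNneq ik => ik; apply/eqP/val_inj.
rewrite !IH ?(ltnW kn)// !(@upd_ne _ _ k) 1?eq_sym//.
case: (ltngtP i k) ik => // ik _.
  rewrite (bigD1 (Ordinal ik))//= [X in _ - _ * X](bigD1 (Ordinal ik))//=.
  by rewrite !updE oddzD1 oddzB1 oi /= !(mulr0, mul0r) subrr mulr0.
rewrite [X in _ * X - _](eq_bigr (fun j : 'I_k => (-1) ^+ j * (if oddz (p j) then
   ell j (p j + 1) - ell j (p j - 1) else 0))); last first.
  by move=> j _; rewrite !upd_ne// ltn_eqF// (ltn_trans (ltn_ord j)).
rewrite [X in _ - _ * X](eq_bigr (fun j : 'I_k => (-1) ^+ j * (if oddz (p j) then
   ell j (p j + 1) - ell j (p j - 1) else 0))) ?subrr ?mulr0//.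
by move=> j _; rewrite !upd_ne// ltn_eqF// (ltn_trans (ltn_ord j)).
Qed.

Lemma box_prod (R : comNzRingType) N (g : nat -> int -> R) k p :
  box N (iota 0 k) (fun q => \prod_(j < k) g j (q j)) p =
  \prod_(j < k) \sum_(i < N) (g j i.*2.+1 + g j (- i.*2.+1%:Z)).
Proof.
elim: k => [|k IH]; first by rewrite /= !big_ord0.
rewrite -[k.+1]addn1 iotaD cats1 box_rcons addn1 big_ord_recr /= -IH mulrC -boxZ.
apply: box_ext => q _ _; rewrite /ssum /psum /nsum -big_split mulr_suml.
apply: eq_bigr => i _; rewrite !big_ord_recr /= !updE add0n mulrDl.
rewrite !(mulrC (g k _)); congr (_ * _ + _ * _); apply: eq_bigr => j _.
  by rewrite upd_ne// ltn_eqF.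
by rewrite upd_ne// ltn_eqF.
Qed.

Lemma degree_prod (R : comNzRingType) N (ell : nat -> int -> R) :
  degree N (fun j q => ell j (q j)) =
  \prod_(j < n) ((-1) ^+ j * (ell j N.*2 - ell j (- N.*2%:Z))).
Proof.
rewrite /degree; have -> : cochain n (fun j q => ell j (q j)) n = fun p =>
    \prod_(j < n) ((-1) ^+ j *
      if oddz (p j) then ell j (p j + 1) - ell j (p j - 1) else 0).
  by apply/funext => p; rewrite cochain_prod.
rewrite (box_prod N (fun j z => (-1) ^+ j *
  if oddz z then ell j (z + 1) - ell j (z - 1) else 0)).
apply: eq_bigr => j _; under eq_bigr do rewrite -mulrDr.
rewrite -mulr_sumr; congr (_ * _).
rewrite -[RHS](ssum_diff N 0 (fun q => ell j (q 0%N)) origin).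
rewrite /ssum /psum /nsum -big_split; apply: eq_bigr => i _.
by rewrite /diff !updE.
Qed.

(** When all coordinates of [c] below [n] are odd, these are the codes of [c] and its faces of all
    dimensions. *)
Definition near_cell (c q : nat -> int) :=
  forall i, (i < n)%N -> (`|q i - c i| <= 1)%N.

Lemma cochain_near (R : comNzRingType) (lam lam' : nat -> (nat -> int) -> R) c :
  (forall i, (i < n)%N -> oddz (c i)) ->
  (forall j q, (j < n)%N -> near_cell c q -> lam j q = lam' j q) ->
  cochain n lam n c = cochain n lam' n c.
Proof.
move=> oc h.
(* The second condition makes the set a subcomplex: a step from an odd coordinate starts at [c i]
   and so stays within distance one. *)
apply: (@cochain_local _ _ (fun q => near_cell c q /\
    forall i, (i < n)%N -> oddz (q i) -> q i = c i)) => [q i iN [q1 q2] oi| |].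
- by split; split=> j jn; rewrite /upd; case: eqP => [->|_];
    rewrite ?oddzD1 ?oddzB1 ?oi//; (do ?[exact: q1|exact: q2]); rewrite q2//; lia.
- by move=> j q jn [q1 _]; exact: h.
- by split=> // i _; rewrite subrr.
Qed.

Lemma cochain_near_const (R : comNzRingType) (lam : nat -> (nat -> int) -> R) c j b :
  (forall i, (i < n)%N -> oddz (c i)) -> (j < n)%N ->
  (forall q, near_cell c q -> lam j q = b) -> cochain n lam n c = 0.
Proof.
move=> oc jn h.
rewrite (@cochain_near _ _ (fun i q => if i == j then b else lam i q) c oc).
  apply: (@cochain_vanish _ _ (fun _ => True) _ j n b) => // q _.
  by rewrite eqxx.
by move=> i q _ cq; case: eqP => [->|//]; exact: h.
Qed.

(** Descending through the dimensions, the sum modulo 2 reduces to the value 1 of the empty cochain.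
    Hence some cell contributes, and a cell with a constant label would contribute 0. *)
Lemma odd_labels_cell N (lam : nat -> (nat -> int) -> bool) :
  (forall j q, (j < n)%N -> cube_boundary n N q ->
     lam j (oppp q) = ~~ lam j q) ->
  exists c, (forall i, (i < n)%N -> inside N (c i)) /\
    forall j b, (j < n)%N -> ~ (forall q, near_cell c q -> lam j q = b).
Proof.
move=> h; apply: contrapT => nc.
pose lam2 j q : 'F_2 := (lam j q)%:R.
have c2 : 2%N \in [pchar 'F_2] by exact: pchar_Fp.
have T1 k : (k <= n)%N -> box N (iota 0 k) (cochain n lam2 k) origin = 1.
  elim: k => [//|k IH] kn; rewrite box_cochain_rec ?IH ?(ltnW kn)// => j q jn bq.
  by rewrite /lam2 h//; case: (lam j q) => /=; rewrite ?add0r ?(addrr_pchar2 c2).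
have /eqP := T1 n (leqnn n); apply/negP; rewrite eq_sym.
rewrite (_ : box _ _ _ _ = 0) ?oner_eq0// -[RHS](box0 _ N (iota 0 n) origin).
apply: box_ext => c c1 _; apply: contrapT => /eqP c0; apply: nc; exists c.
have ci i : (i < n)%N -> inside N (c i) by move=> ?; apply: c1; rewrite mem_iota.
split=> // j b jn hb; apply/negP: c0; rewrite negbK; apply/eqP.
apply: (@cochain_near_const _ lam2 c j (b%:R)) => // [i /ci/andP[]//|q /hb].
by rewrite /lam2 => ->.
Qed.

(** The labels [lam] and those of the identity have opposite nonzero degrees, so their cochains
    differ on some cell. On its closure the labels differ somewhere, and at least one of the two
    cochains is nonzero. *)
Lemma reflection_labels_cell N (lam : nat -> (nat -> int) -> bool) :
  (0 < n)%N -> (0 < N)%N ->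
  (forall j q, (j < n)%N -> cube_boundary n N q ->
     lam j q = if j == 0%N then q j < 0 else 0 < q j) ->
  exists c, [/\ forall i, (i < n)%N -> inside N (c i),
    exists j q, [/\ (j < n)%N, near_cell c q & lam j q <> (0 < q j)] &
    (forall j b, (j < n)%N -> ~ (forall q, near_cell c q -> lam j q = b)) \/
    (forall j b, (j < n)%N -> ~ (forall q, near_cell c q -> (0 < q j) = b))].
Proof.
move=> n0 N0 h; apply: contrapT => nc.
pose lami (mu : nat -> (nat -> int) -> bool) j q : int := (mu j q)%:R.
pose idl (j : nat) (q : nat -> int) := 0 < q j.
have : degree N (lami lam) = degree N (lami idl).
  apply: box_ext => c c1 _; apply: contrapT => cne; apply: nc; exists c.
  have ci i : (i < n)%N -> inside N (c i) by move=> ?; apply: c1; rewrite mem_iota.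
  have oc i : (i < n)%N -> oddz (c i) by move=> /ci/andP[].
  split=> //.
    apply: contrapT => e; apply: cne; apply: cochain_near => // j q jn cq.
    rewrite /lami /idl; congr (_%:R); congr nat_of_bool.
    by apply: contrapT => ne; apply: e; exists j, q.
  apply: contrapT => /not_orP[/existsNP[j1 /existsNP[b1 /not_implyP[jn1 /contrapT e1]]]].
  move=> /existsNP[j2 /existsNP[b2 /not_implyP[jn2 /contrapT e2]]]; apply: cne.
  rewrite (@cochain_near_const _ _ c j1 b1%:R)//; last first.
    by move=> q /e1; rewrite /lami => ->.
  rewrite (@cochain_near_const _ _ c j2 b2%:R)//.
  by move=> q /e2; rewrite /lami /idl => ->.
(* Both degrees are now products over the coordinates, and only factor 0 differs: [rl 0] drops from
   1 to 0, which gives -1 instead of 1. *)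
pose rl (j : nat) (z : int) : int := (if j == 0%N then z < 0 else 0 < z)%:R.
rewrite (@degree_boundary _ N _ (fun j q => rl j (q j)))//; last first.
  by move=> j q jn bq; rewrite /lami h.
rewrite (degree_prod N rl) (degree_prod N (fun _ z => ((0 < z)%R : nat)%:R)).
have Np : (0 < N.*2%:Z) by lia.
have Nn : (N.*2%:Z < 0) = false by lia.
have e1 : \prod_(j < n) ((-1) ^+ j * (((0 < N.*2%:Z)%R : nat)%:R -
    ((0 < - N.*2%:Z)%R : nat)%:R)) = \prod_(j < n) (-1) ^+ j :> int.
  by apply: eq_bigr => j _; rewrite Np oppr_gt0 Nn subr0 mulr1.
rewrite e1 (bigD1 (Ordinal n0))//= [RHS](bigD1 (Ordinal n0))//=.
rewrite (eq_bigr (fun j : 'I_n => (-1) ^+ j)); last first.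
  move=> j j0; rewrite /rl (_ : (j : nat) == 0%N = false); last first.
    by apply: contraNF j0 => /eqP j0; apply/eqP/val_inj.
  by rewrite Np oppr_gt0 Nn subr0 mulr1.
rewrite /rl eqxx Nn oppr_lt0 Np expr0 !mul1r sub0r mulN1r => /esym/eqP.
rewrite -addr_eq0; set x := \prod_(_ < _ | _) _.
suff : x != 0 by move=> x0; rewrite -mulr2n mulrn_eq0 (negbTE x0).
by apply/prodf_neq0 => j _; rewrite expf_neq0// oppr_eq0 oner_eq0.
Qed.

End Degree.

(** * Zeros of maps of cubes *)

Section WithinContinuity.
Variables (T U : topologicalType).

Lemma within_comp (V : topologicalType) (A : set T) (B : set U) (f : T -> U) (g : U -> V) :
  {within A, continuous f} -> {within B, continuous g} -> set_fun A B f ->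
  {within A, continuous (g \o f)}.
Proof.
move=> /subspace_continuousP cf /subspace_continuousP cg fAB.
apply/subspace_continuousP => x Ax.
apply: (@cvg_comp _ _ _ f g _ (within B (nbhs (f x)))); last exact/cg/fAB.
move=> W Wx; have := cf _ Ax _ Wx; rewrite /nbhs /= /within /=.
by apply: filterS => y Wy Ay; apply: Wy => //; exact: fAB.
Qed.
End WithinContinuity.

Lemma cvg_rowP (R : realType) (T : Type) (n : nat) (F : set_system T)
    (f : T -> 'rV[R]_n) (y : 'rV[R]_n) : Filter F ->
  (forall j, (fun t => f t ord0 j) @ F --> y ord0 j) -> f @ F --> y.
Proof.
move=> FF h; apply/cvgrPdist_lt => e e0.
have /= : \forall t \near F, forall j, `|y ord0 j - f t ord0 j| < e.
  by apply: filter_forall => j; move/cvgrPdist_lt : (h j); exact.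
apply: filterS => t ht; rewrite -[`|_|]/(mx_norm _) mx_normrE.
by apply/bigmax_ltP; split => // -[i j] _ /=; rewrite !mxE ord1.
Qed.

Lemma row_norm_coord (R : realType) n (x : 'rV[R]_n) j : `|x ord0 j| <= `|x|.
Proof.
rewrite -[in leRHS]/(mx_norm x) mx_normrE.
by apply: (le_bigmax _ (fun ij => `|x ij.1 ij.2|) (ord0, j)).
Qed.

Lemma row_norm_le (R : realType) n (x : 'rV[R]_n) e : 0 <= e ->
  (forall j, `|x ord0 j| <= e) -> `|x| <= e.
Proof.
move=> e0 h; rewrite -[leLHS]/(mx_norm x) mx_normrE.
by apply/bigmax_leP; split => // -[i j] _ /=; rewrite ord1.
Qed.

Lemma row_norm_ge (R : realType) n (x : 'rV[R]_n.+1) : exists j, `|x| = `|x ord0 j|.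
Proof.
have [/eqP x0|x0] := boolP (mx_norm x == 0).
  exists ord0; move/mx_norm_eq0 : x0 => ->.
  by rewrite normr0 mxE normr0.
have [[i j] /= e] := mx_norm_neq0 x0; exists j.
by rewrite -[LHS]/(mx_norm x) e ord1.
Qed.

Section UniformSign.
Variables (R : realType) (n : nat).

Definition has_sign (s : bool) (z : R) := if s then 0 < z else z < 0.

(** The number [e] is a Lebesgue number for the covering of [K] by sets on which some coordinate of
    [F] has constant sign. *)
Lemma uniform_sign (K : set 'rV[R]_n) (F : 'rV[R]_n -> 'rV[R]_n) :
  compact K -> {within K, continuous F} -> (forall x, K x -> F x != 0) ->
  exists2 e, 0 < e & forall x, K x -> exists j s,
    forall y, K y -> `|x - y| <= e -> has_sign s (F y ord0 j).
Proof.
move=> /compact_near_coveringP cK /subspace_continuousP cF F0.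
pose P (e : R) (x : 'rV[R]_n) := exists j s,
    forall y, K y -> `|x - y| <= e -> has_sign s (F y ord0 j).
suff : \forall e \near 0^'+, K `<=` P e.
  move=> h; have [e [e0 he]] : exists e : R, 0 < e /\ K `<=` P e.
    near (0 : R)^'+ => e; exists e; split; first by near: e; exact: nbhs_right_gt.
    by near: e.
  by exists e.
apply: cK => x Kx.
have [j Fj] : exists j, F x ord0 j != 0.
  apply: contrapT => /forallNP h; have /negP := F0 _ Kx; apply; apply/eqP/rowP => j.
  by rewrite mxE; apply/eqP/negPn/negP => /h.
have cFj : (fun y => F y ord0 j) @ within K (nbhs x) --> F x ord0 j.
  apply: (@cvg_comp _ _ _ F (fun v : 'rV[R]_n => v ord0 j)) (cF _ Kx) _.
  exact: coord_continuous.
pose s := 0 < F x ord0 j.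
have : \forall y \near within K (nbhs x), has_sign s (F y ord0 j).
  have /cvgrPdist_lt/(_ `|F x ord0 j|) := cFj; rewrite normr_gt0 => /(_ Fj).
  apply: filterS => y; rewrite /has_sign /s ltr_norml => /andP[y1 y2].
  have [Fx|Fx|Fx] := ltgtP 0 (F x ord0 j); last by rewrite -Fx eqxx in Fj.
    by move: y2; rewrite gtr0_norm//; lra.
  by move: y1; rewrite ltr0_norm//; lra.
rewrite /within /= => /nbhs_ballP[d /= d0 dP].
exists (ball x (d / 2), [set e | e < d / 2]); first split => /=.
- by apply: nbhsx_ballx; rewrite divr_gt0.
- by apply: nbhs_right_lt; rewrite divr_gt0.
move=> [x' e] /= [xx' ed]; exists j, s => y Ky yx'; apply: dP => //.
rewrite -ball_normE /= in xx' *; rewrite (le_lt_trans (ler_distD x' _ _))//.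
by rewrite (splitr d) ltrD// (le_lt_trans yx').
Unshelve. all: by end_near. Qed.

End UniformSign.

Definition refl (R : realType) n (x : 'rV[R]_n) : 'rV[R]_n :=
  \row_i (if i == 0%N :> nat then - x ord0 i else x ord0 i).

Section Grid.
Variables (R : realType) (n : nat).

(** The centre of the cell coded by [p], scaled so that the codes of absolute value at most 2N fill
    the unit ball of the sup norm. *)
Definition grid N (p : nat -> int) : 'rV[R]_n :=
  \row_i ((p i)%:~R / N.*2%:R).

Lemma grid_opp N p : grid N (oppp p) = - grid N p.
Proof. by apply/rowP => i; rewrite !mxE /oppp mulrNz mulNr. Qed.

Lemma intr_abs (z : int) : `|z%:~R : R| = `|z|%N%:R.
Proof. by rewrite -intr_norm -abszE. Qed.

Lemma grid_coord N p i : (0 < N)%N ->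
  `|grid N p ord0 i| = `|p i|%N%:R / N.*2%:R.
Proof. by move=> N0; rewrite mxE normrM intr_abs normfV normr_nat. Qed.

Lemma grid_le1 N p : (0 < N)%N -> (forall i, (i < n)%N -> (`|p i| <= N.*2)%N) ->
  `|grid N p| <= 1.
Proof.
move=> N0 pN; apply: row_norm_le => // i; rewrite grid_coord//.
by rewrite ler_pdivrMr ?ltr0n ?double_gt0// mul1r ler_nat pN.
Qed.

Lemma grid_boundary N p : (0 < N)%N -> cube_boundary n N p -> `|grid N p| = 1.
Proof.
move=> N0 [[a an pa] pN]; apply/le_anti; rewrite grid_le1//=.
rewrite (le_trans _ (row_norm_coord _ (Ordinal an)))// grid_coord//= pa.
by rewrite divff// pnatr_eq0 double_eq0 -lt0n.
Qed.

Lemma near_cell_le N c q : (forall i, (i < n)%N -> inside N (c i)) ->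
  near_cell n c q -> forall i, (i < n)%N -> (`|q i| <= N.*2)%N.
Proof. by move=> ci cq i iN; have := cq _ iN; have /andP[_] := ci _ iN; lia. Qed.

Lemma grid_near N c q : (0 < N)%N -> near_cell n c q ->
  `|grid N c - grid N q| <= N.*2%:R^-1.
Proof.
move=> N0 cq; apply: row_norm_le => [|i]; first by rewrite invr_ge0.
rewrite !mxE -mulrBl normrM normfV normr_nat ler_piMl ?invr_ge0//.
by rewrite -intrB intr_abs lern1 distnC; exact: cq.
Qed.

End Grid.

(* Breaks ties at the zeros of a coordinate, so that the labels of an odd map
   are exchanged by the antipode. *)
Fixpoint lexpos k (q : nat -> int) :=
  if k is k'.+1 then (if q k' == 0 then lexpos k' q else 0 < q k') else false.

Lemma lexpos_opp k q : (exists2 a, (a < k)%N & q a != 0) ->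
  lexpos k (oppp q) = ~~ lexpos k q.
Proof.
elim: k => [[]//|k IH] [a ak qa] /=; rewrite {1}/oppp oppr_eq0.
case: eqP => [qk|/eqP qk].
  apply: IH; exists a => //; move: ak; rewrite ltnS leq_eqVlt => /predU1P[ka|//].
  by rewrite ka qk eqxx in qa.
by rewrite /oppp oppr_gt0; case: ltgtP qk.
Qed.

Section Brouwer.
Variables (R : realType) (n : nat).
Local Notation V := 'rV[R]_n.+1.
Implicit Types (F : V -> V) (x y : V).

Lemma mesh (e : R) : 0 < e -> exists N, (0 < N)%N /\ N.*2%:R^-1 <= e.
Proof.
move=> e0; have [N eN] : exists N : nat, e^-1 < N%:R.
  by exists (Num.Def.archi_bound e^-1); by apply: archi_boundP; rewrite invr_ge0 ltW.
have N0 : (0 < N)%N.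
  by rewrite -(ltr0n R) (lt_trans _ eN)// invr_gt0.
exists N; split => //; rewrite invf_ple ?posrE ?ltr0n ?double_gt0//.
by rewrite (le_trans (ltW eN))// ler_nat -addnn leq_addr.
Qed.

Lemma compact_ring (a b : R) : compact [set x : V | a <= `|x| <= b].
Proof.
apply: bounded_closed_compact.
  exists b; split; first exact: num_real.
  by move=> c bc x /= /andP[_ xb]; rewrite (le_trans xb)// ltW.
rewrite (_ : [set _ | _] = [set x : V | a <= `|x|] `&` [set x : V | `|x| <= b]).
  apply: closedI.
    apply: (@closed_comp _ _ (fun x : V => `|x|) [set z | a <= z]).
      by move=> x _; exact: norm_continuous.
    exact: closed_ge.
  apply: (@closed_comp _ _ (fun x : V => `|x|) [set z | z <= b]).
    by move=> x _; exact: norm_continuous.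
  exact: closed_le.
by apply/seteqP; split => x /= => [/andP[]//|[-> ->]].
Qed.

(** The signs of the coordinates at the grid points are odd labels on the boundary, so some cell has
    no constant label. On a fine grid this contradicts [uniform_sign]. *)
Lemma borsuk F : {within [set x | `|x| <= 1], continuous F} ->
  (forall x, `|x| <= 1 -> F x != 0) ->
  (forall x, `|x| = 1 -> F (- x) = - F x) -> False.
Proof.
move=> cF F0 Fodd.
have KE : [set x : V | `|x| <= 1] = [set x | 0 <= `|x| <= 1].
  by apply/seteqP; split => x /=; rewrite normr_ge0.
have cK : compact [set x : V | `|x| <= 1] by rewrite KE; exact: compact_ring.
have [e e0 eP] := uniform_sign cK cF F0.
have [N [N0 Ne]] := mesh e0.
pose lam j q := let z := F (grid R n.+1 N q) ord0 (inord j) in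
  (0 < z) || (z == 0) && lexpos n.+1 q.
have [|c [ci cP]] := @odd_labels_cell n.+1 N lam.
  move=> j q jn bq; rewrite /lam grid_opp Fodd ?grid_boundary// mxE oppr_gt0.
  rewrite oppr_eq0 lexpos_opp; first by case: ltgtP.
  by case: bq => -[a an qa] _; exists a => //; rewrite -absz_eq0 qa double_eq0 -lt0n.
have inK q : near_cell n.+1 c q -> `|grid R n.+1 N q| <= 1.
  by move=> cq; apply: grid_le1 => //; exact: near_cell_le cq.
have cc : near_cell n.+1 c c by move=> i _; rewrite subrr.
have [j [s js]] := eP _ (inK _ cc).
apply: (cP j s (ltn_ord j)) => q cq.
have := js _ (inK _ cq) (le_trans (grid_near R N0 cq) Ne).
rewrite /lam inord_val /has_sign; case: s {js} => [->//|z0].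
by rewrite lt_gtF// lt_eqF.
Qed.

Lemma id_refl_not_joined F :
  {within [set x | 4^-1 <= `|x| <= 1], continuous F} ->
  (forall x, 4^-1 <= `|x| <= 1 -> F x != 0) ->
  (forall x, `|x| <= 2^-1 -> F x = x) ->
  (forall x, `|x| = 1 -> F x = refl x) -> False.
Proof.
move=> cF F0 Fid Frefl.
have [e e0 eP] := uniform_sign (@compact_ring _ _) cF F0.
(* With 1/8, a cell having a grid point of norm above 1/2 has its centre at norm at least 3/8 and
   all its grid points at norm at least 1/4, inside the annulus where [F] is continuous. *)
have e8 : 0 < Order.min e 8^-1 :> R by rewrite lt_min e0/= invr_gt0.
have [N [N0]] := mesh e8; rewrite le_min => /andP[Ne N8].
pose lam j q := 0 < F (grid R n.+1 N q) ord0 (inord j).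
have gridp q (j : 'I_n.+1) : (0 < grid R n.+1 N q ord0 j) = (0 < q j).
  by rewrite mxE pmulr_lgt0 ?ltr0z// invr_gt0 ltr0n double_gt0.
have gridn q (j : 'I_n.+1) : (grid R n.+1 N q ord0 j < 0) = (q j < 0).
  by rewrite mxE pmulr_llt0 ?ltrz0// invr_gt0 ltr0n double_gt0.
have [//|//| |c [ci [j [q [jn cq lamq]]] cP]] := @reflection_labels_cell n.+1 N lam.
  move=> j q jn bq; rewrite /lam Frefl ?grid_boundary// mxE inordK//.
  by case: eqP => [->|_]; rewrite ?oppr_gt0 ?gridn ?gridp !inordK.
(* The labels of [F] and of the identity differ at [q], which therefore lies outside the ball where
   [F] is the identity. *)
have gq : 2^-1 < `|grid R n.+1 N q|.
  rewrite ltNge; apply/negP => gq; apply: lamq.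
  by rewrite /lam Fid// gridp inordK.
have cg q' : near_cell n.+1 c q' -> `|grid R n.+1 N c - grid R n.+1 N q'| <= 8^-1.
  by move=> /(grid_near R N0)/le_trans; apply.
have cc : near_cell n.+1 c c by move=> i _; rewrite subrr.
have gc : 2^-1 - 8^-1 <= `|grid R n.+1 N c|.
  have := ler_normD (grid R n.+1 N q - grid R n.+1 N c) (grid R n.+1 N c).
  by rewrite subrK; have := cg _ cq; rewrite distrC; lra.
have inK q' : near_cell n.+1 c q' -> 4^-1 <= `|grid R n.+1 N q'| <= 1.
  move=> cq'; rewrite grid_le1 ?andbT//; last exact: near_cell_le cq'.
  have := ler_normD (grid R n.+1 N c - grid R n.+1 N q') (grid R n.+1 N q').
  by rewrite subrK; have := cg _ cq'; lra.
case: cP => cP.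
  have [i [s js]] := eP _ (inK _ cc).
  apply: (cP i s (ltn_ord i)) => q' cq'.
  have := js _ (inK _ cq') (le_trans (grid_near R N0 cq') Ne).
  by rewrite /lam inord_val /has_sign; case: s {js} => [->//|/lt_gtF].
(* A coordinate of the centre of absolute value at least 3/8 keeps its sign on the whole cell, so
   the identity does have a constant label there. *)
have [i gi] := row_norm_ge (grid R n.+1 N c).
apply: (cP i (0 < c i) (ltn_ord i)) => q' cq'; rewrite -!gridp.
have := row_norm_coord (grid R n.+1 N c - grid R n.+1 N q') i.
have -> : (grid R n.+1 N c - grid R n.+1 N q') ord0 i =
    grid R n.+1 N c ord0 i - grid R n.+1 N q' ord0 i by rewrite !mxE.
move=> /le_trans/(_ (cg _ cq')).
rewrite ler_norml => /andP[].
case: (ltP 0 (grid R n.+1 N c ord0 i)) => gp; move: gc; rewrite gi.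
  by rewrite gtr0_norm// => *; apply/idP; lra.
by rewrite ler0_norm// => *; apply/negbTE; rewrite -leNgt; lra.
Qed.

End Brouwer.

(** * Invariance of domain *)

Lemma cvg_maxr (R : realType) (T : Type) (F : set_system T) {FF : Filter F}
    (f g : T -> R) a b : f @ F --> a -> g @ F --> b ->
  Order.max (f x) (g x) @[x --> F] --> Order.max a b.
Proof.
move=> fa gb; rewrite maxr_absE; under eq_fun do rewrite maxr_absE.
apply: cvgM; last exact: cvg_cst.
apply: cvgD; first exact: cvgD.
by apply: cvg_norm; exact: cvgB.
Qed.

Section InvarianceOfDomain.
Variables (R : realType) (n : nat).
Local Notation V := 'rV[R]_n.+1.

Lemma invariance_of_domain_ball (f : V -> V) (x : V) (rho : R) : 0 < rho ->
  {within [set z | `|z - x| <= rho], continuous f} ->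
  (forall y z, `|y - x| <= rho -> `|z - x| <= rho -> f y = f z -> y = z) ->
  nbhs (f x) (f @` [set z | `|z - x| <= rho]).
Proof.
move=> rho0 cf finj; set D := [set z | _].
(* This is 0 for |u| at most 1/2 and 1 for |u| = 1. Thus [g] below is f (x + rho u) - f x near the
   centre and odd on the boundary. *)
pose beta (u : V) : R := Order.max 0 (2 * `|u| - 1).
have cbeta : continuous beta.
  move=> u; apply: (@cvg_maxr _ _ (nbhs u) _ (fun=> 0) (fun u => 2 * `|u| - 1)).
    exact: cvg_cst.
  apply: cvgB; last exact: cvg_cst.
  apply: cvgM; first exact: cvg_cst.
  exact: norm_continuous.
have beta_bnd u : `|u| <= 1 -> 0 <= beta u <= 1.
  by move=> u1; rewrite /beta le_max lexx ge_max ler01/=; lra.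
pose K := [set u : V | `|u| <= 1].
have normD c (u : V) : 0 <= c -> `|x + c *: u - x| = c * `|u|.
  by move=> c0; rewrite addrAC subrr add0r normrZ ger0_norm.
have in1 u : K u -> D (x + rho *: u).
  by move=> u1; rewrite /D /= normD ?(ltW rho0)// ler_piMr// ltW.
have in2 u : K u -> D (x - (rho * beta u) *: u).
  move=> u1; have /andP[b0 b1] := beta_bnd _ u1.
  rewrite /D /= -scalerN normD ?mulr_ge0 ?(ltW rho0)// normrN -mulrA.
  rewrite ler_piMr ?(ltW rho0)// mulr_ile1//.
have c1 : {within K, continuous (fun u => f (x + rho *: u))}.
  apply: (@within_comp _ _ _ K D (fun u => x + rho *: u) f) => //.
  apply: continuous_subspaceT => u.
  have : x + rho *: v @[v --> nbhs u] --> x + rho *: u; last exact.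
  apply: cvgD; first exact: cvg_cst.
  by apply: cvgZ; [exact: cvg_cst|exact: cvg_id].
have c2 : {within K, continuous (fun u => f (x - (rho * beta u) *: u))}.
  apply: (@within_comp _ _ _ K D (fun u => x - (rho * beta u) *: u) f) => //.
  apply: continuous_subspaceT => u.
  have : x - (rho * beta v) *: v @[v --> nbhs u] --> x - (rho * beta u) *: u; last exact.
  apply: cvgB; first exact: cvg_cst.
  apply: cvgZ; last exact: cvg_id.
  by apply: cvgM; [exact: cvg_cst|exact: cbeta].
pose g u := f (x + rho *: u) - f (x - (rho * beta u) *: u).
have cg : {within K, continuous g}.
  move=> u; apply: cvgB; [exact: c1|exact: c2].
pose S := [set u : V | 2^-1 <= `|u| <= 1].
have SK : S `<=` K by move=> u /= /andP[].
have g0 u : S u -> g u <> 0.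
  move=> Su /subr0_eq /(finj _ _ (in1 _ (SK _ Su)) (in2 _ (SK _ Su))).
  have /andP[u2 u1] := Su; have /andP[b0 b1] := beta_bnd _ u1.
  move=> /addrI /eqP; rewrite -scaleNr -subr_eq0 -scalerBl opprK scaler_eq0.
  apply/negP; rewrite negb_or; apply/andP; split; first by apply: lt0r_neq0; nra.
  by rewrite -normr_gt0 (lt_le_trans _ u2)// invr_gt0.
have [d d0 dP] : exists2 d, 0 < d & forall u, S u -> d <= `|g u|.
  have cS : compact (g @` S).
    apply: continuous_compact; first exact: continuous_subspaceW cg.
    exact: compact_ring.
  have clS := compact_closed (@norm_hausdorff _ _) cS.
  have : nbhs (0 : V) (~` (g @` S)).
    apply: open_nbhs_nbhs; split; first exact: closed_openC.
    by move=> [u /g0].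
  move=> /nbhs_ballP[d /= d0 dP]; exists d => // u Su; rewrite leNgt.
  apply/negP => gd; apply: (dP (g u)); last by exists u.
  by rewrite -ball_normE /= sub0r normrN.
apply/nbhs_ballP; exists d => //= y; rewrite -ball_normE /= => yd.
apply: contrapT => yim.
(* Where [beta] is 0 a zero of [F] would put [y] in the image; for |u| at least 1/2 the value of [g]
   has norm at least [d] and cannot be cancelled; on the boundary the correction is zero and [F] is
   odd. *)
pose F u := g u - (1 - beta u) *: (y - f x).
apply: (@borsuk R n F).
- move=> u; apply: cvgB; first exact: cg.
  apply: cvgZr_tmp; apply: cvgB; first exact: cvg_cst.
  exact: (continuous_subspaceT cbeta).
- move=> u u1; apply/eqP => /subr0_eq.
  have [u2|u2] := ltP `|u| 2^-1.
    have b0 : beta u = 0 by rewrite /beta max_l//; lra.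
    rewrite /g b0 mulr0 scale0r subr0 subr0 scale1r => /addIr e.
    by apply: yim; exists (x + rho *: u); [exact: in1|].
  have Su : S u by rewrite /S /= u2.
  move=> e; have := dP _ Su; rewrite e normrZ leNgt => /negP; apply.
  have /andP[b0 b1] := beta_bnd _ u1; rewrite distrC in yd.
  by rewrite (le_lt_trans _ yd)// ler_piMl// ger0_norm; lra.
- move=> u u1; rewrite /F /g /beta normrN u1.
  have -> : Order.max 0 (2 * 1 - 1) = 1 :> R by rewrite max_r; lra.
  by rewrite subrr !scale0r !subr0 mulr1 !scalerN opprK opprB.
Qed.

Theorem invariance_of_domain (f : V -> V) (U : set V) : open U ->
  {within U, continuous f} -> {in U &, injective f} -> open (f @` U).
Proof.
move=> oU cf finj; rewrite openE => _ [x Ux <-].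
have /nbhs_ballP[e /= e0 eU] : nbhs x U by exact: open_nbhs_nbhs.
have DU : [set z | `|z - x| <= e / 2] `<=` U.
  move=> z /= zx; apply: eU; rewrite -ball_normE /= distrC (le_lt_trans zx)//.
  by rewrite ltr_pdivrMr// ltr_pMr// ltr1n.
apply: (filterS _ (invariance_of_domain_ball (rho := e / 2) _ _ _)).
- by move=> _ [z zx <-]; exists z => //; exact: DU.
- by rewrite divr_gt0.
- exact: continuous_subspaceW cf.
- by move=> y z yx zx; apply: finj; apply/mem_set/DU.
Qed.

End InvarianceOfDomain.

(** * Homotopies and germs *)

Section EuclideanNorm.
Variables (R : realType) (n : nat).
Implicit Types x y u : 'rV[R]_n.

Definition dotp x y : R := \sum_(i < n) x ord0 i * y ord0 i.

Lemma sqnormE x : sqnorm x = dotp x x.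
Proof. by apply: eq_bigr => i _; rewrite expr2. Qed.

Lemma dotpC x y : dotp x y = dotp y x.
Proof. by apply: eq_bigr => i _; rewrite mulrC. Qed.

Lemma dotpDl x y u : dotp (x + y) u = dotp x u + dotp y u.
Proof. by rewrite -big_split; apply: eq_bigr => i _; rewrite mxE mulrDl. Qed.

Lemma dotpZl c x y : dotp (c *: x) y = c * dotp x y.
Proof. by rewrite mulr_sumr; apply: eq_bigr => i _; rewrite mxE mulrA. Qed.

Lemma dotpDr x y u : dotp u (x + y) = dotp u x + dotp u y.
Proof. by rewrite dotpC dotpDl !(dotpC u). Qed.

Lemma dotpZr c x y : dotp x (c *: y) = c * dotp x y.
Proof. by rewrite dotpC dotpZl dotpC. Qed.

Lemma sqnorm_ge0 x : 0 <= sqnorm x.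
Proof. by apply: sumr_ge0 => i _; exact: sqr_ge0. Qed.

Lemma sqnorm_coord x i : x ord0 i ^+ 2 <= sqnorm x.
Proof.
by rewrite /sqnorm (bigD1 i)//= lerDl; apply: sumr_ge0 => j _; exact: sqr_ge0.
Qed.

Lemma sqnorm_eq0 x : (sqnorm x == 0) = (x == 0).
Proof.
apply/eqP/eqP => [x0|->]; last by rewrite /sqnorm big1// => i _; rewrite mxE expr0n.
apply/rowP => i; rewrite mxE; apply/eqP; rewrite -sqrf_eq0 eq_le sqr_ge0 andbT.
by rewrite -x0 sqnorm_coord.
Qed.

Lemma sqnorm_gt0 x : (0 < sqnorm x) = (x != 0).
Proof. by rewrite lt_def sqnorm_ge0 andbT sqnorm_eq0. Qed.

Lemma sqnormZ c x : sqnorm (c *: x) = c ^+ 2 * sqnorm x.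
Proof. by rewrite !sqnormE dotpZl dotpZr mulrA expr2. Qed.

Lemma sqnorm0 : sqnorm (0 : 'rV[R]_n) = 0.
Proof. by apply/eqP; rewrite sqnorm_eq0. Qed.

Lemma norm_le_sqnorm x (e : R) : 0 <= e -> sqnorm x <= e ^+ 2 -> `|x| <= e.
Proof.
move=> e0 xe; apply: row_norm_le => // i.
rewrite -(ler_pXn2r (n := 2))// ?nnegrE//.
by rewrite real_normK ?num_real// (le_trans (sqnorm_coord _ _)).
Qed.

Lemma norm_unit_ball x : closed_unit_ball R n x -> `|x| <= 1.
Proof. by move=> x1; apply: norm_le_sqnorm; rewrite ?expr1n. Qed.

Definition enorm x : R := Num.sqrt (sqnorm x).

Lemma enorm_gt0 x : (0 < enorm x) = (x != 0).
Proof. by rewrite sqrtr_gt0 sqnorm_gt0. Qed.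

Lemma sphere_normalize x : x != 0 -> unit_sphere R n ((enorm x)^-1 *: x).
Proof.
move=> x0; rewrite /unit_sphere /= sqnormZ exprVn sqr_sqrtr ?sqnorm_ge0//.
by rewrite mulVf// sqnorm_eq0.
Qed.

Lemma sphere_neq0 x : unit_sphere R n x -> x != 0.
Proof.
by rewrite /unit_sphere /= => x1; rewrite -sqnorm_eq0 x1 oner_eq0.
Qed.

Variables (T : Type) (F : set_system T).
Context {FF : Filter F}.

Lemma cvg_coord (f : T -> 'rV[R]_n) y j : f @ F --> y ->
  f t ord0 j @[t --> F] --> y ord0 j.
Proof.
by move=> fy; apply: (@cvg_comp _ _ _ f (fun v => v ord0 j) _ (nbhs y)) => //;
  exact: coord_continuous.
Qed.

Lemma cvg_dotp (f g : T -> 'rV[R]_n) y z : f @ F --> y -> g @ F --> z ->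
  dotp (f t) (g t) @[t --> F] --> dotp y z.
Proof.
move=> fy gz; rewrite /dotp; elim: (index_enum _) => [|i r IH].
  by rewrite big_nil; under eq_fun do rewrite big_nil; exact: cvg_cst.
rewrite big_cons; under eq_fun do rewrite big_cons.
by apply: cvgD; last exact: IH; apply: cvgM; exact: cvg_coord.
Qed.

Lemma cvg_sqnorm (f : T -> 'rV[R]_n) y : f @ F --> y ->
  sqnorm (f t) @[t --> F] --> sqnorm y.
Proof.
move=> fy; rewrite sqnormE; under eq_fun do rewrite sqnormE.
exact: cvg_dotp.
Qed.

Lemma cvg_enorm (f : T -> 'rV[R]_n) y : f @ F --> y ->
  enorm (f t) @[t --> F] --> enorm y.
Proof.
move=> fy; apply: (@cvg_comp _ _ _ _ Num.sqrt _ (nbhs (sqnorm y))).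
  exact: cvg_sqnorm.
exact: sqrt_continuous.
Qed.

Lemma cvg_refl (f : T -> 'rV[R]_n) y : f @ F --> y ->
  refl (f t) @[t --> F] --> refl y.
Proof.
move=> fy; apply: cvg_rowP => j; rewrite mxE.
under eq_fun do rewrite mxE.
by case: ifP => _; [apply: cvgN|]; exact: cvg_coord.
Qed.

End EuclideanNorm.

Section Reflection.
Variables (R : realType) (n : nat).
Implicit Types x y : 'rV[R]_n.

Lemma reflK : involutive (@refl R n).
Proof. by move=> x; apply/rowP => i; rewrite !mxE; case: eqP => _; rewrite ?opprK. Qed.

Lemma reflD x y : refl (x + y) = refl x + refl y.
Proof. by apply/rowP => i; rewrite !mxE; case: eqP => _; rewrite ?opprD. Qed.

Lemma reflN x : refl (- x) = - refl x.
Proof. by apply/rowP => i; rewrite !mxE; case: eqP. Qed.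

Lemma reflZ c x : refl (c *: x) = c *: refl x.
Proof. by apply/rowP => i; rewrite !mxE; case: eqP => _; rewrite ?mulrN. Qed.

Lemma sqnorm_refl x : sqnorm (refl x) = sqnorm x.
Proof. by apply: eq_bigr => i _; rewrite !mxE; case: eqP => _; rewrite ?sqrrN. Qed.

Lemma refl_eq0 x : (refl x == 0) = (x == 0).
Proof. by rewrite -sqnorm_eq0 sqnorm_refl sqnorm_eq0. Qed.

End Reflection.

Lemma cvg_within_id (T : topologicalType) (A : set T) (p : T) :
  x @[x --> within A (nbhs p)] --> p.
Proof. exact: cvg_within_filter. Qed.

Lemma within_cvgP (T U : topologicalType) (A : set T) (f : T -> U) :
  {within A, continuous f} <->
  forall p, A p -> f x @[x --> within A (nbhs p)] --> f p.
Proof. exact: subspace_continuousP. Qed.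

Lemma cvg_within_fst (T U : topologicalType) (A : set (T * U)) (p : T * U) :
  (fun x : T * U => x.1) @ within A (nbhs p) --> p.1.
Proof.
apply: (@cvg_comp _ _ _ id fst _ (nbhs p)); first exact: cvg_within_id.
by case: p => a b; exact: cvg_fst.
Qed.

Lemma cvg_within_snd (T U : topologicalType) (A : set (T * U)) (p : T * U) :
  (fun x : T * U => x.2) @ within A (nbhs p) --> p.2.
Proof.
apply: (@cvg_comp _ _ _ id snd _ (nbhs p)); first exact: cvg_within_id.
by case: p => a b; exact: cvg_snd.
Qed.

Lemma cvg_mkpair (T : Type) (U W : topologicalType) (F : set_system T)
    {FF : Filter F} (f : T -> U) (g : T -> W) (a : U) (b : W) :
  f @ F --> a -> g @ F --> b -> (fun x => (f x, g x)) @ F --> (a, b).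
Proof. exact: cvg_pair. Qed.

Lemma within_pair (T U W : topologicalType) (A : set T) (f : T -> U) (g : T -> W) :
  (forall p, A p -> f x @[x --> within A (nbhs p)] --> f p) ->
  (forall p, A p -> g x @[x --> within A (nbhs p)] --> g p) ->
  {within A, continuous (fun x => (f x, g x))}.
Proof.
move=> cf cg; apply/within_cvgP => p Ap.
by apply: cvg_mkpair; [exact: cf|exact: cg].
Qed.

Section Homotopy.
Variables (R : realType) (n : nat).
Local Notation V := 'rV[R]_n.
Local Notation I := (`[0%R, 1%R]%classic : set R).

Section General.
Variables (T : topologicalType) (A : set T).
Implicit Types (B : set V) (f g h : T -> V).

Lemma homotopic_ext B f g f' g' : (forall x, A x -> f x = f' x) ->
  (forall x, A x -> g x = g' x) -> homotopic R A B f g -> homotopic R A B f' g'.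
Proof.
move=> ff' gg' [H [cH HB H0 H1]]; exists H; split => // x Ax.
  by rewrite H0// ff'.
by rewrite H1// gg'.
Qed.

Lemma homotopic_refl B f : {within A, continuous f} -> set_fun A B f ->
  homotopic R A B f f.
Proof.
move=> cf fB; exists (fun p => f p.2); split => // [|[t x] [_ /=]]; last exact: fB.
apply: (@within_comp _ _ _ (I `*` A) A snd f) => //.
  by apply: continuous_subspaceT => -[a b]; exact: cvg_snd.
by move=> [t x] [].
Qed.

Lemma homotopic_sym B f g : homotopic R A B f g -> homotopic R A B g f.
Proof.
move=> [H [cH HB H0 H1]]; exists (fun p => H (1 - p.1, p.2)).
have m : set_fun (I `*` A) (I `*` A) (fun p => (1 - p.1, p.2)).
  move=> [t x] [/=]; rewrite !in_itv/= => /andP[t0 t1] Ax; split => //.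
  by rewrite /= ?in_itv/= subr_ge0 t1 lerBlDr lerDl.
split => [|p /m/HB//|x Ax|x Ax].
- apply: (@within_comp _ _ _ (I `*` A) (I `*` A) (fun p => (1 - p.1, p.2)) H) => //.
  apply: within_pair => p _; last exact: cvg_within_snd.
  by apply: cvgB; [exact: cvg_cst|exact: cvg_within_fst].
- by rewrite subr0 H1.
- by rewrite subrr H0.
Qed.

Lemma homotopic_trans B f g h :
  homotopic R A B f g -> homotopic R A B g h -> homotopic R A B f h.
Proof.
move=> [H [cH HB H0 H1]] [K [cK KB K0 K1]].
pose a (p : R * T) : R * T := (Order.min 1 (2 * p.1), p.2).
pose b (p : R * T) : R * T := (Order.max 0 (2 * p.1 - 1), p.2).
have ma : set_fun (I `*` A) (I `*` A) a.
  move=> [t x] [/=]; rewrite !in_itv/= => /andP[t0 t1] Ax; split => //=.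
  by rewrite ?in_itv/= ge_min lexx le_min ler01/= mulr_ge0.
have mb : set_fun (I `*` A) (I `*` A) b.
  move=> [t x] [/=]; rewrite !in_itv/= => /andP[t0 t1] Ax; split => //=.
  by rewrite ?in_itv/= le_max lexx ge_max ler01/=; lra.
have mc : set_fun (I `*` A) (I `*` A) (fun p : R * T => (1 : R, p.2)).
  by move=> [t x] [/= _ Ax]; split => //=; rewrite ?in_itv/= ler01 lexx.
have HE t x : A x -> t <= 2^-1 ->
    H (a (t, x)) + K (b (t, x)) - H (1, x) = H (2 * t, x).
  move=> Ax t2; rewrite /a /b /= min_r; last lra.
  by rewrite max_l; [rewrite K0// H1// addrK|lra].
have KE t x : A x -> 2^-1 <= t ->
    H (a (t, x)) + K (b (t, x)) - H (1, x) = K (2 * t - 1, x).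
  move=> Ax t2; rewrite /a /b /= min_l; last lra.
  by rewrite max_r; [rewrite addrC addKr|lra].
(* In the first half of the time [K (b p)] is the common middle map and cancels the last term, in
   the second half [H (a p)] does. Continuity is thus that of a sum, with no pasting of two
   pieces. *)
exists (fun p => H (a p) + K (b p) - H (1, p.2)); split.
- have ca : {within I `*` A, continuous (H \o a)}.
    apply: within_comp ma => //; apply: within_pair => p _;
      last exact: cvg_within_snd.
    rewrite -[Order.min _ _]opprK oppr_min; under eq_fun do
      rewrite -[Order.min _ _]opprK oppr_min.
    apply: cvgN; apply: cvg_maxr; first exact: cvg_cst.
    by apply: cvgN; apply: cvgM; [exact: cvg_cst|exact: cvg_within_fst].
  have cb : {within I `*` A, continuous (K \o b)}.
    apply: within_comp mb => //; apply: within_pair => p _;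
      last exact: cvg_within_snd.
    apply: cvg_maxr; first exact: cvg_cst.
    apply: cvgB; last exact: cvg_cst.
    by apply: cvgM; [exact: cvg_cst|exact: cvg_within_fst].
  have cc : {within I `*` A, continuous (H \o (fun p : R * T => (1 : R, p.2)))}.
    apply: within_comp mc => //; apply: within_pair => p _.
      exact: cvg_cst.
    exact: cvg_within_snd.
  apply/within_cvgP => p Ap; apply: cvgB; last by move/within_cvgP : cc; exact.
  by apply: cvgD; [move/within_cvgP : ca; exact|move/within_cvgP : cb; exact].
- move=> [t x] [/=]; rewrite in_itv/= => /andP[t0 t1] Ax.
  have [t2|/ltW t2] := leP t 2^-1.
    by rewrite HE//; apply: HB; split => //=; rewrite ?in_itv/=; lra.
  by rewrite KE//; apply: KB; split => //=; rewrite ?in_itv/=; lra.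
- by move=> x Ax /=; rewrite HE ?invr_ge0// mulr0 H0.
- move=> x Ax /=; rewrite KE ?invf_le1//; last lra.
  by rewrite (_ : 2 * 1 - 1 = 1) ?K1//; lra.
Qed.

End General.

Lemma homotopic_post (T : topologicalType) (A : set T) (B C : set V)
    (h : V -> V) (f g : T -> V) :
  {within B, continuous h} -> set_fun B C h -> homotopic R A B f g ->
  homotopic R A C (h \o f) (h \o g).
Proof.
move=> ch hC [H [cH HB H0 H1]]; exists (h \o H); split.
- exact: within_comp cH ch HB.
- by move=> p /HB/hC.
- by move=> x Ax /=; rewrite H0.
- by move=> x Ax /=; rewrite H1.
Qed.

End Homotopy.

Lemma within_comp_snd (R : realType) (T U : topologicalType) (I : set R) (A : set T)
    (w : T -> U) :
  {within A, continuous w} -> {within I `*` A, continuous (w \o snd)}.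
Proof.
move=> cw; apply: (@within_comp _ _ _ (I `*` A) A snd w) => //.
  by apply/within_cvgP => p _; exact: cvg_within_snd.
by move=> [t x] [].
Qed.

(** Restricted to a small sphere of vectors [v], this is the map whose homotopy class is the local
    degree of [k] at [y]. *)
Definition germ (R : realType) n (k : 'rV[R]_n -> 'rV[R]_n) (y v : 'rV[R]_n) :=
  k (y + v) - k y.

Section Germs.
Variables (R : realType) (n : nat).
Local Notation V := 'rV[R]_n.
Local Notation I := (`[0%R, 1%R]%classic : set R).
Local Notation V0 := (~` [set (0 : V)]).
Implicit Types (k : V -> V) (x y : V) (e rho : R).

Definition embedding_near k y rho :=
  {within [set z | `|z - y| <= rho], continuous k} /\
  forall z z', `|z - y| <= rho -> `|z' - y| <= rho -> k z = k z' -> z = z'.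

Lemma embedding_near_sub k y y' rho rho' : embedding_near k y rho ->
  `|y' - y| + rho' <= rho -> embedding_near k y' rho'.
Proof.
move=> [ck kinj] yy'.
have sub z : `|z - y'| <= rho' -> `|z - y| <= rho.
  by move=> zy; rewrite (le_trans (ler_distD y' _ _))//; lra.
split; first exact: continuous_subspaceW ck.
by move=> z z' /sub h /sub h'; exact: kinj.
Qed.

Lemma germ_neq0 k y rho v : embedding_near k y rho -> `|v| <= rho -> v != 0 ->
  germ k y v != 0.
Proof.
move=> [_ kinj] vr; apply: contra_neq => /subr0_eq h.
have rho0 : 0 <= rho by rewrite (le_trans _ vr).
have := kinj _ _ _ _ h; rewrite addrAC subrr add0r normr0 => /(_ vr rho0).
by rewrite -[RHS]addr0 => /addrI.
Qed.

Lemma within_germ k y rho : embedding_near k y rho ->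
  {within [set v | `|v| <= rho], continuous (germ k y)}.
Proof.
move=> [ck _]; set D := [set z | _] in ck.
have cg : {within [set v | `|v| <= rho], continuous (k \o +%R y)}.
  apply: (within_comp (B := D)) => //.
    apply: continuous_subspaceT => u.
    have : y + v @[v --> nbhs u] --> y + u; last exact.
    by apply: cvgD; [exact: cvg_cst|exact: cvg_id].
  by move=> v /=; rewrite /D /= addrAC subrr add0r.
apply/within_cvgP => p Ap; apply: cvgB; last exact: cvg_cst.
by move/within_cvgP : cg; exact.
Qed.

(** A homotopy in the punctured space may leave the ball on which an embedding is controlled; this
    radial retraction brings it back without creating zeros. *)
Definition clip rho (v : V) : V := Order.min 1 (rho / `|v|) *: v.

Lemma clip_id rho v : `|v| <= rho -> clip rho v = v.
Proof.
have [->|v0] := eqVneq v 0; first by rewrite /clip scaler0.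
by move=> vr; rewrite /clip min_l ?scale1r// ler_pdivlMr ?normr_gt0// mul1r.
Qed.

Lemma norm_clip rho v : 0 < rho -> `|clip rho v| <= rho.
Proof.
move=> r0; have [->|v0] := eqVneq v 0; first by rewrite /clip scaler0 normr0 ltW.
rewrite /clip normrZ ger0_norm; last first.
  by rewrite le_min ler01 divr_ge0// ltW.
by rewrite -ler_pdivlMr ?normr_gt0// ge_min lexx orbT.
Qed.

Lemma clip_neq0 rho v : 0 < rho -> v != 0 -> clip rho v != 0.
Proof.
move=> r0 v0; rewrite scaler_eq0 negb_or v0 andbT lt0r_neq0// lt_min ltr01.
by rewrite divr_gt0// normr_gt0.
Qed.

Lemma within_clip rho : {within V0, continuous (clip rho)}.
Proof.
apply/within_cvgP => p /eqP p0; apply: cvgZ; last exact: cvg_within_id.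
rewrite -[Order.min _ _]opprK oppr_min; under eq_fun do
  rewrite -[Order.min _ _]opprK oppr_min.
apply: cvgN; apply: cvg_maxr; first exact: cvg_cst.
apply: cvgN; apply: cvgM; first exact: cvg_cst.
apply: cvgV; first by rewrite normr_eq0.
by apply: cvg_norm; exact: cvg_within_id.
Qed.

Variables (T : topologicalType) (A : set T).

Lemma germ_homotopic k y rho (w w' : T -> V) : 0 < rho ->
  embedding_near k y rho -> (forall u, A u -> `|w u| <= rho) ->
  (forall u, A u -> `|w' u| <= rho) ->
  homotopic R A V0 w w' -> homotopic R A V0 (germ k y \o w) (germ k y \o w').
Proof.
move=> r0 ek wr wr' /(@homotopic_post _ _ _ _ _ V0 (germ k y \o clip rho)) h.
apply: homotopic_ext (h _ _) => /=.
- by move=> u Au /=; rewrite clip_id//; exact: wr.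
- by move=> u Au /=; rewrite clip_id//; exact: wr'.
- apply: (@within_comp _ _ _ V0 _ (clip rho) (germ k y)) _ (within_germ ek) _.
    exact: within_clip.
  by move=> v _ /=; exact: norm_clip.
- move=> v /eqP v0; apply/eqP; apply: (germ_neq0 ek); first exact: norm_clip.
  exact: clip_neq0.
Qed.

Lemma homotopic_scale (w : T -> V) c c' : 0 < c -> 0 < c' ->
  {within A, continuous w} -> set_fun A V0 w ->
  homotopic R A V0 (fun u => c *: w u) (fun u => c' *: w u).
Proof.
move=> c0 c0' cw w0.
exists (fun p => ((1 - p.1) * c + p.1 * c') *: w p.2); split.
- apply/within_cvgP => p Ap; apply: cvgZ; last first.
    by have /within_cvgP := @within_comp_snd R _ _ I _ _ cw; exact.
  apply: cvgD; apply: cvgM; (try exact: cvg_cst); last exact: cvg_within_fst.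
  by apply: cvgB; [exact: cvg_cst|exact: cvg_within_fst].
- move=> [t x] [/=]; rewrite in_itv/= => /andP[t0 t1] Ax.
  apply/eqP; rewrite scaler_eq0 negb_or; apply/andP; split; last exact/eqP/w0.
  apply: lt0r_neq0; have [->|t0'] := eqVneq t 0; first by rewrite subr0; lra.
  have tc : 0 < t * c' by rewrite mulr_gt0// lt_neqAle t0 eq_sym t0'.
  by rewrite ltr_wpDl// mulr_ge0 ?subr_ge0// ltW.
- by move=> x _; rewrite subr0 mul1r mul0r addr0.
- by move=> x _; rewrite subrr mul0r mul1r add0r.
Qed.

End Germs.

Section SphereGerms.
Variables (R : realType) (n : nat).
Local Notation V := 'rV[R]_n.
Local Notation I := (`[0%R, 1%R]%classic : set R).
Local Notation V0 := (~` [set (0 : V)]).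
Local Notation S := (unit_sphere R n).

Lemma sphere_norm_le1 u : S u -> `|u| <= 1.
Proof.
rewrite /unit_sphere /= => u1; apply: norm_unit_ball.
by rewrite /closed_unit_ball /= u1.
Qed.

Lemma norm_scale_sphere (e : R) u : 0 <= e -> S u -> `|e *: u| <= e.
Proof. by move=> e0 /sphere_norm_le1 u1; rewrite normrZ ger0_norm// ler_piMr. Qed.

Lemma homotopic_scale_id (c c' : R) : 0 < c -> 0 < c' ->
  homotopic R S V0 (fun u => c *: u) (fun u => c' *: u).
Proof.
move=> c0 c0'; apply: (@homotopic_scale _ _ _ _ id) => //.
  by apply: continuous_subspaceT => u; exact: cvg_id.
by move=> u /sphere_neq0/eqP.
Qed.

(** The base point slides along the segment from [x] to [x']. The bound keeps the moving sphere in
    the ball where [k] is injective, so no zero appears. *)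
Lemma germ_move (k : V -> V) x x' (e rho : R) : 0 < e ->
  embedding_near k x rho -> `|x' - x| + e <= rho ->
  homotopic R S V0 (fun u => germ k x (e *: u)) (fun u => germ k x' (e *: u)).
Proof.
move=> e0 ek xe; pose b t := x + t *: (x' - x).
have bnd t : 0 <= t <= 1 -> `|b t - x| + e <= rho.
  move=> /andP[t0 t1]; rewrite /b addrAC subrr add0r normrZ ger0_norm//.
  by rewrite (le_trans _ xe)// lerD2r ler_piMl.
pose D := [set z | `|z - x| <= rho].
have cb (p : R * V) :
    (fun q : R * V => b q.1) @ within (I `*` S) (nbhs p) --> b p.1.
  rewrite /b; apply: cvgD; first exact: cvg_cst.
  by apply: cvgZ; [exact: cvg_within_fst|exact: cvg_cst].
have ck := ek.1.
exists (fun p => germ k (b p.1) (e *: p.2)); split.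
- have c1 : {within I `*` S, continuous (k \o (fun p => b p.1 + e *: p.2))}.
    apply: (within_comp (B := D)) ck _.
      apply/within_cvgP => p _; apply: cvgD; first exact: cb.
      by apply: cvgZ; [exact: cvg_cst|exact: cvg_within_snd].
    move=> [t u] [/=]; rewrite in_itv/= => /bnd tb Su; rewrite /D /= addrAC.
    by rewrite (le_trans (ler_normD _ _))// (le_trans _ tb)// lerD2l
      norm_scale_sphere// ltW.
  have c2 : {within I `*` S, continuous (k \o (fun p => b p.1))}.
    apply: (within_comp (B := D)) ck _.
      by apply/within_cvgP => p _; exact: cb.
    move=> [t u] [/=]; rewrite in_itv/= => /bnd tb Su; rewrite /D /=.
    by rewrite (le_trans _ tb)// lerDl ltW.
  apply/within_cvgP => p Ap; apply: cvgB.
    by move/within_cvgP : c1; exact.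
  by move/within_cvgP : c2; exact.
- move=> [t u] [/=]; rewrite in_itv/= => /bnd tb Su.
  apply/eqP; apply: (@germ_neq0 _ _ _ _ e).
  + exact: embedding_near_sub ek tb.
  + by rewrite norm_scale_sphere// ltW.
  + by rewrite scaler_eq0 negb_or gt_eqF//= sphere_neq0.
- by move=> u _; rewrite /b scale0r addr0.
- by move=> u _; rewrite /b scale1r addrC subrK.
Qed.

End SphereGerms.

(** The homotopy is spread radially over 1/2 <= |u| <= 1, with time read from the sup norm and
    direction from the Euclidean one, and multiplied by the Euclidean norm. The result is a map
    excluded by [id_refl_not_joined]. *)
Lemma id_not_homotopic_refl (R : realType) (n : nat) :
  ~ homotopic R (unit_sphere R n.+1) (~` [set (0 : 'rV[R]_n.+1)]) id (@refl R n.+1).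
Proof.
move=> [H [cH HB H0 H1]]; pose V : normedModType R := 'rV[R]_n.+1.
pose a (u : V) : R * V := (Order.max 0 (2 * `|u| - 1), (enorm u)^-1 *: u).
pose F (u : V) : V := enorm u *: H (a u).
pose K := [set u : V | 4^-1 <= `|u| <= 1].
have K0 u : K u -> u != 0.
  by move=> /andP[u4 _]; rewrite -normr_gt0 (lt_le_trans _ u4)// invr_gt0.
have aK : set_fun K (`[0%R, 1%R] `*` unit_sphere R n.+1) a.
  move=> u Ku; split; last exact: sphere_normalize (K0 _ Ku).
  case/andP: Ku => u4 u1; rewrite /= in_itv/= le_max lexx ge_max ler01/=; lra.
apply: (@id_refl_not_joined R n F).
- have cHa : {within K, continuous (H \o a)}.
    apply: within_comp aK => //; apply: within_pair => p Kp.
      apply: cvg_maxr; first exact: cvg_cst.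
      apply: cvgB; last exact: cvg_cst.
      apply: cvgM; first exact: cvg_cst.
      by apply: cvg_norm; exact: cvg_within_id.
    apply: cvgZ; last exact: cvg_within_id.
    apply: cvgV; first by rewrite gt_eqF// enorm_gt0 K0.
    by apply: cvg_enorm; exact: cvg_within_id.
  apply/within_cvgP => p Kp; apply: cvgZ.
    by apply: cvg_enorm; exact: cvg_within_id.
  by move/within_cvgP : cHa; exact.
- move=> u Ku; rewrite scaler_eq0 negb_or gt_eqF ?enorm_gt0 ?(K0 _ Ku)//=.
  by apply/eqP => /(HB _ (aK _ Ku)).
- move=> u u2; have [->|u0] := eqVneq u 0.
    by rewrite /F /enorm sqnorm0 sqrtr0 scale0r.
  rewrite /F /a max_l; last lra.
  rewrite H0; last exact: sphere_normalize.
  by rewrite scalerA divff ?scale1r// gt_eqF// enorm_gt0.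
- move=> u u1; have u0 : u != 0 by rewrite -normr_gt0 u1.
  rewrite /F /a u1 max_r; last lra.
  rewrite (_ : 2 * 1 - 1 = 1); last lra.
  rewrite H1; last exact: sphere_normalize.
  by rewrite reflZ scalerA divff ?scale1r// gt_eqF// enorm_gt0.
Qed.

(** * Inversion in the unit sphere *)

Section Inversion.
Variables (R : realType).

Definition inversion n (x : 'rV[R]_n) : 'rV[R]_n := (sqnorm x)^-1 *: x.

Lemma sqnorm_inversion n (x : 'rV[R]_n) : sqnorm (inversion x) = (sqnorm x)^-1.
Proof.
rewrite /inversion sqnormZ; have [->|x0] := eqVneq (sqnorm x) 0.
  by rewrite invr0 mulr0.
by rewrite expr2 -mulrA mulVf// mulr1.
Qed.

Lemma inversionK n : involutive (@inversion n).
Proof.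
move=> x; rewrite {1}/inversion sqnorm_inversion invrK /inversion scalerA.
have [->|x0] := eqVneq x 0; first by rewrite scaler0.
by rewrite divff ?scale1r// sqnorm_eq0.
Qed.

Lemma inversion_sphere n (x : 'rV[R]_n) : sqnorm x = 1 -> inversion x = x.
Proof. by rewrite /inversion => ->; rewrite invr1 scale1r. Qed.

Lemma inversion_eq0 n (x : 'rV[R]_n) : (inversion x == 0) = (x == 0).
Proof. by rewrite -!sqnorm_eq0 sqnorm_inversion invr_eq0. Qed.

Lemma inversion_refl n (x : 'rV[R]_n) : inversion (refl x) = refl (inversion x).
Proof. by rewrite /inversion reflZ sqnorm_refl. Qed.

Lemma cvg_inversion n (x : 'rV[R]_n) : x != 0 ->
  inversion y @[y --> nbhs x] --> inversion x.
Proof.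
move=> x0; apply: cvgZ; last exact: cvg_id.
by apply: cvgV; [rewrite sqnorm_eq0|apply: cvg_sqnorm; exact: cvg_id].
Qed.

Section Germ.
Variable n : nat.
Local Notation V := 'rV[R]_n.+1.
Local Notation I := (`[0%R, 1%R]%classic : set R).
Local Notation V0 := (~` [set (0 : V)]).
Local Notation S := (unit_sphere R n.+1).

(* sqnorm y times the reflection in the hyperplane orthogonal to y *)
Let sigma (y u : V) : V := sqnorm y *: u - (2 * dotp y u) *: y.

Lemma sigma_neq0 y u : y != 0 -> u != 0 -> sigma y u != 0.
Proof.
move=> y0; apply: contra_neq => /subr0_eq e.
have sy : sqnorm y != 0 by rewrite sqnorm_eq0.
have d0 : dotp y u = 0.
  have := congr1 (dotp y) e; rewrite !dotpZr -sqnormE => e'.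
  by apply: (mulfI sy); lra.
by move/eqP: e; rewrite d0 mulr0 scale0r scaler_eq0 (negbTE sy) => /eqP.
Qed.

(** The normal vector of the hyperplane moves along a segment to [s] times the first basis vector.
    The sign [s] follows the first coordinate of [x], so that the segment avoids 0. *)
Lemma sigma_refl (x : V) : x != 0 -> homotopic R S V0 (sigma x) (@refl R n.+1).
Proof.
move=> x0; pose s : R := if 0 <= x ord0 ord0 then 1 else -1.
pose b (t : R) : V := (1 - t) *: x + t *: (s *: delta_mx ord0 ord0).
have s1 : s ^+ 2 = 1 by rewrite /s; case: ifP => _; rewrite ?sqrrN expr1n.
have b0 t : 0 <= t <= 1 -> b t != 0.
  move=> /andP[t0 t1]; have [->|t0'] := eqVneq t 0.
    by rewrite /b subr0 scale1r scale0r addr0.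
  have {t0'}t0 : 0 < t by rewrite lt_neqAle eq_sym t0'.
  apply/eqP => /rowP/(_ ord0); rewrite !mxE eqxx mulr1 /s.
  by case: leP => xx; nra.
have cb (p : R * V) : (fun q : R * V => b q.1) @ within (I `*` S) (nbhs p) --> b p.1.
  apply: cvgD.
    apply: cvgZ; last exact: cvg_cst.
    by apply: cvgB; [exact: cvg_cst|exact: cvg_within_fst].
  by apply: cvgZ; [exact: cvg_within_fst|exact: cvg_cst].
exists (fun p => sigma (b p.1) p.2); split.
- apply/within_cvgP => p _; apply: cvgB.
    by apply: cvgZ; [apply: cvg_sqnorm; exact: cb|exact: cvg_within_snd].
  apply: cvgZ; last exact: cb.
  apply: cvgM; first exact: cvg_cst.
  by apply: cvg_dotp; [exact: cb|exact: cvg_within_snd].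
- move=> [t u] [/=]; rewrite in_itv/= => /b0 bt /sphere_neq0 u0.
  by apply/eqP; exact: sigma_neq0.
- by move=> u _; rewrite /b subr0 scale1r scale0r addr0.
- move=> u _; rewrite /b subrr scale0r add0r scale1r /sigma sqnormZ s1 mul1r.
  have -> : sqnorm (delta_mx ord0 ord0 : V) = 1.
    rewrite /sqnorm (bigD1 ord0)//= big1 ?addr0; first by rewrite mxE !eqxx expr1n.
    by move=> i i0; rewrite mxE (negbTE i0) andbF expr0n.
  have -> : dotp (s *: delta_mx ord0 ord0 : V) u = s * u ord0 ord0.
    rewrite dotpZl /dotp (bigD1 ord0)//= big1 ?addr0; first by rewrite mxE !eqxx mul1r.
    by move=> i i0; rewrite mxE (negbTE i0) andbF mul0r.
  apply/rowP => i; rewrite !mxE mul1r; case: (eqVneq i ord0) => [->|i0] /=.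
    have -> : 2 * (s * u ord0 ord0) * (s * 1%:R) = 2 * (s ^+ 2) * u ord0 ord0 by ring.
    by rewrite s1; ring.
  by rewrite ifF ?mulr0 ?subr0//; apply/negbTE.
Qed.

(** For v = t e u the germ of the inversion at x is (|x|^2 v - (2 <x,v> + |v|^2) x) / (|x|^2 |x +
    v|^2), with Euclidean norms in this formula. Replacing v by v / (t e) in the numerator gives a
    family that extends to t = 0, where it becomes a multiple of [sigma x]. *)
Lemma inversion_germ (x : V) (e : R) : 0 < e < `|x| ->
  homotopic R S V0 (fun u => germ (@inversion n.+1) x (e *: u)) (@refl R n.+1).
Proof.
move=> /andP[e0 ex]; have x0 : x != 0 by rewrite -normr_gt0 (lt_trans e0).
apply: homotopic_trans (sigma_refl x0).
have sx : sqnorm x != 0 by rewrite sqnorm_eq0.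
have xtu t u : 0 <= t <= 1 -> S u -> x + (t * e) *: u != 0.
  move=> /andP[t0 t1] Su; apply/eqP => /eqP; rewrite addr_eq0 => /eqP xe.
  move: ex; rewrite xe normrN ltNge => /negP; apply.
  rewrite (le_trans (norm_scale_sphere _ Su)) ?mulr_ge0 ?(ltW e0)//.
  by rewrite ler_piMl// ltW.
pose w (p : R * V) := (2 * dotp x p.2 + p.1 * e * sqnorm p.2).
(* The positive numerator is chosen to make the factor 1 at time 0, giving [sigma x], and to restore
   the factor [e] of the germ at time 1. *)
pose c (p : R * V) := ((1 - p.1) * sqnorm x ^+ 2 + p.1 * e) /
  (sqnorm x * sqnorm (x + (p.1 * e) *: p.2)).
pose H (p : R * V) : V := c p *: (sqnorm x *: p.2 - w p *: x).
apply: homotopic_sym; exists H; split.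
- apply/within_cvgP => p [/= ]; rewrite in_itv/= => p1 p2.
  have c1 := @cvg_within_fst _ _ (I `*` S) p.
  have c2 := @cvg_within_snd _ _ (I `*` S) p.
  have cte : (fun q : R * V => q.1 * e) @ within (I `*` S) (nbhs p) --> p.1 * e.
    by apply: cvgM => //; exact: cvg_cst.
  apply: cvgZ.
    apply: cvgM.
      apply: cvgD => //; apply: cvgM; last exact: cvg_cst.
      by apply: cvgB => //; exact: cvg_cst.
    apply: cvgV; first by rewrite mulf_neq0// sqnorm_eq0 xtu.
    apply: cvgM; first exact: cvg_cst.
    apply: cvg_sqnorm; apply: cvgD; first exact: cvg_cst.
    exact: cvgZ.
  apply: cvgB; first by apply: cvgZ => //; exact: cvg_cst.
  apply: cvgZ; last exact: cvg_cst.
  apply: cvgD; apply: cvgM => //; try exact: cvg_cst.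
    by apply: cvg_dotp => //; exact: cvg_cst.
  exact: cvg_sqnorm.
- move=> [t u] [/=]; rewrite in_itv/= => tt Su.
  have u0 := sphere_neq0 Su; have xu := xtu _ _ tt Su; have /andP[t0 t1] := tt.
  have sxu : sqnorm (x + (t * e) *: u) != 0 by rewrite sqnorm_eq0.
  apply/eqP; rewrite /H scaler_eq0 negb_or; apply/andP; split.
    rewrite /c /= mulf_neq0// ?invr_neq0 ?mulf_neq0//.
    have sx2 : 0 < sqnorm x ^+ 2 by rewrite exprn_gt0// sqnorm_gt0.
    have [->|t0'] := eqVneq t 0; first by rewrite subr0 mul1r mul0r addr0 gt_eqF.
    have te : 0 < t * e by rewrite mulr_gt0// lt_neqAle eq_sym t0'.
    by rewrite gt_eqF// ltr_wpDl// mulr_ge0 ?subr_ge0// ltW.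
  (* Pairing a zero with [x] and with [u] determines <x,u> and |x|^2 in terms of |u|^2, and forces
     |x + t e u|^2 = 0, against [xtu]. *)
  apply/negP => /eqP /subr0_eq eq1; move: xu; rewrite -sqnorm_eq0 => /negP; apply.
  have sqE : sqnorm (x + (t * e) *: u) =
      sqnorm x + 2 * (t * e) * dotp x u + (t * e) ^+ 2 * sqnorm u.
    by rewrite !sqnormE !dotpDr !dotpDl !dotpZr !dotpZl (dotpC u x); ring.
  have eq2 := congr1 (dotp x) eq1; rewrite !dotpZr -sqnormE /w /= in eq2.
  have dE : dotp x u = - (t * e * sqnorm u).
    by apply: (mulfI sx); rewrite eq2; move: eq2; lra.
  have eq3 := congr1 (dotp u) eq1; rewrite !dotpZr -sqnormE (dotpC u x) /w /= in eq3.
  have su : sqnorm u != 0 by rewrite sqnorm_eq0.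
  have eq4 : sqnorm x = (t * e) ^+ 2 * sqnorm u.
    by apply: (mulIf su); rewrite eq3 dE; ring.
  by apply/eqP; rewrite sqE dE eq4; ring.
- by move=> u _; rewrite /H /c /w /= subr0 mul1r !mul0r !addr0 scale0r addr0 expr2
    divff ?mulf_neq0// scale1r.
- move=> u Su; rewrite /H /c /w /= subrr mul0r add0r !mul1r.
  have := xtu 1 u; rewrite lexx ler01 => /(_ isT Su); rewrite mul1r => xu.
  have sxu : sqnorm (x + e *: u) != 0 by rewrite sqnorm_eq0.
  have sqE : sqnorm (x + e *: u) = sqnorm x + 2 * e * dotp x u + e ^+ 2 * sqnorm u.
    by rewrite !sqnormE !dotpDr !dotpDl !dotpZr !dotpZl (dotpC u x); ring.
  rewrite /germ /inversion; apply/rowP => i; rewrite !mxE.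
  have -> : 2 * dotp x u + e * sqnorm u = (sqnorm (x + e *: u) - sqnorm x) / e.
    by rewrite sqE; field; rewrite gt_eqF.
  by field; rewrite sx sxu gt_eqF.
Qed.

End Germ.
End Inversion.

(** * Parity functionals *)

Lemma F2_eq1 (x : 'F_2) : x != 0 -> x = 1.
Proof. by case: x => [[|[|//]]] i //= _; apply/val_inj. Qed.

Lemma F2_addxx (V : lmodType 'F_2) (v : V) : v + v = 0.
Proof.
rewrite -[v]scale1r -scalerDl.
by rewrite (addrr_pchar2 (pchar_Fp _)) ?scale0r.
Qed.

Lemma F2_oppr (V : lmodType 'F_2) (v : V) : - v = v.
Proof. by apply/eqP; rewrite eq_sym -addr_eq0 F2_addxx. Qed.

Lemma F2_even m : (m.*2)%:R = 0 :> 'F_2.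
Proof. by rewrite -addnn natrD (addrr_pchar2 (pchar_Fp _)). Qed.

Lemma F2_odd m : odd m -> m%:R = 1 :> 'F_2.
Proof.
by move=> om; rewrite -[m]odd_double_half om natrD F2_even addr0.
Qed.

Section OddFunctionals.
Variables (I : finType) (K : pred I) (n : nat) (g : I -> 'rV['F_2]_n).

(** Here [e] counts generators modulo 2. If (0, 1) lies in the span of the rows (g i, 1), adding the
    rows one by one reaches [Q 0 1]. Otherwise a column of the cokernel kills these rows but not (0,
    1); its last entry is 1, and its first [n] entries form [phi]. *)
Lemma odd_functional (Q : 'rV['F_2]_n -> 'F_2 -> Prop) :
  Q 0 0 -> (forall i v e, K i -> Q v e -> Q (v + g i) (e + 1)) -> ~ Q 0 1 ->
  exists phi : 'cV['F_2]_n, forall i, K i -> (g i *m phi) ord0 ord0 = 1.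
Proof.
move=> Q0 QS nQ.
pose M : 'M['F_2]_(#|I|, n + 1) := \matrix_i
  (if K (enum_val i) then row_mx (g (enum_val i)) 1%:M else 0).
pose t : 'rV['F_2]_(n + 1) := row_mx 0 1%:M.
have [|] := boolP (t <= M)%MS.
  move=> /submxP[D tD]; exfalso; apply: nQ.
  have : forall r, Q (lsubmx (\sum_(i <- r) D ord0 i *: row i M))
      (rsubmx (\sum_(i <- r) D ord0 i *: row i M) ord0 ord0).
    elim=> [|i r IH]; first by rewrite big_nil !linear0 mxE.
    rewrite big_cons addrC rowK; case: ifP => Ki; last by rewrite scaler0 addr0.
    have [->|/F2_eq1->] := eqVneq (D ord0 i) 0; first by rewrite scale0r addr0.
    rewrite scale1r !linearD /= row_mxKl row_mxKr [X in Q _ X]mxE.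
    by rewrite [X in Q _ (_ + X)]mxE; exact: QS.
  move=> /(_ (index_enum _)); rewrite -mulmx_sum_row -tD.
  by rewrite row_mxKl row_mxKr mxE.
rewrite submxE; move: (cokermx M) (mulmx_coker M) => C MC /eqP /rowP /existsNP[j].
rewrite [in X in _ <> X]mxE => /eqP tj.
pose psi := col j C; exists (usubmx psi) => i Ki.
have t1 : dsubmx psi ord0 ord0 = 1.
  apply: F2_eq1; apply: contraNneq tj => d0; apply/eqP.
  have -> : (t *m C) ord0 j = (t *m psi) ord0 ord0.
    by rewrite /psi colE mulmxA -colE [RHS]mxE.
  by rewrite -[psi]vsubmxK mul_row_col mul0mx add0r mul1mx.
have : (row_mx (g i) 1%:M *m psi) ord0 ord0 = 0.
  have -> : row_mx (g i) 1%:M = row (enum_rank i) M.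
    by rewrite rowK enum_rankK Ki.
  by rewrite /psi colE mulmxA -row_mul MC row0 mul0mx mxE.
rewrite -[psi]vsubmxK mul_row_col mul1mx mxE t1 vsubmxK => /eqP.
by rewrite addr_eq0 => /eqP ->; apply/val_inj.
Qed.

Lemma odd_basis_functional (b : n.-tuple 'rV['F_2]_n) : basis_of fullv b ->
  (forall i, K i -> exists B : {set 'I_n},
     odd #|B| /\ g i = \sum_(j in B) tnth b j) ->
  exists phi : 'cV['F_2]_n, forall i, K i -> (g i *m phi) ord0 ord0 = 1.
Proof.
move=> bb h.
(* The sum of the coordinates counts basis vectors modulo 2. *)
pose f v := \sum_(k < n) coord b k v.
exists (\col_j f (delta_mx ord0 j)) => i /h[B [oB gE]].
have -> : (g i *m \col_j f (delta_mx ord0 j)) ord0 ord0 = f (g i).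
  rewrite [in RHS](row_sum_delta (g i)) /f.
  under [RHS]eq_bigr do rewrite linear_sum.
  rewrite exchange_big mxE /=; apply: eq_bigr => j _; rewrite mxE mulr_sumr.
  by apply: eq_bigr => k _; rewrite linearZ.
rewrite gE /f -(F2_odd oB) -sum1_card natr_sum [RHS]big_mkcond.
apply: eq_bigr => k _; rewrite linear_sum (eq_bigr (fun j => (k == j)%:R)); last first.
  by move=> j _ /=; rewrite (tnth_nth 0) (coord_free _ _ (basis_free bb)) eq_sym.
case: ifPn => kB.
  rewrite (bigD1 k)//= eqxx big1 ?addr0// => j /andP[_ jk].
  by rewrite eq_sym (negbTE jk).
rewrite big1// => j jB; case: eqP => // kj.
by rewrite kj jB in kB.
Qed.

(** For nonzero [phi] an involution B sending the all-ones column to [phi] is built as a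
    transvection 1 + c delta. Its rows form the basis: the coordinates of [v] in them are v B, and
    their sum is v B 1 = v phi. For [phi = 0] the hypothesis leaves no index in [K], and the
    standard basis serves. *)
Lemma functional_odd_basis (phi : 'cV['F_2]_n) :
  (forall i, K i -> (g i *m phi) ord0 ord0 = 1) ->
  exists b : n.-tuple 'rV['F_2]_n, basis_of fullv b /\
    forall i, K i -> exists B : {set 'I_n},
     odd #|B| /\ g i = \sum_(j in B) tnth b j.
Proof.
move=> h.
have [B [BB Bphi]] : exists B : 'M['F_2]_n, B *m B = 1%:M /\
    forall i, K i -> g i *m B *m const_mx 1 = g i *m phi.
  have [phi0|phi0] := eqVneq phi 0.
    exists 1%:M; split; first by rewrite mulmx1.
    by move=> i /h; rewrite phi0 mulmx0 mxE => /eqP; rewrite eq_sym oner_eq0.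
  have [i0 phi1] : exists i0, phi i0 ord0 = 1.
    apply: contrapT => /forallNP nphi; move/eqP : phi0; apply; apply/colP => i.
    by rewrite mxE; apply/eqP/negPn/negP => /F2_eq1; exact: nphi.
  pose c : 'cV['F_2]_n := const_mx 1 - phi.
  have dc : delta_mx ord0 i0 *m c = 0 :> 'M['F_2]_1.
    by rewrite -rowE; apply/rowP => j; rewrite !mxE ord1 phi1 subrr.
  have d1 : delta_mx ord0 i0 *m const_mx 1 = 1%:M :> 'M['F_2]_1.
    by rewrite -rowE; apply/rowP => j; rewrite !mxE ord1.
  exists (1%:M + c *m delta_mx ord0 i0); split.
    have cd0 : c *m delta_mx ord0 i0 *m (c *m delta_mx ord0 i0) = 0.
      by rewrite -mulmxA (mulmxA (delta_mx ord0 i0)) dc mul0mx mulmx0.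
    by rewrite mulmxDl !mulmxDr !mul1mx mulmx1 cd0 addr0 -addrA F2_addxx addr0.
  move=> i _; rewrite -mulmxA; congr (_ *m _).
  rewrite mulmxDl mul1mx -mulmxA d1 mulmx1 /c addrA F2_addxx add0r F2_oppr//.
pose b : n.-tuple 'rV['F_2]_n := [tuple row j B | j < n].
have span v : v = \sum_j (v *m B) ord0 j *: tnth b j.
  rewrite -{1}[v]mulmx1 -BB mulmxA mulmx_sum_row.
  by apply: eq_bigr => j _; rewrite tnth_mktuple.
exists b; split.
  rewrite basisEdim; apply/andP; split.
    apply/subvP => v _; rewrite [v]span; apply: memv_suml => j _.
    by rewrite memvZ// memv_span// mem_tnth.
  by rewrite size_tuple dimvf /dim /= mul1n.
move=> i Ki; exists [set j | (g i *m B) ord0 j == 1]%SET; split; last first.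
  rewrite {1}[g i]span [RHS]big_mkcond; apply: eq_bigr => j _; rewrite inE.
  case: eqP => [->|/eqP j1]; first by rewrite scale1r.
  have [->|/F2_eq1 e] := eqVneq ((g i *m B) ord0 j) 0; first by rewrite scale0r.
  by rewrite e eqxx in j1.
have : (g i *m B *m (const_mx 1 : 'cV_n)) ord0 ord0 = 1 by rewrite Bphi// h.
rewrite mxE; under eq_bigr do rewrite [X in _ * X]mxE mulr1.
rewrite (eq_bigr (fun j => (((g i *m B) ord0 j == 1) : nat)%:R)); last first.
  move=> j _; case: eqP => [->//|/eqP j1].
  have [->//|/F2_eq1 e] := eqVneq ((g i *m B) ord0 j) 0.
  by rewrite e eqxx in j1.
rewrite -natr_sum (_ : (\sum_j _)%N = #|[set j | (g i *m B) ord0 j == 1]%SET|);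
  last first.
  by rewrite -sum1dep_card [RHS]big_mkcond; apply: eq_bigr => j _; case: ifP.
move=> s1; rewrite -[odd _]negbK; apply/negP => even; move: s1.
rewrite -[X in X%:R]odd_double_half (negbTE even) add0n F2_even => /eqP.
by rewrite eq_sym oner_eq0.
Qed.

End OddFunctionals.

(** The open cone over [F] is the image of (0, oo) x ball under the continuous injection (r, w) |->
    r g(w), so it is open by invariance of domain. Together with the complement of the sphere it
    makes up the set. *)
Lemma open_sphere_cell (R : realType) (n : nat) (F : set 'rV[R]_n.+1) :
  F `<=` unit_sphere R n.+1 -> homeomorphic F (unit_ball R n) ->
  open [set x : 'rV[R]_n.+1 | sqnorm x != 1 \/ F x].
Proof.
move=> FS [f [g [_ cg fF gF [fK gK]]]].
pose rest (z : 'rV[R]_n.+1) : 'rV[R]_n := \row_j z ord0 (lift ord0 j).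
pose U := [set z : 'rV[R]_n.+1 | 0 < z ord0 ord0 /\ unit_ball R n (rest z)].
pose G (z : 'rV[R]_n.+1) := z ord0 ord0 *: g (rest z).
have cont_sq m : continuous (@sqnorm R m).
  move=> x; have : sqnorm y @[y --> nbhs x] --> sqnorm x; last exact.
  by apply: cvg_sqnorm; exact: cvg_id.
have crest : continuous rest.
  move=> x; have : rest y @[y --> nbhs x] --> rest x; last exact.
  apply: cvg_rowP => j; rewrite mxE; under eq_fun do rewrite mxE.
  by apply: cvg_coord; exact: cvg_id.
have oU : open U.
  apply: openI.
    apply: (@open_comp _ _ (fun z : 'rV[R]_n.+1 => z ord0 ord0) [set t | 0 < t]).
      by move=> z _; exact: coord_continuous.
    exact: open_gt.
  apply: (@open_comp _ _ (@sqnorm R n \o rest) [set t | t < 1]).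
    by move=> z _; apply: continuous_comp; [exact: crest|exact: cont_sq].
  exact: open_lt.
have cG : {within U, continuous G}.
  have cgr : {within U, continuous (g \o rest)}.
    apply: (within_comp (B := unit_ball R n)) => //.
      exact: continuous_subspaceT.
    by move=> z [].
  apply/within_cvgP => z Uz; apply: cvgZ.
    by apply: cvg_coord; exact: cvg_within_id.
  by move/within_cvgP : cgr; exact.
have iG : {in U &, injective G}.
  move=> z z' /set_mem[z0 zr] /set_mem[z0' zr'] e.
  have g1 := FS _ (gF _ zr); have g1' := FS _ (gF _ zr').
  rewrite /unit_sphere /= in g1 g1'.
  have e0 : z ord0 ord0 = z' ord0 ord0.
    have := congr1 (@sqnorm R _) e; rewrite !sqnormZ g1 g1' !mulr1 => /eqP.
    by rewrite eqrXn2// ?ltW// => /eqP.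
  have er : rest z = rest z'.
    rewrite -(gK (rest z)) ?inE// -(gK (rest z')) ?inE//; congr f.
    by move: e; rewrite /G e0 => /scalerI; apply; rewrite gt_eqF.
  apply/rowP => j; case: (unliftP ord0 j) => [k ->|-> //].
  by move/rowP : er => /(_ k); rewrite !mxE.
have oW := invariance_of_domain oU cG iG.
rewrite (_ : [set _ | _] = G @` U `|` ([set x | sqnorm x < 1] `|` [set x | 1 < sqnorm x])).
  apply: openU => //; apply: openU.
    apply: (@open_comp _ _ (@sqnorm R n.+1) [set t | t < 1]).
      by move=> z _; exact: cont_sq.
    exact: open_lt.
  apply: (@open_comp _ _ (@sqnorm R n.+1) [set t | 1 < t]).
    by move=> z _; exact: cont_sq.
  exact: open_gt.
apply/seteqP; split => [x [|Fx]|x [[z [z0 zr] <-]|[|]]] /=.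
- by rewrite neq_lt => /orP[]; right; [left|right].
- left; pose z : 'rV[R]_n.+1 :=
    \row_j (if unlift ord0 j is Some k then f x ord0 k else 1).
  have z0 : z ord0 ord0 = 1 by rewrite mxE unlift_none.
  have zr : rest z = f x by apply/rowP => k; rewrite !mxE liftK.
  exists z; first by rewrite /U /= z0 zr; split => //; exact: fF.
  by rewrite /G z0 zr scale1r fK ?inE.
- have [e|] := eqVneq (sqnorm (G z)) 1; last by left.
  right; move: e; rewrite /G sqnormZ (FS _ (gF _ zr)) mulr1.
  by move=> /eqP; rewrite sqrp_eq1 ?ltW// => /eqP ->; rewrite scale1r; exact: gF.
- by left; rewrite lt_eqF.
- by left; rewrite gt_eqF.
Qed.

(** * The space lying over the big cell and the facets *)

Section SmallCover.
Variables (R : realType) (n : nat) (d : Order.disp_t) (P : finBPOrderType d).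
Variable X : small_cover R n P.
Local Notation V := 'rV[R]_n.
Local Notation A := (carrier_circ X).
Local Notation Y := (small_cover_circ X).
Local Notation facet s := (cell_rank X s = 1%N).
Implicit Types (x y : V) (xi eta g : signs n) (s t : P).

Lemma unit_ball_carrier x : unit_ball R n x -> A x.
Proof. by move=> x1; left; rewrite big_cell. Qed.

Lemma facet_carrier s x : facet s -> face X s x -> A x.
Proof. by move=> s1 sx; right; exists s. Qed.

Lemma origin_in_ball : unit_ball R n 0.
Proof. by rewrite /unit_ball /= sqnorm0 ltr01. Qed.

Definition origin_pt : A := SigSub (mem_set (unit_ball_carrier origin_in_ball)).

(** Outside the carrier the value is the origin, so that [cpi] is a total function on the ambient
    space. *)
Definition pt x : A := insubd origin_pt x.

Lemma ptK x : A x -> set_val (pt x) = x.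
Proof. by move=> Ax; exact: (insubdK origin_pt (mem_set Ax)). Qed.

Lemma valKpt (p : A) : pt (set_val p) = p.
Proof. exact: (valKd origin_pt p). Qed.

Definition cpi x xi : Y := cover_pi X (pt x, xi : discrete_topology (signs n)).

Lemma cpi_surj (y : Y) : exists x xi, A x /\ y = cpi x xi.
Proof.
exists (set_val (repr y).1), (repr y).2; split; first exact: set_valP.
rewrite /cpi valKpt /cover_pi -[LHS]reprK.
by case: (repr y).
Qed.

Lemma cpiP x y xi eta : A x -> A y ->
  cpi x xi = cpi y eta <->
  x = y /\ forall s, face X s x -> eta - xi \in sbar X s.
Proof.
move=> Ax Ay.
have cosetP s : lcoset (sbar X s) xi = lcoset (sbar X s) eta <->
    eta - xi \in sbar X s.
  rewrite addrC -FinRing.zmodVgE -FinRing.zmodMgE -mem_lcoset; split => [e|h].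
    by apply/lcoset_eqP; rewrite -!lcosetE; symmetry.
  by symmetry; rewrite !lcosetE; move/lcoset_eqP: h.
split.
  move=> /eqquotP /asboolP[] /=; rewrite !ptK// => xy h; split => // s /h.
  by move=> /cosetP.
move=> [xy h]; apply/eqquotP/asboolP; rewrite /= !ptK//; split => // s /h.
by move=> /cosetP.
Qed.

(** The sheets are discrete, so openness in the quotient can be tested on one sheet at a time, in
    the coordinates of the ambient space. *)
Lemma open_cpiP (O : set Y) : open O <->
  forall x xi, A x -> O (cpi x xi) -> \forall y \near x, A y -> O (cpi y xi).
Proof.
split => [oO x xi Ax Ox|h].
  have oO' : open ((@cover_pi _ _ _ _ X A) @^-1` O) by exact: oO.
  have : nbhs ((pt x, xi : discrete_topology (signs n)) : sheets A)
    ((@cover_pi _ _ _ _ X A) @^-1` O) by exact: open_nbhs_nbhs.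
  move=> [[U W] [/= Ux Wxi] UW].
  move: Ux; rewrite nbhsE => -[_ [[B oB <-] Bx] BU].
  have : nbhs x B by apply: open_nbhs_nbhs; split => //; rewrite -(ptK Ax).
  apply: filterS => y By Ay; apply: (UW (pt y, xi)); split => /=.
    by apply: BU; rewrite /= ptK.
  exact: (nbhs_singleton Wxi).
suff : open ((@cover_pi _ _ _ _ X A) @^-1` O) by [].
rewrite openE => -[p xi] Op.
have Ap : A (set_val p) by exact: set_valP.
have : nbhs (set_val p) [set y | A y -> O (cpi y xi)].
  by apply: h => //; rewrite /cpi valKpt.
rewrite nbhsE => -[B [oB Bp] BO].
exists (set_val @^-1` B, [set xi]); first split => /=.
- by apply: open_nbhs_nbhs; split => //; exists B.
- exact: discrete_set1.
move=> [p' xi'] [/= Bp' ->]; have := BO _ Bp' (set_valP p').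
by rewrite /cpi valKpt.
Qed.

Lemma sbar_bot xi : xi \in sbar X \bot%O -> xi = 0.
Proof.
have c1 : #|sbar X \bot%O| = 1%N.
  rewrite (card_isog (sbar_isog X _)) (proj1 (cell_rankP X)) cardsT card_mx.
  by rewrite muln0 expn0.
by move/eqP: c1; rewrite -trivg_card1 => /eqP ->; rewrite inE => /eqP.
Qed.

Lemma facet_gen s : facet s -> exists2 g, g != 0 &
  forall xi, xi \in sbar X s <-> xi = 0 \/ xi = g.
Proof.
move=> s1.
have c2 : #|sbar X s| = 2%N.
  rewrite (card_isog (sbar_isog X _)) s1 cardsT card_mx card_Fp//.
have /cyclicP[g sg] : cyclic (sbar X s) by apply: prime_cyclic; rewrite c2.
have og : #[g]%g = 2%N by rewrite orderE -sg.
exists g; first by apply/eqP => g0; move: og; rewrite g0 order1.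
move=> xi; rewrite sg cycle2g// !inE; split.
  by case/orP => /eqP ->; [left|right].
by case=> ->; rewrite ?eqxx ?orbT//.
Qed.

Lemma face_inj s t x : face X s x -> face X t x -> s = t.
Proof.
move=> sx tx; apply/eqP; apply: contraPT (conj sx tx) => st.
by have := face_disjoint X st; rewrite -subset0 => /(_ x) h [? ?]; exact: h.
Qed.

Lemma facet_bot s : facet s -> s != \bot%O.
Proof. by move=> s1; apply/eqP => e; have := (cell_rankP X).1; rewrite -e s1. Qed.

Lemma continuous_sqnorm m : continuous (@sqnorm R m).
Proof.
move=> x; have : sqnorm y @[y --> nbhs x] --> sqnorm x; last exact.
by apply: cvg_sqnorm; exact: cvg_id.
Qed.

(** Faces lie in the closed ball, and distinct faces are disjoint, so a facet cannot meet the open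
    ball. *)
Lemma face_sphere s : facet s -> face X s `<=` unit_sphere R n.
Proof.
move=> s1 x sx; have := face_sub sx; rewrite big_cell => xc.
have x1 : sqnorm x <= 1.
  have cl : closed [set x : V | sqnorm x <= 1].
    apply: (@closed_comp _ _ (@sqnorm R n) [set t | t <= 1]).
      by move=> z _; exact: continuous_sqnorm.
    exact: closed_le.
  move/closure_id : cl => cl.
  suff : [set x : V | sqnorm x <= 1] x by [].
  rewrite cl.
  by apply: closureS xc => z; rewrite /unit_ball /=; exact: ltW.
apply/eqP; rewrite eq_le x1 leNgt; apply/negP => xb.
have /face_inj/(_ sx) : face X \bot%O x by rewrite big_cell.
by move=> e; have := facet_bot s1; rewrite -e eqxx.
Qed.

Lemma carrierP x : A x -> sqnorm x < 1 \/ exists s, facet s /\ face X s x.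
Proof. by case; [rewrite big_cell; left|move=> [s s1 sx]; right; exists s]. Qed.

Lemma carrier_le1 x : A x -> sqnorm x <= 1.
Proof.
move=> /carrierP[/ltW//|[s [s1 sx]]].
by rewrite (face_sphere s1 sx).
Qed.

Lemma carrier_scale x (c : R) : A x -> 0 <= c < 1 -> unit_ball R n (c *: x).
Proof.
move=> /carrier_le1 x1 /andP[c0 c1]; rewrite /unit_ball /= sqnormZ.
have : c ^+ 2 < 1 by rewrite expr_lt1.
by have := sqnorm_ge0 x; have := sqr_ge0 c; nra.
Qed.

Lemma cpi_ball x y xi eta : sqnorm x < 1 -> A y ->
  cpi x xi = cpi y eta -> y = x /\ eta = xi.
Proof.
move=> x1 Ay /(cpiP _ _ (unit_ball_carrier x1) Ay)[xy h]; rewrite -xy; split => //.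
apply/eqP; rewrite -subr_eq0; apply/eqP/sbar_bot/h.
by rewrite big_cell; exact: x1.
Qed.

Lemma cpi_facet s g x y xi eta : facet s ->
  (forall xi, xi \in sbar X s <-> xi = 0 \/ xi = g) -> face X s x -> A y ->
  cpi x xi = cpi y eta <-> y = x /\ (eta = xi \/ eta = xi + g).
Proof.
move=> s1 gP sx Ay; rewrite cpiP//; last exact: facet_carrier sx.
split=> [[<- /(_ s sx)/gP h]|[-> h]]; split => //.
  case: h => /eqP; rewrite subr_eq; first by rewrite add0r; left; apply/eqP.
  by rewrite addrC; right; apply/eqP.
move=> t tx; rewrite (face_inj tx sx); apply/gP.
by case: h => ->; [left; rewrite subrr|right; rewrite addrAC subrr add0r].
Qed.

Lemma cpi_within xi : {within A, continuous (cpi^~ xi)}.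
Proof.
apply/within_cvgP => x Ax W Wx.
have [B [oB Bx] BW] : exists2 B : set Y, open_nbhs (cpi x xi) B & B `<=` W.
  by move: Wx; rewrite nbhsE.
suff : nbhs x [set y | A y -> W (cpi y xi)] by [].
apply: filterS ((open_cpiP B).1 oB _ _ Ax Bx) => y By Ay.
by apply: BW; exact: By.
Qed.

Lemma sbar_facet_group s xi : facet s -> xi \in sbar X s -> xi \in facet_group X.
Proof.
by move=> s1 sxi; apply: mem_gen; apply/bigcupP; exists s => //; exact/eqP.
Qed.

Lemma facet_groupD xi eta : xi \in facet_group X -> eta \in facet_group X ->
  xi + eta \in facet_group X.
Proof. exact: groupM. Qed.

Lemma facet_groupN xi : xi \in facet_group X -> - xi \in facet_group X.
Proof. by rewrite -[- xi]/((xi^-1)%g) groupV. Qed.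

Lemma facet_group0 : (0 : signs n) \in facet_group X.
Proof. exact: group1. Qed.

Lemma cpi_facet_group x y xi eta : A x -> A y -> cpi x xi = cpi y eta ->
  eta - xi \in facet_group X.
Proof.
move=> Ax Ay e; case: (carrierP Ax) => [x1|[s [s1 sx]]].
  by have [_ ->] := cpi_ball x1 Ay e; rewrite subrr facet_group0.
apply: (sbar_facet_group s1).
by have [_] := (cpiP _ _ Ax Ay).1 e; exact.
Qed.

Lemma carrier_segment x (c : R) : A x -> 0 <= c <= 1 -> A (c *: x).
Proof.
move=> Ax /andP[c0]; rewrite le_eqVlt => /predU1P[->|c1]; first by rewrite scale1r.
by apply: unit_ball_carrier; apply: carrier_scale; rewrite ?c0.
Qed.

Lemma component_ray x xi : A x ->
  connected_component [set: Y] (cpi x xi) (cpi 0 xi).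
Proof.
move=> Ax; pose I := (`[0%R, 1%R]%classic : set R).
have cI : {within I, continuous ((cpi^~ xi) \o (fun c : R => c *: x))}.
  apply: (@within_comp _ _ _ I A (fun c : R => c *: x)); last first.
  - by move=> c; rewrite /I /= in_itv/= => ?; exact: carrier_segment.
  - exact: cpi_within.
  apply/within_cvgP => c _; apply: cvgZ; last exact: cvg_cst.
  exact: cvg_within_id.
have conn := connected_continuous_connected (@segment_connected R 0 1) cI.
exists (((cpi^~ xi) \o (fun c : R => c *: x)) @` I); last first.
  by exists 0; rewrite /I /= ?in_itv/= ?lexx ?ler01// scale0r.
split => //; exists 1; rewrite /I /= ?in_itv/= ?lexx ?ler01//.
by rewrite scale1r.
Qed.

Definition coset_part xi : set Y :=
  [set y | exists x eta, [/\ A x, eta - xi \in facet_group X & y = cpi x eta]].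

Lemma coset_partP x eta xi : A x ->
  coset_part xi (cpi x eta) <-> eta - xi \in facet_group X.
Proof.
move=> Ax; split => [[x' [eta' [Ax' h e]]]|h]; last by exists x, eta.
have := facet_groupD (facet_groupN (cpi_facet_group Ax Ax' e)) h.
by rewrite opprB addrA subrK.
Qed.

(** The translations that keep every chamber centre in its component form a subgroup, so a generator
    suffices. A point of its facet lies on both chambers, and rays join it to both centres. *)
Lemma component0_facet_group gamma xi : gamma \in facet_group X ->
  connected_component [set: Y] (cpi 0 xi) (cpi 0 (xi + gamma)).
Proof.
pose S := [set gamma | `[< forall xi,
  connected_component [set: Y] (cpi 0 xi) (cpi 0 (xi + gamma)) >]]%SET.
have S_group : group_set S.
  apply/group_setP; split => [|a b].
    rewrite inE; apply/asboolP => eta.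
    rewrite [1%g]/(0 : signs n) addr0; exact: connected_component_refl.
  rewrite !inE => /asboolP ha /asboolP hb; apply/asboolP => eta.
  rewrite [(a * b)%g]/(a + b) addrA.
  exact: connected_component_trans (ha _) (hb _).
suff /fintype.subsetP/[apply] : facet_group X \subset Group S_group.
  by rewrite inE => /asboolP.
rewrite gen_subG; apply/fintype.subsetP => eta /bigcupP[s /eqP s1 seta].
rewrite inE; apply/asboolP => zeta.
have [x sx] : exists x, face X s x.
  have [f [g [_ _ _ gF _]]] := face_cell X s.
  exists (g 0); apply: gF.
  by rewrite /unit_ball /= sqnorm0 ltr01.
have Ax := facet_carrier s1 sx.
apply: connected_component_trans (connected_component_sym (component_ray _ Ax)) _.
have -> : cpi x zeta = cpi x (zeta + eta).
  apply/cpiP => //; split => // t tx; rewrite (face_inj tx sx).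
  by rewrite addrAC subrr add0r.
exact: component_ray.
Qed.

Lemma coset_part_open xi : open (coset_part xi).
Proof.
apply/open_cpiP => x eta Ax /(coset_partP _ _ Ax) h.
have : nbhs x [set: V] by exact: filterT.
by apply: filterS => y _ Ay; apply/coset_partP.
Qed.

Lemma coset_part_closed xi : closed (coset_part xi).
Proof.
rewrite -openC; apply/open_cpiP => x eta Ax h.
have : nbhs x [set: V] by exact: filterT.
apply: filterS => y _ Ay /(coset_partP _ _ Ay) h'; apply: h.
exact/coset_partP.
Qed.

(** The coset part is open and closed, which bounds the component from above; rays and facet
    crossings connect it. *)
Lemma component_cpi x xi : A x ->
  connected_component [set: Y] (cpi x xi) = coset_part xi.
Proof.
move=> Ax; apply/seteqP; split.
  set C := connected_component _ _.
  have Cx : C (cpi x xi) by exact: connected_component_refl.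
  have : C `&` coset_part xi = C.
    apply: (component_connected (A := [set: Y])).
    - exists (cpi x xi); split => //; apply/coset_partP => //.
      by rewrite subrr facet_group0.
    - by exists (coset_part xi) => //; exact: coset_part_open.
    - by exists (coset_part xi) => //; exact: coset_part_closed.
  by move=> <- y [].
move=> _ [y [eta [Ay h ->]]].
apply: connected_component_trans (component_ray _ Ax) _.
apply: connected_component_trans (connected_component_sym (component_ray _ Ay)).
by rewrite -(subrK xi eta) addrC; exact: component0_facet_group.
Qed.

Lemma signs_norm xi : xi \in 'N(facet_group X)%g.
Proof.
have zab := FinRing.zmod_abelian [set: signs n]%SET.
apply: (fintype.subsetP (sub_abelian_norm zab (finset.subsetT _))).
exact: finset.in_setT.
Qed.

Lemma coset_eqP xi eta :
  coset (facet_group X) xi = coset (facet_group X) eta <->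
  xi - eta \in facet_group X.
Proof.
have -> : xi - eta = (xi * eta^-1)%g by [].
rewrite -mem_rcoset; split => [e|h].
  by apply/rcoset_kercosetP => //; exact: signs_norm.
by apply/rcoset_kercosetP => //; exact: signs_norm.
Qed.

Theorem components_coset : exists f : coset_of (facet_group X) -> set Y,
  set_bij [set: coset_of (facet_group X)] (components Y) f /\
  forall xi, chamber X xi `<=` f (coset (facet_group X) xi).
Proof.
pose f (c : coset_of (facet_group X)) := coset_part (fingroup.repr c).
have A0 : A 0 := unit_ball_carrier origin_in_ball.
have fE xi : f (coset (facet_group X) xi) = coset_part xi.
  rewrite /f -(component_cpi xi A0) -(component_cpi (fingroup.repr _) A0).
  apply: same_connected_component; rewrite component_cpi//.
  by apply/coset_partP => //; apply/coset_eqP; rewrite coset_reprK.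
exists f; split; last first.
  move=> xi y [p p0 <-]; rewrite fE.
  rewrite (_ : cover_pi X (p, xi) = cpi (set_val p) xi).
    apply/coset_partP; first exact: set_valP.
    by rewrite subrr facet_group0.
  by rewrite /cpi valKpt.
split.
- move=> c _; exists (cpi 0 (fingroup.repr c)) => //; exact: component_cpi.
- move=> c c' _ _ e; rewrite -(coset_reprK c) -(coset_reprK c'); apply/coset_eqP.
  apply/(coset_partP _ _ A0); rewrite -/(f c') -e; apply/coset_partP => //.
  by rewrite subrr facet_group0.
- move=> _ [y _ <-]; have [x [xi [Ax ->]]] := cpi_surj y.
  by exists (coset (facet_group X) xi) => //; rewrite fE component_cpi.
Qed.

End SmallCover.

(** * The atlas of a parity functional *)

Section OpenEmbeddings.
Variables (R : realType) (n : nat) (T : topologicalType).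
Local Notation V := 'rV[R]_n.
Implicit Types (U W : set V) (f : V -> T).

Definition open_embedding U f :=
  [/\ open U, {within U, continuous f}, {in U &, injective f} &
      forall W, open W -> W `<=` U -> open (f @` W)].

Lemma open_embedding_chart U f : open_embedding U f ->
  exists c : chart R n T,
    [/\ chart_dom c = f @` U, chart_cod c = U & chart_inv c = f].
Proof.
move=> [oU cf finj fo]; pose h (y : T) : V := xget 0 [set x | U x /\ f x = y].
have hP x : U x -> h (f x) = x.
  move=> Ux; rewrite /h; case: xgetP => [z -> [Uz e]|/(_ x)]; last by case.
  by apply: finj; rewrite ?inE.
have odom : open (f @` U) by exact: fo.
have ch : homeo_on (f @` U) U h f.
  split=> //.
  - apply/within_cvgP => _ [x Ux <-] W; rewrite hP// => Wx.
    have [B [oB Bx] BW] : exists2 B : set V, open_nbhs x B & B `<=` W.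
      by move: Wx; rewrite nbhsE.
    suff : nbhs (f x) [set y | (f @` U) y -> W (h y)] by [].
    have : nbhs (f x) (f @` (B `&` U)).
      apply: open_nbhs_nbhs; split; last by exists x.
      by apply: fo; [exact: openI|move=> ? []].
    by apply: filterS => _ [z [Bz Uz] <-] _; rewrite hP//; exact: BW.
  - by move=> _ [x Ux <-]; rewrite hP.
  - split=> [y /set_mem[x Ux <-]|x /set_mem Ux]; by rewrite hP.
by exists (Chart odom oU ch).
Qed.

Lemma open_embedding_refl U f : open_embedding U f ->
  open_embedding (@refl R n @^-1` U) (f \o @refl R n).
Proof.
move=> [oU cf finj fo].
have crefl : continuous (@refl R n).
  move=> x; have : refl y @[y --> nbhs x] --> refl x; last exact.
  by apply: cvg_refl; exact: cvg_id.
have orefl W : open W -> open (@refl R n @^-1` W).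
  by move=> oW; apply: open_comp => // x _; exact: crefl.
split.
- exact: orefl.
- apply: (within_comp (B := U)) => //.
  exact: continuous_subspaceT.
- move=> x y /set_mem Ux /set_mem Uy /= /finj; rewrite !inE => /(_ Ux Uy).
  exact: (can_inj (@reflK R n)).
- move=> W oW WU; rewrite (_ : _ @` _ = f @` (@refl R n @^-1` W)).
    by apply: fo; [exact: orefl|move=> x /= /WU /=; rewrite reflK].
  apply/seteqP; split => [_ [x Wx <-]|_ [x Wx <-]].
    by exists (refl x) => //=; rewrite reflK.
  by exists (refl x) => //=; rewrite reflK.
Qed.

End OpenEmbeddings.

Definition flip (R : realType) n (b : bool) (x : 'rV[R]_n) := if b then refl x else x.

Lemma flipK (R : realType) n b : involutive (@flip R n b).
Proof. by case: b => x //=; exact: reflK. Qed.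

Lemma open_embedding_flip (R : realType) n (T : topologicalType) b
    (U : set 'rV[R]_n) (f : 'rV[R]_n -> T) : open_embedding U f ->
  open_embedding (flip b @^-1` U) (f \o flip b).
Proof. by case: b => //; exact: open_embedding_refl. Qed.

Section OrientationPreserving.
Variables (R : realType).

Lemma orientation_preserving_id n (U : set 'rV[R]_n) (h : 'rV[R]_n -> 'rV[R]_n) :
  open U -> (forall x, U x -> h x = x) -> orientation_preserving U h.
Proof.
move=> oU hid x Ux.
have /nbhs_ballP[e /= e0 eU] : nbhs x U by exact: open_nbhs_nbhs.
have in_U u : closed_unit_ball R n u -> U (x + (e / 2) *: u).
  move=> u1; apply: eU; rewrite -ball_normE /= opprD addrA subrr add0r normrN.
  rewrite normrZ ger0_norm ?divr_ge0 ?ltW//.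
  by have := norm_unit_ball u1; have := normr_ge0 u; nra.
exists (e / 2); split; first by rewrite divr_gt0.
  by move=> _ [u u1 <-]; exact: in_U.
apply: homotopic_ext (homotopic_scale_id n (c := e / 2) (c' := 1) _ _) => //.
- move=> u u1; rewrite !hid ?[x + _]addrC ?addrK//; rewrite addrC; apply: in_U.
  by rewrite /closed_unit_ball /= u1.
- by move=> u _; rewrite scale1r.
- by rewrite divr_gt0.
Qed.

Lemma orientation_preserving_inversion n (U : set 'rV[R]_n) (h : 'rV[R]_n -> 'rV[R]_n) :
  open U -> (forall x, U x -> x != 0 /\ h x = refl (inversion x)) ->
  orientation_preserving U h.
Proof.
case: n U h => [|n] U h oU hU x Ux.
  (* In dimension 0 every vector is 0, so [U] is empty. *)
  by have [/eqP[]] := hU x Ux; apply/rowP; case.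
have /nbhs_ballP[d /= d0 dU] : nbhs x U by exact: open_nbhs_nbhs.
have [x0 _] := hU x Ux.
pose e := Order.min (d / 2) (`|x| / 2).
have e0 : 0 < e by rewrite lt_min !divr_gt0 ?normr_gt0.
have ed : e <= d / 2 by rewrite ge_min lexx.
have ex : e <= `|x| / 2 by rewrite ge_min lexx orbT.
have in_U u : closed_unit_ball R n.+1 u -> U (x + e *: u).
  move=> u1; apply: dU; rewrite -ball_normE /= opprD addrA subrr add0r normrN.
  rewrite normrZ ger0_norm ?ltW//.
  by have := norm_unit_ball u1; have := normr_ge0 u; nra.
exists e; split => //; first by move=> _ [u u1 <-]; exact: in_U.
have crefl : {within ~` [set 0], continuous (@refl R n.+1)}.
  apply: continuous_subspaceT => y.
  have : refl z @[z --> nbhs y] --> refl y; last exact.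
  by apply: cvg_refl; exact: cvg_id.
have nx0 : 0 < `|x| by rewrite normr_gt0.
have ee : 0 < e < `|x| by rewrite e0/=; lra.
have reflV : set_fun (~` [set 0]) (~` [set (0 : 'rV[R]_n.+1)]) (@refl R n.+1).
  by move=> y /eqP y0; apply/eqP; rewrite refl_eq0.
have := homotopic_post crefl reflV (inversion_germ ee).
apply: homotopic_ext => u u1 /=; last by rewrite reflK.
rewrite /germ reflD reflN (proj2 (hU _ Ux)) (proj2 (hU _ (in_U u _)))//.
by rewrite /closed_unit_ball /= u1.
Qed.

End OrientationPreserving.

Lemma open_facet_dom (R : realType) n (F : set 'rV[R]_n) k : (0 < n)%N -> k = 1%N ->
  F `<=` unit_sphere R n -> homeomorphic F (unit_ball R (n - k)) ->
  open [set x : 'rV[R]_n | sqnorm x != 1 \/ F x].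
Proof.
by case: n F => [//|n] F _ -> FS; rewrite subSS subn0; exact: open_sphere_cell.
Qed.

(** * Charts unfolding two adjacent chambers *)

Section Parametrizations.
Variables (R : realType) (n : nat) (d : Order.disp_t) (P : finBPOrderType d).
Variable X : small_cover R n P.
Local Notation V := 'rV[R]_n.
Local Notation A := (carrier_circ X).
Local Notation Y := (small_cover_circ X).
Local Notation facet s := (cell_rank X s = 1%N).
Implicit Types (x y z : V) (xi eta g h : signs n) (s t : P) (U W : set V).

(* Two adjacent chambers are unfolded across a facet with generator g: the
   chamber of xi occupies the ball, and that of xi + g its exterior. *)
Definition param g xi x : Y :=
  if sqnorm x <= 1 then cpi X x xi else cpi X (inversion x) (xi + g).

Definition facet_dom s g U := [/\ facet s, g != 0,
  forall xi, xi \in sbar X s <-> xi = 0 \/ xi = g &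
  U = [set x | sqnorm x != 1 \/ face X s x]].

(** On the ball [param] stays in its first branch; the ball with [g = 0] gives the chart of a single
    chamber. *)
Definition param_dom g U := U = unit_ball R n \/ exists s, facet_dom s g U.

Lemma param_dom_open g U : param_dom g U -> open U.
Proof.
case=> [->|[s [s1 _ _ ->]]].
  apply: (@open_comp _ _ (@sqnorm R n) [set t | t < 1]).
    by move=> z _; exact: continuous_sqnorm.
  exact: open_lt.
apply: (open_facet_dom _ s1 (face_sphere s1) (face_cell X s)).
by rewrite -s1 cell_rank_le.
Qed.

Lemma param_dom_carrier g U x : param_dom g U -> U x -> sqnorm x <= 1 -> A x.
Proof.
case=> [->|[s [s1 _ _ ->]]]; first by move=> x1 _; exact: unit_ball_carrier.
move=> [xn1|sx] x1; last exact: facet_carrier sx.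
by apply: unit_ball_carrier; rewrite /unit_ball /= lt_neqAle xn1.
Qed.

Lemma inversion_ball x : 1 < sqnorm x -> unit_ball R n (inversion x).
Proof.
by move=> x1; rewrite /unit_ball /= sqnorm_inversion invf_lt1// (lt_trans ltr01).
Qed.

(** Injectivity, openness and the transition maps are all read off from this description of
    preimages. On the sphere the two branches of [param] agree, because inversion fixes [p] and the
    sheets [xi] and [xi + g] are glued there. *)
Lemma param_meets g U W xi p eta : param_dom g U -> W `<=` U -> A p ->
  (exists2 x, W x & param g xi x = cpi X p eta) <->
  (eta = xi /\ W p) \/ [/\ eta = xi + g, p != 0 & W (inversion p)].
Proof.
move=> gU WU Ap; split.
  move=> [x Wx]; rewrite /param; case: ifPn => [x1 e|]; last first.
    rewrite -ltNge => x1 e.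
    have [-> ->] := cpi_ball (inversion_ball x1) Ap e.
    right; rewrite inversion_eq0 inversionK; split=> //.
    by rewrite -sqnorm_gt0 (lt_trans ltr01).
  have Ax := param_dom_carrier gU (WU _ Wx) x1.
  move: x1; rewrite le_eqVlt => /predU1P[x1|x1]; last first.
    by have [-> ->] := cpi_ball x1 Ap e; left.
  have := WU _ Wx; case: gU => [->|[s [s1 _ gP ->]] [|sx]].
  - by rewrite /unit_ball /= x1 ltxx.
  - by rewrite x1 eqxx.
  have [-> [->|->]] := (cpi_facet _ _ s1 gP sx Ap).1 e; first by left.
  by right; rewrite inversion_sphere// -sqnorm_eq0 x1 oner_eq0.
move=> [[-> Wp]|[-> p0 Wp]].
  by exists p => //; rewrite /param (carrier_le1 Ap).
exists (inversion p) => //; rewrite /param inversionK; case: ifPn => // p1.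
have {}p1 : sqnorm p = 1.
  apply/eqP; rewrite eq_le (carrier_le1 Ap)/=.
  by move: p1; rewrite sqnorm_inversion invf_le1// sqnorm_gt0.
rewrite (inversion_sphere p1) in Wp *.
have := WU _ Wp; case: gU => [->|[s [s1 _ gP ->]] [|sp]].
- by rewrite /unit_ball /= p1 ltxx.
- by rewrite p1 eqxx.
by apply/(cpi_facet _ _ s1 gP sp Ap); split => //; right.
Qed.

Lemma param_inj g U x y xi : param_dom g U -> U x -> U y ->
  param g xi x = param g xi y -> x = y.
Proof.
move=> gU Ux Uy e.
(* Applied to a singleton, [param_meets] becomes a statement about the single parameter [y]. *)
have yU : [set y] `<=` U by move=> z ->.
have [x1|x1] := leP (sqnorm x) 1.
  have Ax := param_dom_carrier gU Ux x1.
  have /(param_meets xi xi gU yU Ax) : exists2 z, [set y] z & param g xi z = cpi X x xi.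
    by exists y => //; rewrite -e /param x1.
  case=> [[_ //]|[/esym/eqP]].
  rewrite -[X in _ == X]addr0 (inj_eq (addrI _)) => /eqP g0 x0 /= xy.
  case: gU => [UE|[s [_ /eqP//]]].
  move: Uy; rewrite -xy UE /unit_ball /= sqnorm_inversion invf_lt1 ?sqnorm_gt0//.
  by rewrite ltNge x1.
have Ax := unit_ball_carrier X (inversion_ball x1).
have : exists2 z, [set y] z & param g xi z = cpi X (inversion x) (xi + g).
  by exists y => //; rewrite -e /param leNgt x1.
move=> /(param_meets xi (xi + g) gU yU Ax); rewrite inversionK.
case=> [[/eqP]|[_ _ //]].
rewrite -[X in _ == X]addr0 (inj_eq (addrI _)) => /eqP g0 /= xy.
case: gU => [UE|[s [_ /eqP//]]].
by move: Ux; rewrite UE /unit_ball /= ltNge ltW.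
Qed.

Lemma param_continuous g U xi : param_dom g U -> {within U, continuous (param g xi)}.
Proof.
move=> gU; apply/within_cvgP => x Ux W Wx.
have [B [oB Bx] BW] : exists2 B : set Y, open_nbhs (param g xi x) B & B `<=` W.
  by move: Wx; rewrite nbhsE.
suff : nbhs x [set y | U y -> B (param g xi y)].
  by apply: filterS => y By Uy; apply/BW/By.
have near_sq (D : set R) : open D -> D (sqnorm x) -> nbhs x (@sqnorm R n @^-1` D).
  move=> oD Dx; apply: continuous_sqnorm; exact: open_nbhs_nbhs.
have in_ball (p : V) eta : A p -> B (cpi X p eta) ->
    nbhs p [set y | A y -> B (cpi X y eta)].
  by move=> Ap Bp; exact: ((open_cpiP B).1 oB).
have near_inv (Q : set V) : x != 0 -> nbhs (inversion x) Q ->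
    nbhs x (@inversion R n @^-1` Q).
  by move=> x0; exact: cvg_inversion.
have outside : 1 <= sqnorm x -> A (inversion x) ->
    B (cpi X (inversion x) (xi + g)) ->
    nbhs x [set y | 1 < sqnorm y -> B (cpi X (inversion y) (xi + g))].
  move=> x1 Ax Bx'; have x0 : x != 0 by rewrite -sqnorm_gt0 (lt_le_trans ltr01).
  apply: filterS (near_inv _ x0 (in_ball _ _ Ax Bx')) => y /= By y1.
  exact/By/unit_ball_carrier/inversion_ball.
have inside' : A x -> B (cpi X x xi) ->
    nbhs x [set y | U y -> sqnorm y <= 1 -> B (cpi X y xi)].
  move=> Ax Bx'; apply: filterS (in_ball _ _ Ax Bx') => y /= By Uy y1.
  by apply: By; exact: param_dom_carrier gU Uy y1.
move: Bx; rewrite /param; case: (ltgtP (sqnorm x) 1) => [x1|x1|x1] Bx.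
- have Ax : A x by exact: unit_ball_carrier.
  have ox := near_sq _ (@open_lt _ 1) x1.
  apply: filterS (filterI (inside' Ax Bx) ox) => y [/= By y1] Uy.
  by rewrite ltW//; apply: By => //; exact: ltW.
- have Ax := unit_ball_carrier X (inversion_ball x1).
  have ox := near_sq _ (@open_gt _ 1) x1.
  apply: filterS (filterI (outside (ltW x1) Ax Bx) ox) => y [/= By y1] Uy.
  by rewrite leNgt y1 /=; exact: By.
(* At a point of the sphere both branches have the same value, and a neighbourhood is the
   intersection of one for each branch. *)
- have Ax : A x by apply: (param_dom_carrier gU Ux); rewrite x1.
  have Bx' : B (cpi X (inversion x) (xi + g)).
    rewrite inversion_sphere//.
    suff -> : cpi X x (xi + g) = cpi X x xi by [].
    symmetry; have := Ux; case: (gU) => [->|[s [s1 _ gP ->]] [|sx]].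
    + by rewrite /unit_ball /= x1 ltxx.
    + by rewrite x1 eqxx.
    by apply/(cpi_facet _ _ s1 gP sx Ax); split => //; right.
  have Ax' : A (inversion x) by rewrite inversion_sphere.
  have x1' : 1 <= sqnorm x by rewrite x1.
  apply: filterS (filterI (inside' Ax Bx) (outside x1' Ax' Bx')) => y [/= B1 B2] Uy.
  by case: ifPn => [y1|]; [exact: B1|rewrite -ltNge; exact: B2].
Qed.

Lemma param_open g U W xi : param_dom g U -> open W -> W `<=` U ->
  open (param g xi @` W).
Proof.
move=> gU oW WU; apply/open_cpiP => p eta Ap Wp.
have sub y : A y -> (eta = xi /\ W y) \/ [/\ eta = xi + g, y != 0 & W (inversion y)] ->
    (param g xi @` W) (cpi X y eta).
  by move=> Ay /(param_meets xi eta gU WU Ay)[x Wx e]; exists x.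
have : exists2 x, W x & param g xi x = cpi X p eta by case: Wp => x; exists x.
move=> /(param_meets xi eta gU WU Ap)[[e Wp']|[e p0 Wp']].
  have : nbhs p W by exact: open_nbhs_nbhs.
  by apply: filterS => y Wy Ay; apply: sub => //; left.
have : nbhs p (@inversion R n @^-1` W).
  by apply: cvg_inversion => //; exact: open_nbhs_nbhs.
have : nbhs p [set y | y != 0].
  apply: open_nbhs_nbhs; split => //; rewrite (_ : mkset _ = ~` [set 0]).
    exact/closed_openC/accessible_closed_set1/hausdorff_accessible/norm_hausdorff.
  by apply/seteqP; split => y /= /eqP.
apply: filterS2 => y y0 Wy Ay; apply: sub => //.
by right.
Qed.

Lemma param_embedding g U xi : param_dom g U -> open_embedding U (param g xi).
Proof.
move=> gU; split.
- exact: param_dom_open gU.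
- exact: param_continuous.
- by move=> x y /set_mem Ux /set_mem Uy; exact: param_inj gU Ux Uy.
- by move=> W; exact: param_open.
Qed.

(** Each change of branch, in either chart, adds a generator with [phi = 1] and inverts the
    parameter. Hence the parity of the difference of the sheets records whether [z'] is [z] or its
    inverse. *)
Lemma param_transition (phi : signs n -> 'F_2) g h U U' xi eta z z' :
  (forall a b, phi (a + b) = phi a + phi b) ->
  (forall s g, facet s -> g \in sbar X s -> g != 0 -> phi g = 1) ->
  param_dom g U -> param_dom h U' -> U z -> U' z' ->
  param g xi z = param h eta z' ->
  (z' = z /\ phi xi = phi eta) \/
  [/\ z != 0, z' = inversion z & phi xi = phi eta + 1].
Proof.
move=> phiD phi1 gU hU' Uz Uz' e.
have phi_dom k W y : param_dom k W -> W y -> 1 <= sqnorm y -> phi k = 1.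
  case=> [->|[s [s1 k0 kP _]]]; first by rewrite /unit_ball /= ltNge => /negP.
  by move=> _ _; apply: (phi1 s) => //; apply/kP; right.
have z'U : [set z'] `<=` U' by move=> y ->.
have [z1|z1] := leP (sqnorm z) 1.
  have Az := param_dom_carrier gU Uz z1.
  have : exists2 y, [set z'] y & param h eta y = cpi X z xi.
    by exists z' => //; rewrite -e /param z1.
  move=> /(param_meets eta xi hU' z'U Az)[[-> /= ->]|[-> z0 /= zz']]; first by left.
  right; split => //; rewrite phiD (phi_dom _ _ _ hU' Uz')//.
  by rewrite -zz' sqnorm_inversion invf_ge1// sqnorm_gt0.
have Az := unit_ball_carrier X (inversion_ball z1).
have : exists2 y, [set z'] y & param h eta y = cpi X (inversion z) (xi + g).
  by exists z' => //; rewrite -e /param leNgt z1.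
have g1 := phi_dom _ _ _ gU Uz (ltW z1).
have phiE : phi (xi + g) + 1 = phi xi.
  by rewrite phiD g1 -addrA (addrr_pchar2 (pchar_Fp _))// addr0.
move=> /(param_meets eta (xi + g) hU' z'U Az); rewrite inversionK.
move=> [[e1 /= e2]|[e1 z0 /= e2]]; [right|left]; split => //.
- by rewrite -sqnorm_gt0 (lt_trans ltr01).
- by rewrite -phiE e1.
- rewrite -phiE e1 phiD (phi_dom _ _ _ hU' Uz').
    by rewrite -addrA (addrr_pchar2 (pchar_Fp _))// addr0.
  by rewrite -e2 ltW.
Qed.

Lemma orientable_of_parity (phi : signs n -> 'F_2) :
  (forall a b, phi (a + b) = phi a + phi b) ->
  (forall s g, facet s -> g \in sbar X s -> g != 0 -> phi g = 1) ->
  orientable R n Y.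
Proof.
move=> phiD phi1 C Ccomp.
pose fl xi := @flip R n (phi xi == 1).
pose good (c : chart R n Y) := exists g xi U, [/\ param_dom g U,
  chart_dom c = (param g xi \o fl xi) @` (fl xi @^-1` U),
  chart_cod c = fl xi @^-1` U & chart_inv c = param g xi \o fl xi].
exists [set c | good c /\ chart_dom c `<=` C]; split.
- by move=> c [].
- move=> y Cy.
  have compC z eta : A z -> C (cpi X z eta) -> C = @coset_part R n d P X eta.
    move=> Az Cz; case: Ccomp Cz => w _ <- /same_connected_component ->.
    exact: component_cpi.
  have good_chart g U xi (x : V) : param_dom g U -> U x -> y = param g xi x ->
      (forall z, U z -> C (param g xi z)) ->
      (\bigcup_(c in [set c | good c /\ chart_dom c `<=` C]) chart_dom c) y.
    move=> gU Ux yE UC.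
    have [c [c1 c2 c3]] := open_embedding_chart
      (open_embedding_flip (phi xi == 1) (param_embedding xi gU)).
    exists c.
      split; first by exists g, xi, U.
      by rewrite c1 => _ [z Uz <-] /=; exact: UC.
    by rewrite c1 yE; exists (fl xi x); rewrite /= /fl flipK.
  have [x [xi [Ax yE]]] := cpi_surj y.
  have CE : C = @coset_part R n d P X xi by apply: (compC x) => //; rewrite -yE.
  case: (carrierP Ax) => [x1|[s [s1 sx]]].
    apply: (good_chart 0 (unit_ball R n) xi x) => //.
    + by left.
    + by rewrite /param ltW.
    + move=> z z1; rewrite /param ltW// CE; apply/coset_partP.
        exact: unit_ball_carrier.
      by rewrite subrr facet_group0.
  have [g g0 gP] := facet_gen s1.
  have gU : param_dom g [set x | sqnorm x != 1 \/ face X s x].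
    by right; exists s.
  apply: (good_chart g _ xi x gU) => //; first by right.
    by rewrite /param (carrier_le1 Ax).
  move=> z Uz; rewrite CE /param; case: ifPn => z1.
    apply/coset_partP; first exact: param_dom_carrier gU Uz z1.
    by rewrite subrr facet_group0.
  rewrite -ltNge in z1; apply/coset_partP.
    exact/unit_ball_carrier/inversion_ball.
  by rewrite addrAC subrr add0r; apply: (sbar_facet_group s1); apply/gP; right.
move=> c c' [[g [xi [U [gU c1 c2 c3]]]] _] [[h [eta [U' [hU c1' c2' c3']]]] _].
set D := _ `&` _; set k := _ \o _.
have oD : open D.
  have oc := @open_chart_cod _ _ _ c; apply: (continuous_inP _ oc).1; last first.
    exact: open_chart_dom.
  by rewrite -continuous_open_subspace//; have [] := chart_homeo c.
have [_ [_ _ c'dom _ [c'K _]]] := (chart_homeo c, chart_homeo c').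
have kP x : D x -> (k x = x /\ phi xi = phi eta) \/
    [/\ x != 0, k x = refl (inversion x) & phi xi = phi eta + 1].
  move=> [cx dx]; have Ux : U (fl xi x) by move: cx; rewrite c2.
  have kc : chart_cod c' (k x) by exact: c'dom.
  have Ukx : U' (fl eta (k x)) by move: kc; rewrite c2'.
  have : param g xi (fl xi x) = param h eta (fl eta (k x)).
    have := c'K (chart_inv c x) (mem_set dx).
    by rewrite c3' c3 /k /= c3 => ->.
  move=> /(param_transition phiD phi1 gU hU Ux Ukx)[[e pe]|[x0 e pe]].
    left; split => //; move: e; rewrite /fl pe => /(congr1 (flip (phi eta == 1))).
    by rewrite !flipK.
  right; split => //.
    by move: x0; rewrite /fl /flip; case: ifP => // _; rewrite refl_eq0.
  have := congr1 (flip (phi eta == 1)) e; rewrite /fl flipK => ->; rewrite pe.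
  have [pe0|/F2_eq1 pe1] := eqVneq (phi eta) 0.
    by rewrite pe0 add0r eqxx /= inversion_refl.
  by rewrite pe1 (addrr_pchar2 (pchar_Fp _)).
have [pe|pe] := eqVneq (phi xi) (phi eta).
  apply: orientation_preserving_id => // x /kP[[] //|[_ _]].
  rewrite pe => /eqP; rewrite eq_sym -subr_eq0 addrAC subrr add0r.
  by rewrite oner_eq0.
apply: orientation_preserving_inversion => // x /kP[[_ e]|[] //].
by rewrite e eqxx in pe.
Qed.

End Parametrizations.

(** * Local orientations of an arbitrary oriented atlas *)

Section SphereHomotopies.
Variables (R : realType) (n : nat).
Local Notation V := 'rV[R]_n.
Local Notation I := (`[0%R, 1%R]%classic : set R).
Local Notation V0 := (~` [set (0 : V)]).
Local Notation S := (unit_sphere R n).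
Implicit Types (f g w nu : V -> V).

Lemma homotopic_pre (B : set V) f g nu : {within S, continuous nu} ->
  set_fun S S nu -> homotopic R S B f g -> homotopic R S B (f \o nu) (g \o nu).
Proof.
move=> cnu nuS [H [cH HB H0 H1]].
have m : set_fun (I `*` S) (I `*` S) (fun p : R * V => (p.1, nu p.2)).
  by move=> [t x] [/= It Sx]; split => //; exact: nuS.
exists (fun p => H (p.1, nu p.2)); split.
- apply: (@within_comp _ _ _ _ (I `*` S) (fun p : R * V => (p.1, nu p.2)) H) => //.
  apply: within_pair => p Ip; first exact: cvg_within_fst.
  by have /within_cvgP := @within_comp_snd R _ _ I _ _ cnu; exact.
- by move=> p /m/HB.
- by move=> x /nuS; exact: H0.
- by move=> x /nuS; exact: H1.
Qed.

Lemma homotopic_pre_refl (B : set V) f g :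
  homotopic R S B f g -> homotopic R S B (f \o @refl R n) (g \o @refl R n).
Proof.
apply: homotopic_pre; last by move=> x; rewrite /unit_sphere /= sqnorm_refl.
apply: continuous_subspaceT => y.
have : refl z @[z --> nbhs y] --> refl y; last exact.
by apply: cvg_refl; exact: cvg_id.
Qed.

Definition normalize (v : V) : V := (enorm v)^-1 *: v.

Lemma within_normalize w : {within S, continuous w} -> set_fun S V0 w ->
  {within S, continuous (normalize \o w)}.
Proof.
move=> /within_cvgP cw w0; apply/within_cvgP => u Su.
apply: cvgZ; last exact: cw.
apply: cvgV; last by apply: cvg_enorm; exact: cw.
by rewrite gt_eqF// enorm_gt0; apply/eqP/w0.
Qed.

Lemma homotopic_normalize w c : 0 < c -> {within S, continuous w} -> set_fun S V0 w ->
  homotopic R S V0 w (fun u => c *: normalize (w u)).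
Proof.
move=> c0 cw w0.
exists (fun p => ((1 - p.1) + p.1 * (c / enorm (w p.2))) *: w p.2).
have e0 u : S u -> 0 < enorm (w u) by move=> Su; rewrite enorm_gt0; exact/eqP/w0.
split.
- apply/within_cvgP => p Ap; have [_ Sp] := Ap.
  have cw2 : w q.2 @[q --> within (I `*` S) (nbhs p)] --> w p.2.
    by have /within_cvgP := @within_comp_snd R _ _ I _ _ cw; exact.
  apply: cvgZ => //; apply: cvgD.
    by apply: cvgB; [exact: cvg_cst|exact: cvg_within_fst].
  apply: cvgM; first exact: cvg_within_fst.
  apply: cvgM; first exact: cvg_cst.
  by apply: cvgV; [rewrite gt_eqF// e0|exact: cvg_enorm].
- move=> [t u] [/=]; rewrite in_itv/= => /andP[t0 t1] Su.
  apply/eqP; rewrite scaler_eq0 negb_or; apply/andP; split; last exact/eqP/w0.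
  have q0 : 0 < c / enorm (w u) by rewrite divr_gt0// e0.
  apply: lt0r_neq0; have [t2|t2] := ltP t 1.
    by rewrite ltr_pwDl ?subr_gt0// mulr_ge0// ltW.
  have -> : t = 1 by apply/le_anti; rewrite t1.
  by rewrite subrr add0r mul1r.
- by move=> u _; rewrite subr0 mul0r addr0 scale1r.
- by move=> u _; rewrite subrr mul1r add0r /normalize scalerA.
Qed.

(** Stated for any [D] containing the intermediate spheres: the radius in [orientation_preserving]
    comes with a Euclidean ball, while [embedding_near] uses balls of the sup norm. *)
Lemma germ_scale_on (k : V -> V) (D : set V) y (e e' : R) :
  {within D, continuous k} -> {in D &, injective k} -> D y -> 0 < e -> 0 < e' ->
  (forall c u, 0 < c <= Order.max e e' -> S u -> D (y + c *: u)) ->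
  homotopic R S V0 (fun u => germ k y (e *: u)) (fun u => germ k y (e' *: u)).
Proof.
move=> ck kinj Dy e0 e0' DS.
pose B := [set v | v != 0 /\ D (y + v)].
have cB : {within B, continuous (germ k y)}.
  have cg : {within B, continuous (k \o +%R y)}.
    apply: (within_comp (B := D)) => //; last by move=> v [].
    apply: continuous_subspaceT => u.
    have : y + v @[v --> nbhs u] --> y + u; last exact.
    by apply: cvgD; [exact: cvg_cst|exact: cvg_id].
  apply/within_cvgP => p Ap; apply: cvgB; last exact: cvg_cst.
  by move/within_cvgP : cg; exact.
have mB : set_fun B V0 (germ k y).
  move=> v [v0 Dv]; apply/eqP; apply: contra_neq v0 => /subr0_eq h.
  have := kinj _ _ (mem_set Dv) (mem_set Dy) h.
  by rewrite -[RHS]addr0 => /addrI.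
apply: (@homotopic_post R n _ S B V0 (germ k y) (fun u => e *: u)
  (fun u => e' *: u) cB mB).
have bnd t : 0 <= t <= 1 -> 0 < (1 - t) * e + t * e' <= Order.max e e'.
  move=> /andP[t0 t1]; have m1 : e <= Order.max e e' by rewrite le_max lexx.
  have m2 : e' <= Order.max e e' by rewrite le_max lexx orbT.
  by apply/andP; split; nra.
exists (fun p => ((1 - p.1) * e + p.1 * e') *: p.2); split.
- apply/within_cvgP => p Ap; apply: cvgZ; last exact: cvg_within_snd.
  apply: cvgD; apply: cvgM; (try exact: cvg_cst); last exact: cvg_within_fst.
  by apply: cvgB; [exact: cvg_cst|exact: cvg_within_fst].
- move=> [t u] [/=]; rewrite in_itv/= => /bnd tt Su; split; last exact: DS.
  by rewrite scaler_eq0 negb_or sphere_neq0// andbT gt_eqF//; case/andP: tt.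
- by move=> u _; rewrite subr0 mul1r mul0r addr0.
- by move=> u _; rewrite subrr mul0r mul1r add0r.
Qed.

Lemma germ_scale (k : V -> V) y (e e' rho : R) : embedding_near k y rho ->
  0 < e <= rho -> 0 < e' <= rho ->
  homotopic R S V0 (fun u => germ k y (e *: u)) (fun u => germ k y (e' *: u)).
Proof.
move=> [ck kinj] /andP[e0 er] /andP[e0' er'].
apply: (germ_scale_on ck) => //.
- by move=> a b /set_mem ka /set_mem kb; exact: kinj.
- by rewrite /= subrr normr0 (le_trans (ltW e0)).
- move=> c u /andP[c0 ce] Su /=; rewrite addrAC subrr add0r.
  rewrite (le_trans (norm_scale_sphere (ltW c0) Su))// (le_trans ce)//.
  by rewrite ge_max er.
Qed.

Lemma germ_small (k : V -> V) y (rho r : R) : embedding_near k y rho ->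
  0 < rho -> 0 < r ->
  exists dl, 0 < dl <= rho /\ forall v, `|v| <= dl -> `|germ k y v| <= r.
Proof.
move=> ek rho0 r0; have /within_cvgP/(_ 0) := within_germ ek.
rewrite /= normr0 => /(_ (ltW rho0)) /cvgrPdist_lt /(_ _ r0).
rewrite /germ addr0 subrr => h.
have : nbhs (0 : V) [set v | `|v| <= rho -> `|0 - (k (y + v) - k y)| < r] by exact: h.
move=> /nbhs_ballP[dl /= dl0 dP]; exists (Order.min (dl / 2) rho).
rewrite lt_min rho0 divr_gt0//= ge_min lexx orbT; split => // v.
rewrite le_min => /andP[v1 v2]; have /dP/(_ v2) : ball (0 : V) dl v.
  rewrite -ball_normE /= sub0r normrN (le_lt_trans v1)//.
  by rewrite ltr_pdivrMr// ltr_pMr// ltr1n.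
by rewrite sub0r normrN => /ltW.
Qed.

Lemma within_germ_scale (k : V -> V) y (e rho : R) : embedding_near k y rho ->
  0 < e <= rho -> {within S, continuous (fun u => germ k y (e *: u))} /\
  set_fun S V0 (fun u => germ k y (e *: u)).
Proof.
move=> ek /andP[e0 er].
have m u : S u -> `|e *: u| <= rho.
  by move=> Su; rewrite (le_trans (norm_scale_sphere (ltW e0) Su)).
split; last first.
  move=> u Su; apply/eqP; apply: (germ_neq0 ek); first exact: m.
  by rewrite scaler_eq0 negb_or gt_eqF//= sphere_neq0.
apply: (@within_comp _ _ _ S _ (fun u => e *: u) (germ k y) _ (within_germ ek)) => //.
apply/within_cvgP => u _; apply: cvgZ; first exact: cvg_cst.
exact: cvg_within_id.
Qed.

(* The third hypothesis says that h has local degree 1 at y. *)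
Lemma germ_degree1 (h w : V -> V) y (rho e : R) : embedding_near h y rho ->
  0 < e <= rho -> homotopic R S V0 (fun u => germ h y (e *: u)) id ->
  {within S, continuous w} -> set_fun S V0 w -> (forall u, S u -> `|w u| <= rho) ->
  homotopic R S V0 (germ h y \o w) w.
Proof.
move=> eh /andP[e0 er] h1 cw w0 wr.
have nS : set_fun S S (normalize \o w).
  by move=> u Su; apply: sphere_normalize; exact/eqP/w0.
have step1 : homotopic R S V0 (germ h y \o w)
    (germ h y \o (fun u => e *: normalize (w u))).
  apply: (germ_homotopic (rho := rho)) => //; first exact: lt_le_trans er.
    by move=> u Su; rewrite (le_trans (norm_scale_sphere (ltW e0) (nS _ Su))).
  exact: homotopic_normalize.
apply: homotopic_trans step1 _.
apply: homotopic_trans (homotopic_pre (within_normalize cw w0) nS h1) _.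
apply: homotopic_sym; have := homotopic_normalize ltr01 cw w0.
by apply: homotopic_ext => // u _ /=; rewrite scale1r.
Qed.

End SphereHomotopies.

Section OrientedAtlas.
Variables (R : realType) (n : nat) (T : topologicalType) (C : set T).
Variable atlas : set (chart R n T).
Hypothesis atlasP : oriented_atlas C atlas.
Local Notation V := 'rV[R]_n.
Local Notation V0 := (~` [set (0 : V)]).
Local Notation S := (unit_sphere R n).
Implicit Types (f : V -> T) (a : V -> V) (c : chart R n T) (U : set V).

Definition adapted f x c rho := [/\ atlas c, 0 < rho,
  forall z, `|z - x| <= rho -> chart_dom c (f z) &
  embedding_near (chart_map c \o f) x rho].

(* the homotopy class a is the local orientation at x of the atlas, read in
   the coordinates f *)
Definition local_class f x a := exists c rho e, [/\ adapted f x c rho, 0 < e <= rho &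
  homotopic R S V0 (fun u => germ (chart_map c \o f) x (e *: u)) a].

Lemma adapted_sub f x x' c rho rho' : adapted f x c rho -> 0 < rho' ->
  `|x' - x| + rho' <= rho -> adapted f x' c rho'.
Proof.
move=> [ca r0 fc ek] r0' xr; split => //; last exact: embedding_near_sub ek xr.
by move=> z zx; apply: fc; rewrite (le_trans (ler_distD x' _ _))//; lra.
Qed.

Lemma adapted_at f U x c : open_embedding U f -> U x -> atlas c ->
  chart_dom c (f x) -> exists rho, adapted f x c rho.
Proof.
move=> [oU cf finj _] Ux ca cx.
have oD : open (U `&` f @^-1` chart_dom c).
  apply: (continuous_inP _ oU).1; last exact: open_chart_dom.
  by rewrite -continuous_open_subspace.
have /nbhs_ballP[e /= e0 eD] : nbhs x (U `&` f @^-1` chart_dom c).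
  exact: open_nbhs_nbhs.
have sub z : `|z - x| <= e / 2 -> U z /\ chart_dom c (f z).
  move=> zx; apply: eD; rewrite -ball_normE /= distrC (le_lt_trans zx)//.
  by rewrite ltr_pdivrMr// ltr_pMr// ltr1n.
have [cm _ _ _ [cK _]] := chart_homeo c.
exists (e / 2); split => //.
- by rewrite divr_gt0.
- by move=> z /sub[].
split.
  apply: (@within_comp _ _ _ _ (chart_dom c) f (chart_map c)) => //.
    by apply: continuous_subspaceW cf => z /sub[].
  by move=> z /sub[].
move=> z z' /sub[Uz dz] /sub[Uz' dz'] /= e'.
apply: finj; rewrite ?inE//.
by rewrite -(cK _ (mem_set dz)) e' cK// inE.
Qed.

Lemma adapted_exists f U x : open_embedding U f -> U x -> C (f x) ->
  exists c rho, adapted f x c rho.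
Proof.
have [_ cover _] := atlasP.
move=> Uf Ux /cover[c ca cx]; exists c; exact: adapted_at Uf Ux ca cx.
Qed.

(** Near [x] the second chart reads [f] as [h \o k], where the transition map [h] has degree 1 at
    [k x]. On a sphere so small that the germ of [k] stays where this degree is controlled,
    [germ_degree1] removes [h]. *)
Lemma adapted_compare f x c c' rho rho' e e' : adapted f x c rho ->
  adapted f x c' rho' -> 0 < e <= rho -> 0 < e' <= rho' ->
  homotopic R S V0 (fun u => germ (chart_map c \o f) x (e *: u))
                   (fun u => germ (chart_map c' \o f) x (e' *: u)).
Proof.
move=> [ca r0 fc ek] [ca' r0' fc' ek'] er er'.
set k := _ \o f in ek *; set k' := _ \o f in ek' *.
have [_ _ /(_ c c' ca ca')] := atlasP.
set h := _ \o _; set D := _ `&` _ => hor.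
have [_ ci cmf _ [cK ciK]] := chart_homeo c.
have [cm' _ _ _ [cK' _]] := chart_homeo c'.
have xx : `|x - x| <= rho by rewrite subrr normr0 ltW.
have xx' : `|x - x| <= rho' by rewrite subrr normr0 ltW.
have cfK z : `|z - x| <= rho -> chart_inv c (k z) = f z.
  by move=> zx; rewrite /k /= cK// inE; exact: fc.
have Dk z : `|z - x| <= rho -> `|z - x| <= rho' -> D (k z).
  move=> zx zx'; split; first exact/cmf/fc.
  by rewrite /= cfK//; exact: fc'.
have oD : open D.
  apply: (continuous_inP _ (@open_chart_cod _ _ _ c)).1; last exact: open_chart_dom.
  by rewrite -continuous_open_subspace//; exact: open_chart_cod.
have ch : {within D, continuous h}.
  apply: (@within_comp _ _ _ D (chart_dom c') (chart_inv c) (chart_map c')) => //.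
    by apply: continuous_subspaceW ci => z [].
  by move=> z [].
have hinj : {in D &, injective h}.
  move=> a b /set_mem[ca1 ca2] /set_mem[cb1 cb2] hab.
  have : chart_inv c a = chart_inv c b.
    by rewrite -(cK' _ (mem_set ca2)) -(cK' _ (mem_set cb2)); congr (chart_inv c' _).
  by move=> hab'; rewrite -(ciK _ (mem_set ca1)) -(ciK _ (mem_set cb1)) hab'.
have Dkx := Dk _ xx xx'.
have [e1 [e10 e1D h1]] := hor _ Dkx.
have /nbhs_ballP[d /= d0 dD] : nbhs (k x) D by exact: open_nbhs_nbhs.
pose rho1 := Order.min (d / 2) e1.
have rho10 : 0 < rho1 by rewrite lt_min e10 divr_gt0.
have eh : embedding_near h (k x) rho1.
  have sub z : `|z - k x| <= rho1 -> D z.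
    rewrite le_min => /andP[zd _]; apply: dD; rewrite -ball_normE /= distrC.
    by rewrite (le_lt_trans zd)// ltr_pdivrMr// ltr_pMr// ltr1n.
  split; first by apply: continuous_subspaceW ch => z /sub.
  by move=> z z' /sub Dz /sub Dz'; apply: hinj; rewrite inE.
have h2 : homotopic R S V0 (fun u => germ h (k x) (rho1 *: u)) id.
  apply: homotopic_trans h1.
  apply: (germ_scale_on ch hinj) => // b u.
  have -> : Order.max rho1 e1 = e1 by rewrite max_r// ge_min lexx orbT.
  move=> /andP[b0 be] Su; apply: e1D; exists ((b / e1) *: u); last first.
    by rewrite scalerA mulrCA divff ?mulr1// gt_eqF.
  rewrite /closed_unit_ball /= sqnormZ Su mulr1 expr_le1// ?(divr_ge0 (ltW b0) (ltW e10))//.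
  by rewrite ler_pdivrMr// mul1r.
have [dl [/andP[dl0 dlr] dlP]] := germ_small ek r0 rho10.
pose e2 := Order.min dl rho'.
have e2r : 0 < e2 <= rho.
  by rewrite lt_min dl0 r0'/= ge_min dlr.
have e2r' : 0 < e2 <= rho'.
  by rewrite lt_min dl0 r0'/= ge_min lexx orbT.
have e20 := proj1 (andP e2r).
apply: homotopic_trans (germ_scale ek er e2r) _.
apply: homotopic_trans (germ_scale ek' e2r' er').
have [wc w0] := within_germ_scale ek e2r.
have small u : S u -> `|x + e2 *: u - x| <= rho /\ `|x + e2 *: u - x| <= rho'.
  move=> Su; rewrite addrAC subrr add0r; have e2u := norm_scale_sphere (ltW e20) Su.
  split; rewrite (le_trans e2u)//; first by case/andP: e2r.
  by case/andP: e2r'.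
apply: homotopic_sym.
have w1 u : S u -> `|germ k x (e2 *: u)| <= rho1.
  move=> Su; apply: dlP; rewrite (le_trans (norm_scale_sphere (ltW e20) Su))//.
  by rewrite ge_min lexx.
have rr : 0 < rho1 <= rho1 by rewrite rho10 lexx.
have := germ_degree1 eh rr h2 wc w0 w1.
apply: homotopic_ext => u Su //=.
have [s1 s2] := small _ Su.
by rewrite /germ [k x + _]addrC subrK /h /= !cfK.
Qed.

Lemma local_class_adapted f x a c rho e : local_class f x a -> adapted f x c rho ->
  0 < e <= rho -> homotopic R S V0 (fun u => germ (chart_map c \o f) x (e *: u)) a.
Proof.
move=> [c' [rho' [e' [ad er h]]]] ad' er'.
exact: homotopic_trans (adapted_compare ad' ad er' er) h.
Qed.

Lemma local_class_near f U x a : open_embedding U f -> U x -> C (f x) ->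
  nbhs x [set x' | local_class f x a <-> local_class f x' a].
Proof.
move=> Uf Ux Cx; have [c [rho ad]] := adapted_exists Uf Ux Cx.
have [_ r0 _ ek] := ad; have r2 : 0 < rho / 2 by rewrite divr_gt0.
apply/nbhs_ballP; exists (rho / 2) => //= x'; rewrite -ball_normE /= distrC => /ltW xx'.
have xr : `|x' - x| + rho / 2 <= rho by rewrite [leRHS]splitr lerD2r.
have ad' := adapted_sub ad r2 xr.
have er : 0 < rho / 2 <= rho by rewrite r2/=; lra.
have er' : 0 < rho / 2 <= rho / 2 by rewrite r2/=.
have mv := germ_move r2 ek xr.
split => h.
  exists c, (rho / 2), (rho / 2); split => //.
  exact: homotopic_trans (homotopic_sym mv) (local_class_adapted h ad er).
exists c, rho, (rho / 2); split => //.
exact: homotopic_trans mv (local_class_adapted h ad' er').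
Qed.

(** By [local_class_near] the property is locally constant along the path, and [0, 1] is
    connected. *)
Lemma local_class_path f U a (gam : R -> V) : open_embedding U f ->
  continuous gam -> (forall t : R, 0 <= t <= 1 -> U (gam t) /\ C (f (gam t))) ->
  local_class f (gam 0) a -> local_class f (gam 1) a.
Proof.
move=> Uf cg UC h0; pose Q t := local_class f (gam t) a.
have near (t : R) : 0 <= t <= 1 -> nbhs t [set t' | Q t <-> Q t'].
  move=> /UC[Ut Ct]; exact: (cg t _ (local_class_near a Uf Ut Ct)).
pose I := (`[0%R, 1%R]%classic : set R).
have IE (t : R) : I t <-> 0 <= t <= 1 by rewrite /I /= in_itv.
suff e : I `&` [set t | Q t] = I.
  have : I 1 by apply/IE; rewrite ler01 lexx.
  by rewrite -e => -[].
apply: (@segment_connected R 0 1).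
- by exists 0; split => //; apply/IE; rewrite lexx ler01.
- exists ([set t | I t -> Q t]^°); first exact: open_interior.
  apply/seteqP; split => t [It Qt]; split => //.
    have /near : 0 <= t <= 1 by apply/IE.
    rewrite /interior /=; apply: filterS => t' /= tt' _; exact/tt'.
  by apply: (interior_subset Qt).
- exists (~` ([set t | I t -> ~ Q t]^°)).
    by apply: open_closedC; exact: open_interior.
  apply/seteqP; split => t [It Qt]; split => //.
    by move=> /interior_subset /(_ It).
  apply: contrapT => nQ; apply: Qt.
  have /near : 0 <= t <= 1 by apply/IE.
  rewrite /interior /=; apply: filterS => t' /= tt' _ /tt'; exact: nQ.
Qed.

Lemma local_class_ext f g U x a : open_embedding U g -> U x ->
  nbhs x [set z | f z = g z] -> local_class f x a -> local_class g x a.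
Proof.
move=> Ug Ux /nbhs_ballP[d /= d0 dP] [c [rho [e [ad er h]]]].
have [ca r0 fc ek] := ad.
have fgx : f x = g x by apply: dP; exact: ballxx.
have xx : `|x - x| <= rho by rewrite subrr normr0 ltW.
have [rho' ad'] : exists rho', adapted g x c rho'.
  by apply: adapted_at Ug Ux ca _; rewrite -fgx; exact: fc.
have [_ r0' _ ek'] := ad'.
pose e' := Order.min (Order.min rho rho') (d / 2).
have e'0 : 0 < e' by rewrite !lt_min r0 r0' divr_gt0.
have e'r : 0 < e' <= rho by rewrite e'0/= !ge_min lexx.
have e'r' : 0 < e' <= rho' by rewrite e'0/= !ge_min lexx orbT.
have e'd : e' <= d / 2 by rewrite ge_min lexx orbT.
exists c, rho', e'; split => //.
apply: homotopic_ext (homotopic_trans (germ_scale ek e'r er) h) => // u Su.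
rewrite /germ /= fgx; congr (chart_map c _ - _); apply: dP.
rewrite -ball_normE /= opprD addrA subrr add0r normrN.
rewrite (le_lt_trans (norm_scale_sphere (ltW e'0) Su))// (le_lt_trans e'd)//.
by rewrite ltr_pdivrMr// ltr_pMr// ltr1n.
Qed.

End OrientedAtlas.

(** * Orientation classes and reflections *)

Section ReflectionObstruction.
Variables (R : realType) (n : nat).
Hypothesis n_gt0 : (0 < n)%N.
Local Notation V := 'rV[R]_n.
Local Notation V0 := (~` [set (0 : V)]).
Local Notation S := (unit_sphere R n).

(** Invariance of domain makes [k] an open embedding of an open ball; the coordinate map of the
    resulting chart is the inverse. *)
Lemma local_inverse (k : V -> V) x rho : embedding_near k x rho -> 0 < rho ->
  exists l rho', [/\ 0 < rho', embedding_near l (k x) rho' &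
    forall z, `|z - x| <= rho -> `|k z - k x| <= rho' -> l (k z) = z].
Proof.
case: n n_gt0 k x => [//|m] _ k x [ck kinj] r0.
pose U := [set z : 'rV[R]_m.+1 | `|z - x| < rho].
have oU : open U.
  apply: (@open_comp _ _ (fun z : 'rV[R]_m.+1 => `|z - x|) [set t | t < rho]).
    move=> z _; have : `|y - x| @[y --> nbhs z] --> `|z - x|; last exact.
    by apply: cvg_norm; apply: cvgB; [exact: cvg_id|exact: cvg_cst].
  exact: open_lt.
have UD z : U z -> `|z - x| <= rho by exact: ltW.
have cU : {within U, continuous k} by apply: continuous_subspaceW ck => z /UD.
have iU W : W `<=` U -> {in W &, injective k}.
  by move=> WU z z' /set_mem/WU/UD Uz /set_mem/WU/UD Uz'; exact: kinj.
have Uk : open_embedding U k.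
  split => //; first exact: (iU U).
  move=> W oW WU; apply: invariance_of_domain => //; last exact: iU.
  exact: continuous_subspaceW cU.
have [c [c1 c2 c3]] := open_embedding_chart Uk.
have [cm ci mm _ [cK ciK]] := chart_homeo c.
rewrite c1 c2 c3 in cm ci mm cK ciK.
have kUx : (k @` U) (k x) by exists x => //; rewrite /U /= subrr normr0.
have /nbhs_ballP[d /= d0 dU] : nbhs (k x) (k @` U).
  by apply: open_nbhs_nbhs; split => //; rewrite -c1; exact: open_chart_dom.
have sub y : `|y - k x| <= d / 2 -> (k @` U) y.
  move=> yx; apply: dU; rewrite -ball_normE /= distrC (le_lt_trans yx)//.
  by rewrite ltr_pdivrMr// ltr_pMr// ltr1n.
exists (chart_map c), (d / 2); split; first by rewrite divr_gt0.
- split; first by apply: continuous_subspaceW cm => y /sub.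
  move=> y y' /sub ky /sub ky' e.
  by rewrite -(cK _ (mem_set ky)) e cK// inE.
- move=> z zx kz; apply: kinj => //; last first.
    by rewrite cK// inE; exact: sub.
  by apply/UD/mm; exact: sub.
Qed.

Lemma id_not_homotopic_refl_pos : ~ homotopic R S V0 id (@refl R n).
Proof. by case: n n_gt0 => // m _; exact: id_not_homotopic_refl. Qed.

Lemma inversion_germ_pos (x : V) (e : R) : 0 < e < `|x| ->
  homotopic R S V0 (fun u : V => germ (@inversion R n) x (e *: u)) (@refl R n).
Proof. by case: n n_gt0 x => // m _ x; exact: inversion_germ. Qed.

Lemma germ_not_homotopic_refl (k : V -> V) x rho : embedding_near k x rho ->
  0 < rho -> ~ (forall e, 0 < e <= rho ->
    homotopic R S V0 (fun u : V => germ k x (e *: u))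
      (fun u : V => germ k x (e *: refl u))).
Proof.
move=> ek r0 h; have [l [rho' [r0' el lk]]] := local_inverse ek r0.
(* The radius must be small enough for the germ of [k] to land where the local inverse [l] is
   defined. *)
have [e [er small]] := germ_small ek r0 r0'.
have e0 := proj1 (andP er).
have small' u : S u -> `|germ k x (e *: u)| <= rho'.
  by move=> Su; apply: small; rewrite norm_scale_sphere// ltW.
have Srefl u : S u -> S (refl u) by rewrite /unit_sphere /= sqnorm_refl.
have lE u : S u -> germ l (k x) (germ k x (e *: u)) = e *: u.
  move=> Su; rewrite /germ [k x + _]addrC subrK lk; last first.
  - exact: small'.
  - rewrite addrAC subrr add0r (le_trans (norm_scale_sphere (ltW e0) Su))//.
    by case/andP: er.
  rewrite lk ?subrr ?normr0 ?ltW//.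
  by rewrite addrAC subrr add0r.
have := germ_homotopic r0' el (w := fun u : V => germ k x (e *: u))
  (w' := fun u : V => germ k x (e *: refl u)) small'
  (fun u Su => small' _ (Srefl u Su)) (h _ er).
move=> h1; apply: id_not_homotopic_refl_pos.
have s1 : homotopic R S V0 id (fun u : V => e *: u).
  apply: homotopic_ext (homotopic_scale_id n ltr01 e0) => // u _.
  by rewrite scale1r.
apply: homotopic_trans s1 _.
have s2 : homotopic R S V0 (fun u : V => e *: refl u) (@refl R n).
  have := homotopic_pre_refl (homotopic_sym (homotopic_scale_id n ltr01 e0)).
  by apply: homotopic_ext => // u _ /=; rewrite scale1r.
apply: homotopic_trans s2.
by apply: homotopic_ext h1 => u Su /=; rewrite lE//; exact: Srefl.
Qed.

Section Atlas.
Variables (T : topologicalType) (C : set T) (atlas : set (chart R n T)).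
Hypothesis atlasP : oriented_atlas C atlas.
Implicit Types (f : V -> T) (a : V -> V) (U : set V).

Lemma local_class_refl f x a : local_class atlas f x a ->
  ~ local_class atlas f x (a \o @refl R n).
Proof.
move=> h h'; have [c [rho [_ [ad _ _]]]] := h; have [_ r0 _ ek] := ad.
apply: (germ_not_homotopic_refl ek r0) => e er.
have h1 := local_class_adapted atlasP h ad er.
have h2 := local_class_adapted atlasP h' ad er.
exact: homotopic_trans h2 (homotopic_sym (homotopic_pre_refl h1)).
Qed.

(** The germ of [f] is the germ of [f'] composed with that of the inversion, which is homotopic to a
    reflection. So [a] is the class of [f'] precomposed with [refl], and [refl] is an involution. *)
Lemma local_class_inversion f f' U U' x a : open_embedding U f -> U x -> x != 0 ->
  open_embedding U' f' -> U' (inversion x) -> C (f' (inversion x)) ->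
  nbhs x [set z | f z = f' (inversion z)] ->
  local_class atlas f x a -> local_class atlas f' (inversion x) (a \o @refl R n).
Proof.
move=> Uf Ux x0 Uf' Ux' Cx' ff' h.
set x' := inversion x in Ux' Cx' *.
have [c [rho' ad']] := adapted_exists atlasP Uf' Ux' Cx'.
have [ca r0' fc' ek'] := ad'.
have fx : f x = f' x' by exact: (nbhs_singleton ff').
have [rho ad] : exists rho, adapted atlas f x c rho.
  apply: adapted_at Uf Ux ca _; rewrite fx; apply: fc'.
  by rewrite subrr normr0 ltW.
have [_ r0 _ ek] := ad.
have near_inv : nbhs x [set z | `|inversion z - x'| <= rho'].
  have /cvgrPdist_le/(_ _ r0') := cvg_inversion x0.
  by apply: filterS => z; rewrite distrC.
have /nbhs_ballP[d /= d0 dP] : nbhs x ([set z | f z = f' (inversion z)] `&`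
    [set z | `|inversion z - x'| <= rho']) by exact: filterI.
(* Three bounds: the chart adapted to [f], the region where [f] is [f'] after inversion with values
   in the ball of radius [rho'], and the condition [e < |x|] of [inversion_germ]. *)
pose e := Order.min rho (Order.min (d / 2) (`|x| / 2)).
have nx0 : 0 < `|x| by rewrite normr_gt0.
have e0 : 0 < e by rewrite !lt_min r0 !divr_gt0.
have er : 0 < e <= rho by rewrite e0/= ge_min lexx.
have ed : e <= d / 2 by rewrite !ge_min lexx orbT.
have ex : e <= `|x| / 2 by rewrite !ge_min lexx !orbT.
have eP u : S u -> f (x + e *: u) = f' (inversion (x + e *: u)) /\
    `|germ (@inversion R n) x (e *: u)| <= rho'.
  move=> Su; apply: dP; rewrite -ball_normE /= opprD addrA subrr add0r normrN.
  by rewrite (le_lt_trans (norm_scale_sphere (ltW e0) Su))//; lra.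
set k' := chart_map c \o f' in ek'.
have ee : 0 < e < `|x| by rewrite e0/=; lra.
have Srefl u : S u -> S (refl u) by rewrite /unit_sphere /= sqnorm_refl.
have h1 : homotopic R S V0 (fun u : V => germ (@inversion R n) x (e *: u))
    (fun u : V => rho' *: refl u).
  apply: homotopic_trans (inversion_germ_pos ee) _.
  have := homotopic_pre_refl (homotopic_scale_id n ltr01 r0').
  by apply: homotopic_ext => // u _ /=; rewrite scale1r.
have h2 := germ_homotopic r0' ek' (fun u Su => (eP u Su).2)
  (fun u Su => norm_scale_sphere (ltW r0') (Srefl u Su)) h1.
have h3 : homotopic R S V0 a (fun u => germ k' x' (rho' *: refl u)).
  apply: homotopic_trans (homotopic_sym (local_class_adapted atlasP h ad er)) _.
  apply: homotopic_ext h2 => // u Su /=.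
  rewrite /germ /k' /= fx (eP u Su).1 [inversion x + _]addrC subrK//.
have h4 := homotopic_pre_refl h3.
exists c, rho', rho'; split => //; first by rewrite r0' lexx.
apply: homotopic_sym; apply: homotopic_ext h4 => // u _ /=.
by rewrite reflK.
Qed.

End Atlas.
End ReflectionObstruction.

(** * From an oriented atlas to a parity functional *)

Section ParityOfOrientation.
Variables (R : realType) (n : nat) (d : Order.disp_t) (P : finBPOrderType d).
Variable X : small_cover R n P.
Local Notation V := 'rV[R]_n.
Local Notation A := (carrier_circ X).
Local Notation Y := (small_cover_circ X).
Local Notation facet s := (cell_rank X s = 1%N).
Implicit Types (x z : V) (xi eta g : signs n) (s : P).

Lemma param_coset_part g U xi eta x : param_dom X g U -> U x ->
  xi - eta \in facet_group X -> g \in facet_group X ->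
  coset_part (X := X) eta (param X g xi x).
Proof.
move=> gU Ux h gG; rewrite /param; case: ifPn => [x1|].
  by apply/coset_partP => //; exact: param_dom_carrier gU Ux x1.
rewrite -ltNge => x1; apply/coset_partP.
  exact/unit_ball_carrier/inversion_ball.
by rewrite addrAC; exact: facet_groupD.
Qed.

Lemma near_ball x : sqnorm x < 1 -> nbhs x [set z : V | sqnorm z < 1].
Proof.
move=> x1; suff : nbhs x (@sqnorm R n @^-1` [set t | t < 1]) by [].
apply: continuous_sqnorm; apply: open_nbhs_nbhs.
by split => //; exact: open_lt.
Qed.

Lemma near_exterior x : 1 < sqnorm x -> nbhs x [set z : V | 1 < sqnorm z].
Proof.
move=> x1; suff : nbhs x (@sqnorm R n @^-1` [set t | 1 < t]) by [].
apply: continuous_sqnorm; apply: open_nbhs_nbhs.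
by split => //; exact: open_gt.
Qed.

(** The class is transported in the unfolded chart from 0 through a facet point [x0] to [2 *: x0].
    There the chart of the chamber [xi + g] takes over at the inverse point, half of [x0], at the
    cost of one reflection, and a segment leads back to 0. *)
Lemma cross_facet (atlas : set (chart R n Y)) s g xi a :
  oriented_atlas (coset_part (X := X) 0) atlas -> (0 < n)%N -> facet s -> g != 0 ->
  (forall xi, xi \in sbar X s <-> xi = 0 \/ xi = g) -> xi \in facet_group X ->
  local_class atlas (param X 0 xi) 0 a ->
  local_class atlas (param X 0 (xi + g)) 0 (a \o @refl R n).
Proof.
move=> atlasP n0 s1 g0 gP xiG h.
pose U := [set x : V | sqnorm x != 1 \/ face X s x].
have gU : param_dom X g U by right; exists s.
have bU : param_dom X 0 (unit_ball R n) by left.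
have gG : g \in facet_group X by apply: (sbar_facet_group s1); apply/gP; right.
have zG := facet_group0 X.
have xigG : xi + g \in facet_group X by exact: facet_groupD.
have [x0 sx0] : exists x, face X s x.
  have [f [f' [_ _ _ fF _]]] := face_cell X s.
  by exists (f' 0); apply: fF; rewrite /unit_ball /= sqnorm0 ltr01.
have x01 : sqnorm x0 = 1 := face_sphere s1 sx0.
have U0 : U 0 by left; rewrite sqnorm0 eq_sym oner_eq0.
have h1 : local_class atlas (param X g xi) 0 a.
  apply: (local_class_ext (param_embedding xi gU) U0 _ h).
  have z1 : sqnorm (0 : V) < 1 by rewrite sqnorm0 ltr01.
  by apply: filterS (near_ball z1) => z /= z2; rewrite /param ltW.
have cray : continuous (fun t : R => (2 * t) *: x0).
  move=> t; have : (2 * u) *: x0 @[u --> nbhs t] --> (2 * t) *: x0; last exact.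
  apply: cvgZ; last exact: cvg_cst.
  by apply: cvgM; [exact: cvg_cst|exact: cvg_id].
have Uray (t : R) : 0 <= t <= 1 -> U ((2 * t) *: x0).
  move=> /andP[t0 t1]; rewrite /U /= sqnormZ x01 mulr1.
  (* The path meets the sphere only at t = 1/2, in the facet point [x0]. *)
  have [->|t2] := eqVneq t 2^-1; first by right; rewrite divff// scale1r.
  left; apply: contra_neq t2 => /eqP; rewrite sqrp_eq1 ?mulr_ge0// => /eqP; lra.
have h2 : local_class atlas (param X g xi) ((2 * 1) *: x0) a.
  apply: (local_class_path atlasP (param_embedding xi gU) cray).
    move=> t t01; split; first exact: Uray.
    apply: param_coset_part gU (Uray _ t01) _ gG.
    by rewrite subr0.
  by rewrite mulr0 scale0r.
rewrite mulr1 in h2.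
have sq4 : sqnorm (2 *: x0) = 4 by rewrite sqnormZ x01; ring.
have sq41 : 1 < sqnorm (2 *: x0) by rewrite sq4; lra.
have U2 : U (2 *: x0) by left; rewrite gt_eqF.
have x2 : 2 *: x0 != 0 by rewrite -sqnorm_gt0 sq4.
have bx : unit_ball R n (inversion (2 *: x0)) by exact: inversion_ball.
have Cball eta z : eta \in facet_group X -> unit_ball R n z ->
    coset_part (X := X) 0 (param X 0 eta z).
  by move=> etaG z1; apply: param_coset_part bU z1 _ zG; rewrite subr0.
have h3 : local_class atlas (param X 0 (xi + g)) (inversion (2 *: x0))
    (a \o @refl R n).
  apply: (local_class_inversion n0 atlasP (param_embedding xi gU) U2 x2
    (param_embedding (xi + g) bU) bx (Cball _ _ xigG bx) _ h2).
  apply: filterS (near_exterior sq41) => z /= z1.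
  rewrite /param leNgt z1 /= ifT//; apply: ltW; exact: inversion_ball.
have cray' : continuous (fun t : R => (1 - t) *: inversion (2 *: x0)).
  move=> t; have : (1 - u) *: inversion (2 *: x0) @[u --> nbhs t] -->
    (1 - t) *: inversion (2 *: x0); last exact.
  apply: cvgZ; last exact: cvg_cst.
  by apply: cvgB; [exact: cvg_cst|exact: cvg_id].
have Bray (t : R) : 0 <= t <= 1 -> unit_ball R n ((1 - t) *: inversion (2 *: x0)).
  move=> /andP[t0 t1]; rewrite /unit_ball /= sqnormZ.
  have tt : (1 - t) ^+ 2 <= 1 by rewrite expr_le1 ?subr_ge0//; lra.
  by apply: le_lt_trans bx; apply: ler_piMl => //; exact: sqnorm_ge0.
have h4 : local_class atlas (param X 0 (xi + g)) ((1 - 1) *: inversion (2 *: x0))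
    (a \o @refl R n).
  apply: (local_class_path atlasP (param_embedding (xi + g) bU) cray').
    by move=> t t01; split; [exact: Bray|exact/Cball/Bray].
  by rewrite subr0 scale1r.
by move: h4; rewrite subrr scale0r.
Qed.

Lemma facet_generators : exists gen : P -> signs n, forall s, facet s ->
  gen s != 0 /\ forall xi, xi \in sbar X s <-> xi = 0 \/ xi = gen s.
Proof.
exists (fun s =>
  if pselect (facet s) is left s1 then sval (cid2 (facet_gen s1)) else 0).
by move=> s s1; case: pselect => // s1'; case: cid2.
Qed.

Lemma generator_facet s g xi : g != 0 ->
  (forall xi, xi \in sbar X s <-> xi = 0 \/ xi = g) ->
  generator (sbar X s) xi = (xi == g).
Proof.
move=> g0 gP; have sg : g \in sbar X s by apply/gP; right.
apply/eqP/eqP => [e|->].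
  have /gP[xi0|//] : xi \in sbar X s by rewrite e cycle_id.
  by move: sg; rewrite e xi0 cycle1 inE => /eqP g1; rewrite g1 eqxx in g0.
apply/eqP; rewrite finset.eqEsubset cycle_subG sg andbT.
by apply/fintype.subsetP => eta /gP[->|->]; [exact: group1|exact: cycle_id].
Qed.

(** The component of the chamber 0 suffices: a relation among the generators is a closed walk
    through its chambers, and an odd one would give the base chamber both [a] and [a \o refl]. *)
Lemma parity_of_orientable : orientable R n Y ->
  exists phi : 'cV['F_2]_n, forall s g, facet s -> g \in sbar X s -> g != 0 ->
    (g *m phi) ord0 ord0 = 1.
Proof.
move=> orY; have [[s0 s01]|nofacet] := pselect (exists s, facet s); last first.
  by exists 0 => s g s1; exfalso; apply: nofacet; exists s.
have n0 : (0 < n)%N by rewrite -s01 cell_rank_le.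
have A0 : A 0 := unit_ball_carrier X (origin_in_ball R n).
have [atlas atlasP] : exists atlas : set (chart R n Y),
    oriented_atlas (coset_part (X := X) 0) atlas.
  by apply: orY; exists (cpi X 0 0) => //; exact: component_cpi.
have bU : param_dom X 0 (unit_ball R n) by left.
have C0 : coset_part (X := X) 0 (param X 0 0 0).
  apply: param_coset_part bU (origin_in_ball R n) _ (facet_group0 X).
  by rewrite subrr facet_group0.
have [c [rho ad]] :=
  adapted_exists atlasP (param_embedding 0 bU) (origin_in_ball R n) C0.
have [_ r0 _ ek] := ad.
pose a u := germ (chart_map c \o param X 0 0) 0 (rho *: u).
have cls0 : local_class atlas (param X 0 0) 0 a.
  exists c, rho, rho; split => //; first by rewrite r0 lexx.
  have rr : 0 < rho <= rho by rewrite r0 lexx.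
  have [aw a0] := within_germ_scale ek rr.
  exact: homotopic_refl.
have [gen genP] := facet_generators.
pose b (e : 'F_2) := if e == 0 then a else a \o @refl R n.
(* Membership in [facet_group X] keeps the walk in the component that [atlas] covers. *)
pose Q (xi : signs n) (e : 'F_2) := xi \in facet_group X /\
  local_class atlas (param X 0 xi) 0 (b e).
have [|i v e /eqP Ki [vG h]|[_ h]|phi phiP] :=
    @odd_functional P (fun s => cell_rank X s == 1%N) n gen Q.
- by split; [exact: facet_group0|].
- have [g0 gP] := genP _ Ki; split.
    by apply: facet_groupD => //; apply: (sbar_facet_group Ki); apply/gP; right.
  have -> : b (e + 1) = b e \o @refl R n.
    rewrite /b; have [->|/F2_eq1->] := eqVneq e 0; first by rewrite add0r.
    rewrite (addrr_pchar2 (pchar_Fp _))//= ?oner_eq0.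
    by apply/funext => u /=; rewrite reflK.
  exact: cross_facet g0 gP vG h.
- by apply: (local_class_refl n0 atlasP cls0 h).
exists phi => s g s1 sg g0; rewrite -(phiP s) ?s1//.
have [_ gP] := genP _ s1; have /gP[g0'|-> //] := sg.
by rewrite g0' eqxx in g0.
Qed.

End ParityOfOrientation.

Theorem theorem2p1 (R : realType) (n : nat) (d : Order.disp_t)
    (P : finBPOrderType d) (X : small_cover R n P) :
  (orientable R n (small_cover_circ X) <->
     exists b : n.-tuple (signs n),
       basis_of fullv b /\
       forall s : P, cell_rank X s = 1%N ->
         exists B : {set 'I_n},
           odd #|B| /\ generator (sbar X s) (\sum_(i in B) tnth b i))
  /\
  (exists f : coset_of (facet_group X) -> set (small_cover_circ X),
     set_bij [set: coset_of (facet_group X)]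
       (components (small_cover_circ X)) f /\
     forall xi : signs n, chamber X xi `<=` f (coset (facet_group X) xi)).
Proof.
split; last exact: components_coset.
have [gen genP] := facet_generators X.
(* A group of order 2 has one generator, so the condition in the theorem is an equation for
   [gen s]. *)
have genE s xi : cell_rank X s = 1%N ->
    generator (sbar X s) xi <-> gen s = xi.
  move=> /genP[g0 gP]; rewrite (generator_facet _ g0 gP).
  by split => [/eqP|->].
split=> [/parity_of_orientable[phi phiP]|[b [bb bP]]].
  have [s /eqP s1|b [bb bP]] := @functional_odd_basis
    P (fun s => cell_rank X s == 1%N) n gen phi.
    have [g0 gP] := genP _ s1.
    by apply: (phiP s) => //; apply/gP; right.
  exists b; split => // s s1; have [B [oB gB]] := bP s (introT eqP s1).
  by exists B; split => //; apply/(genE s _ s1).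
have [s /eqP s1|phi phiP] := @odd_basis_functional
    P (fun s => cell_rank X s == 1%N) n gen b bb.
  by have [B [oB /(genE s _ s1) gB]] := bP s s1; exists B.
apply: (orientable_of_parity (phi := fun v => (v *m phi) ord0 ord0)).
  by move=> u v; rewrite mulmxDl mxE.
move=> s g s1 sg g0; rewrite -(phiP s) ?s1//.
have [_ gP] := genP _ s1; have /gP[g0'|-> //] := sg.
by rewrite g0' eqxx in g0.
Qed.
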